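(* For all $\mu,\nu\in\mathfrak{M}^1_+(\Omega)$, the reduced measures relative to $g$ satisfy $$|\mu^*-\nu^*|\le|\mu-\nu|.$$
   Context: $|\lambda|$ denotes the total variation measure of a signed measure $\lambda$. Throughout: $\Omega\subset\mathbb{R}^N$ ($N\ge1$) is a bounded domain, $T>0$, $Q_T=\Omega\times(0,T)$, $\rho(x)=\operatorname{dist}(x,\partial\Omega)$, and $g:\mathbb{R}\to\mathbb{R}$ is continuous, nondecreasing and vanishes on $(-\infty,0]$. $\mathfrak{M}^1_+(\Omega)$ is the set of positive Radon measures $\mu$ on $\Omega$ with $\int_\Omega\rho\,d\mu<\infty$; $L^1_\rho(Q_T)$ is the set of measurable $f$ with $\iint_{Q_T}|f|\rho<\infty$. $C^{2,1}_{\ell,0}(\overline{Q_T})$ is the space of $C^{2,1}(\overline{Q_T})$ functions vanishing on $\partial\Omega\times[0,T]\cup\overline\Omega\times\{T\}$. For $\lambda\in\mathfrak{M}^1_+(\Omega)$, a weak solution of $\partial_tu-\Delta u+g(u)=0$ in $Q_T$, $u=0$ on $\partial\Omega\times(0,T)$, $u(\cdot,0)=\lambda$ is a $u\in L^1(Q_T)$ with $g(u)\in L^1_\rho(Q_T)$ and $\iint_{Q_T}(-u\partial_t\zeta-u\Delta\zeta+\zeta g(u))\,dx\,dt=\int_\Omega\zeta(x,0)\,d\lambda$ for all $\zeta\in C^{2,1}_{\ell,0}(\overline{Q_T})$; $\lambda$ is good if such a solution exists. Reduced measure of $\lambda$: with any nondecreasing sequence $\{g_k\}$ of continuous nondecreasing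 functions vanishing on $(-\infty,0]$, $0\le g_k(r)\le c_kr^p+c_k'$ ($r\ge0$, $p\in(1,(N+2)/(N+1))$), $g_k\to g$ pointwise, let $u_k$ be the weak solution with $g_k$ in place of $g$ and initial datum $\lambda$; $u_k\to u^*$ in $L^1(Q_T)$, $u^*$ is a weak solution with $g$ and initial datum a positive measure $\lambda^*\le\lambda$ (the initial trace of $u^*$), the reduced measure; equivalently $\lambda^*$ is the largest good measure below $\lambda$. *)

(* Defs.v *)
From HB Require Import structures.
From mathcomp Require Import all_boot all_order all_algebra.
From mathcomp Require Import all_classical all_reals all_analysis.
Set Implicit Arguments. Unset Strict Implicit. Unset Printing Implicit Defensive.
Import Order.TTheory GRing.Theory Num.Theory.
Import numFieldNormedType.Exports.
Local Open Scope classical_set_scope.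
Local Open Scope ring_scope.

Notation RN R N := (g_sigma_algebraType (@open 'rV[R]_N)).

Section Defs.
Variables (R : realType) (N : nat).

Definition enorm (x : 'rV[R]_N) : R := Num.sqrt (\sum_(i < N) x 0 i ^+ 2).

(** Lebesgue measure on the Borel sets of R^N, characterized by the volume of
    half-open boxes (this determines it uniquely). *)
Definition is_lebesgue (m : {measure set (RN R N) -> \bar R}) :=
  forall a b : 'rV[R]_N, (forall i, a 0 i <= b 0 i) ->
    m [set x : (RN R N) | forall i, a 0 i < (x : 'rV[R]_N) 0 i <= b 0 i]
    = (\prod_(i < N) (b 0 i - a 0 i))%:E.

Definition bounded_domain (O : set 'rV[R]_N) :=
  open O /\ connected O /\ O !=set0 /\ exists M : R, forall x, O x -> enorm x <= M.

Definition bdry (O : set 'rV[R]_N) := closure O `\` O.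

Definition rho (O : set 'rV[R]_N) (x : 'rV[R]_N) : R :=
  inf [set enorm (x - y) | y in bdry O].

Definition QT (O : set 'rV[R]_N) (T : R) : set ('rV[R]_N * R) :=
  [set p | O p.1 /\ 0 < p.2 < T].

Definition mQ (m : {measure set (RN R N) -> \bar R}) :=
  (m \x (@lebesgue_measure R))%E.

Definition ei (i : 'I_N) : 'rV[R]_N := delta_mx 0 i.
Definition dx (i : 'I_N) (f : 'rV[R]_N * R -> R) (p : 'rV[R]_N * R) : R :=
  derive1 (fun h : R => f (p.1 + h *: ei i, p.2)) 0.
Definition dt (f : 'rV[R]_N * R -> R) (p : 'rV[R]_N * R) : R :=
  derive1 (fun s : R => f (p.1, s)) p.2.
Definition lap (f : 'rV[R]_N * R -> R) (p : 'rV[R]_N * R) : R :=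
  \sum_(i < N) dx i (dx i f) p.

Definition ext_cont (S : set ('rV[R]_N * R)) (F : 'rV[R]_N * R -> R) :=
  exists G : 'rV[R]_N * R -> R,
    {within closure S, continuous G} /\ (forall p, S p -> F p = G p).

(** C^{2,1}(closure Q_T) functions vanishing on (bdry O) x [0,T] and on
    closure(O) x {T}. *)
Definition test_fun (O : set 'rV[R]_N) (T : R) (z : 'rV[R]_N * R -> R) :=
  [/\ forall p, QT O T p ->
        derivable (fun s : R => z (p.1, s)) p.2 1 /\
        forall i, derivable (fun h : R => z (p.1 + h *: ei i, p.2)) 0 1 /\
          forall j, derivable (fun h : R => dx j z (p.1 + h *: ei i, p.2)) 0 1,
      {within closure (QT O T), continuous z},
      ext_cont (QT O T) (dt z) /\ (forall i, ext_cont (QT O T) (dx i z)) /\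
      (forall i j, ext_cont (QT O T) (dx i (dx j z))),
      forall x t, bdry O x -> 0 <= t <= T -> z (x, t) = 0 &
      forall x, closure O x -> z (x, T) = 0].

(** M^1_+(O): positive Radon measures on O (represented as Borel measures on
    R^N carried by O, finite on compact subsets of O) with rho in L^1. *)
Definition Mplus1 (O : set 'rV[R]_N) (mu : {measure set (RN R N) -> \bar R}) :=
  [/\ mu (~` O : set (RN R N)) = 0%E,
      forall K : set 'rV[R]_N, compact K -> K `<=` O -> (mu (K : set (RN R N)) < +oo)%E &
      (\int[mu]_(x in (O : set (RN R N))) (rho O x)%:E < +oo)%E].

(** weak solution of  u_t - Lap u + g(u) = 0 in Q_T, u = 0 on bdry, u(.,0)=lam *)
Definition weak_sol (m : {measure set (RN R N) -> \bar R}) (O : set 'rV[R]_N) (T : R)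
  (g : R -> R) (lam : {measure set (RN R N) -> \bar R}) (u : 'rV[R]_N * R -> R) :=
  [/\ (mQ m).-integrable (QT O T : set ((RN R N) * R)) (fun p => (u p)%:E),
      (mQ m).-integrable (QT O T : set ((RN R N) * R))
          (fun p => (g (u p) * rho O p.1)%:E) &
      forall z, test_fun O T z ->
        (\int[mQ m]_(p in (QT O T : set ((RN R N) * R)))
            (- u p * dt z p - u p * lap z p + z p * g (u p))%:E
         = \int[lam]_(x in (O : set (RN R N))) (z (x, 0))%:E)%E].

Definition admissible_g (g : R -> R) :=
  [/\ continuous g, {homo g : x y / x <= y} & forall r, r <= 0 -> g r = 0].

Definition reduced_measure (m : {measure set (RN R N) -> \bar R}) (O : set 'rV[R]_N)
  (T : R) (g : R -> R) (lam lam' : {measure set (RN R N) -> \bar R}) :=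
  exists (gk : nat -> R -> R) (p : R) (c c' : nat -> R)
         (uk : nat -> 'rV[R]_N * R -> R) (u : 'rV[R]_N * R -> R),
  [/\ 1 < p < (N.+2)%:R / (N.+1)%:R,
      forall k, admissible_g (gk k) /\
        (forall r, 0 <= r -> gk k r <= c k * r `^ p + c' k),
      forall k r, gk k r <= gk k.+1 r,
      forall r, gk ^~ r @ \oo --> g r &
      forall k, weak_sol m O T (gk k) lam (uk k)] /\
  [/\
      (fun k => (\int[mQ m]_(q in (QT O T : set ((RN R N) * R)))
                   (`|uk k q - u q|)%:E)%E) @ \oo --> 0%E,
      Mplus1 O lam' &
      weak_sol m O T g lam' u].

(** total variation measure |mu - nu| of the (locally finite) signed measure
    mu - nu, evaluated on A: supremum over finite measurable partitions of
    subsets of A into pieces of finite mu- and nu-measure. *)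
Definition tv (mu nu : {measure set (RN R N) -> \bar R}) (A : set (RN R N)) : \bar R :=
  ereal_sup [set s : \bar R | exists (n : nat) (B : 'I_n -> set (RN R N)),
     [/\ forall i, measurable (B i),
         forall i, B i `<=` A,
         forall i j, i != j -> B i `&` B j = set0,
         forall i, (mu (B i) < +oo /\ nu (B i) < +oo)%E &
         s = (\sum_(i < n) `|mu (B i) - nu (B i)|)%E]].

End Defs.

(* Main.v *)
(** Everything is local in [O], so no regularity of the boundary is used. Let [v] be the limit
    solution for [mu'] and [u_k] the approximations for [nu], with absorptions [g_k <= g]. On a
    box [V] away from the boundary write [mu + beta = nu + alpha], with [alpha] and [beta] the
    positive and negative parts of [mu - nu] in a Hahn decomposition. Comparing with the
    approximations for [mu], whose absorption terms are nonnegative, gives [mu' <= mu], so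
    [mu' - nu <= alpha] on [V]. Kato's inequality for [w = v - u_k] needs only that
    [g v - g_k u_k >= 0] where [w > 0]; it yields
    [\iint w^+ (- z_t - Lap z) <= \int z(., 0) dalpha] for test functions [z >= 0]. Letting [k]
    tend to infinity and concentrating [z] at [t = 0] gives [\int f dmu' <= \int f dnu' +
    \int f dalpha] for [f >= 0] in the span of products of one-variable C^2 functions supported
    in the box, hence [mu' <= nu' + alpha] there; exchanging the roles of [mu] and [nu],
    [|mu' - nu'| <= alpha + beta = |mu - nu|]. Countably many boxes cover [O].

    Kato's inequality is proved by mollification. For products of one-variable functions,
    [- z_t - Lap z] is a bounded pointwise limit of finite differences, and for these the
    convexity inequality [j a - j b <= j'(a) (a - b)] and translation invariance replace the
    integrations by parts. *)
Require Import Defs.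
From HB Require Import structures.
From mathcomp Require Import all_boot all_order all_algebra.
From mathcomp Require Import all_classical all_reals all_analysis.
From mathcomp Require Import ring lra measurable_realfun.
Set Implicit Arguments. Unset Strict Implicit. Unset Printing Implicit Defensive.
Import Order.TTheory GRing.Theory Num.Theory.
Import numFieldNormedType.Exports.
Local Open Scope classical_set_scope.
Local Open Scope ring_scope.

(** * One-variable test functions *)

Section OneVariable.
Variable R : realType.
Implicit Types (f g p q : R -> R) (a b c x h : R).

(** The definition supplies the two reduced measures with unrelated approximating sequences, so the
    approximations for [mu] and [nu] cannot be compared level by level. Comparing the limit [v] with
    [u_k] needs only nonnegativity of the absorptions on one side and [g_k <= g] on the other. The
    difference [w] is merely integrable and satisfies its inequality only against test functions, so
    the inequality is first tested with the mollifying kernel itself. The kernel belonging to a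
    point [p] lives at times strictly before that of [p]. It is therefore an admissible test
    function as soon as the time of [p] is at most [T]. When its support straddles [t = 0], its
    values there bring in the initial measure as a source term. With [w] extended by zero to
    [t <= 0], initial data thus need no separate treatment. The same one-sidedness fits half-open
    boxes, whose indicators are then mollified correctly at every point. *)

Lemma is_derive1D f g x df dg : is_derive x 1 f df -> is_derive x 1 g dg ->
  is_derive x 1 (fun y => f y + g y) (df + dg).
Proof. by move=> hf hg; exact: is_deriveD. Qed.

Lemma is_derive1M f g x df dg : is_derive x 1 f df -> is_derive x 1 g dg ->
  is_derive x 1 (fun y => f y * g y) (df * g x + f x * dg).
Proof.
move=> hf hg; have := is_deriveM hf hg.
by rewrite addrC /GRing.scale/= [g x * df]mulrC.
Qed.

Lemma is_derive1Zl k f x df : is_derive x 1 f df ->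
  is_derive x 1 (fun y => k * f y) (k * df).
Proof. by move=> hf; exact: is_deriveZ. Qed.

Lemma is_derive1_addr f x c d : is_derive (x + c) 1 f d ->
  is_derive x 1 (fun y => f (y + c)) d.
Proof.
move=> hf; rewrite -[d]mulr1; apply: (@is_derive1_comp _ f (+%R^~ c)) => //.
by rewrite -[1 in X in is_derive _ _ _ X]addr0; exact: is_derive1D.
Qed.

Lemma is_derive1_subl f x c d : is_derive (c - x) 1 f d ->
  is_derive x 1 (fun y => f (c - y)) (- d).
Proof.
move=> hf; rewrite -mulrN1; apply: (@is_derive1_comp _ f (fun y => c - y)) => //.
by rewrite -[- 1]add0r; apply: is_derive1D.
Qed.

Lemma is_derive1_continuous f x d : is_derive x 1 f d -> {for x, continuous f}.
Proof. by move=> [fx _]; exact/differentiable_continuous/derivable1_diffP. Qed.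

Lemma is_derive1_derive1 f x d : is_derive x 1 f d -> derive1 f x = d.
Proof. by move=> fx; rewrite derive1E derive_val. Qed.

Definition posX n x : R := Num.max x 0 ^+ n.

Lemma posX_ge0 n x : 0 <= posX n x.
Proof. by rewrite exprn_ge0// le_max lexx orbT. Qed.

Lemma posX_le0 n x : x <= 0 -> posX n.+1 x = 0.
Proof. by move=> x0; rewrite /posX max_r// expr0n. Qed.

Lemma posX_gt0 n x : 0 < x -> 0 < posX n x.
Proof. by move=> x0; rewrite exprn_gt0// lt_max x0. Qed.

Lemma is_derive_posX n x :
  is_derive x 1 (posX n.+2) (n.+2%:R * posX n.+1 x).
Proof.
have [x0|x0|->] := ltgtP x 0.
- rewrite posX_le0 ?mulr0; last exact: ltW.
  apply: (@near_eq_is_derive _ _ _ (cst 0)).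
    near=> y; rewrite /= posX_le0//; near: y.
    by apply: filterS (lt_nbhsl x0) => y /ltW.
- have H : is_derive x 1 (fun y : R => y ^+ n.+2) (n.+2%:R * posX n.+1 x).
    have := is_deriveX n.+2 (is_derive_id x (1 : R)).
    by rewrite /GRing.scale/= mulr1 /posX (max_l (ltW x0)) exprfctE.
  apply: near_eq_is_derive H; near=> y; rewrite /posX max_l//; near: y.
  by apply: filterS (lt_nbhsr x0) => y /ltW.
rewrite posX_le0// mulr0.
(* At the kink the derivative is computed by hand: for [|h| < 1] the numerator is at most [|h|^2],
   so the quotient is at most [|h|]. *)
have H : (fun h => h^-1 *: ((posX n.+2 \o shift 0) (h *: 1) - posX n.+2 0))
    @ 0^' --> (0 : R).
  rewrite posX_le0//; under eq_fun do rewrite /= addr0 subr0 /GRing.scale/= mulr1.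
  apply/cvgr0Pnorm_lt => e e0; near=> h.
  have h0 : h != 0 by near: h; exact: nbhs_dnbhs_neq.
  have h1 : `|h| < Num.min e 1.
    by near: h; apply: dnbhs0_lt; rewrite lt_min e0 ltr01.
  move: h1; rewrite lt_min => /andP[he h1].
  rewrite normrM normfV /posX ger0_norm; last by rewrite exprn_ge0// le_max lexx orbT.
  rewrite mulrC ltr_pdivrMr ?normr_gt0//.
  apply: (@le_lt_trans _ _ (`|h| ^+ 2)).
    apply: (@le_trans _ _ (`|h| ^+ n.+2)).
      rewrite lerXn2r ?nnegrE ?le_max ?lexx ?orbT// ge_max ler_norm/=//.
    by rewrite -[n.+2]addn2 exprD ler_piMl// ?exprn_ge0// exprn_ile1// ltW.
  by rewrite expr2 ltr_pM2r ?normr_gt0.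
by apply: DeriveDef; [exact: cvgP H|exact: cvg_lim H].
Unshelve. all: by end_near.
Qed.

Lemma continuous_posX n : continuous (posX n.+1).
Proof.
move=> x.
have cm : {for x, continuous (fun y : R => Num.max y 0)}.
  by apply: continuous_max; [exact: cvg_id|exact: cvg_cst].
exact: continuous_comp cm (@exprn_continuous _ n.+1 _).
Qed.

(** The two derivatives are carried along as data, so that Laplacians can be written without
    [derive1]. Vanishing is required off the open interval, endpoints included; for [b <= a] this
    forces all three functions to be zero. *)
Definition C2c a b p p1 p2 := [/\ forall x, is_derive x 1 p (p1 x),
  forall x, is_derive x 1 p1 (p2 x), continuous p2 &
  forall x, ~~ (a < x < b) -> [/\ p x = 0, p1 x = 0 & p2 x = 0]].

(** The exponent 3 is the least for which a product of truncated powers is of class C^2 across both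
    endpoints. *)
Definition cbump a b x : R := posX 3 (x - a) * posX 3 (b - x).
Definition cbump1 a b x : R :=
  3%:R * posX 2 (x - a) * posX 3 (b - x) - posX 3 (x - a) * (3%:R * posX 2 (b - x)).
Definition cbump2 a b x : R :=
  6%:R * posX 1 (x - a) * posX 3 (b - x)
  - 18%:R * posX 2 (x - a) * posX 2 (b - x)
  + 6%:R * posX 3 (x - a) * posX 1 (b - x).

Lemma cbump_C2c a b : C2c a b (cbump a b) (cbump1 a b) (cbump2 a b).
Proof.
have dl n x : is_derive x 1 (fun y => posX n.+2 (y - a)) (n.+2%:R * posX n.+1 (x - a)).
  exact/is_derive1_addr/is_derive_posX.
have dr n x : is_derive x 1 (fun y => posX n.+2 (b - y)) (- (n.+2%:R * posX n.+1 (b - x))).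
  exact/is_derive1_subl/is_derive_posX.
split.
- move=> x; apply: is_derive_eq (is_derive1M (dl 1%N x) (dr 1%N x)) _.
  by rewrite /cbump1; ring.
- move=> x.
  have := is_derive1D (is_derive1Zl 3%:R (is_derive1M (dl 0%N x) (dr 1%N x)))
    (is_derive1Zl (- 3%:R) (is_derive1M (dl 1%N x) (dr 0%N x))).
  rewrite (_ : (fun _ => _) = cbump1 a b); last first.
    by apply/funext => y; rewrite /cbump1; ring.
  by move=> H; apply: is_derive_eq H _; rewrite /cbump2; ring.
- have cl n : continuous (fun x => posX n.+1 (x - a)).
    move=> x; apply: (@continuous_comp _ _ _ (fun x => x - a)); last exact: continuous_posX.
    by apply: cvgB; [exact: cvg_id|exact: cvg_cst].
  have cr n : continuous (fun x => posX n.+1 (b - x)).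
    move=> x; apply: (@continuous_comp _ _ _ (fun x => b - x)); last exact: continuous_posX.
    by apply: cvgB; [exact: cvg_cst|exact: cvg_id].
  move=> x; apply: cvgD; first apply: cvgB.
  + by apply: cvgM; [apply: cvgM; [exact: cvg_cst|exact: cl]|exact: cr].
  + by apply: cvgM; [apply: cvgM; [exact: cvg_cst|exact: cl]|exact: cr].
  + by apply: cvgM; [apply: cvgM; [exact: cvg_cst|exact: cl]|exact: cr].
- move=> x; rewrite negb_and -!leNgt => /orP[xa|bx].
  + by rewrite /cbump /cbump1 /cbump2 !(posX_le0 _ (_ : x - a <= 0)) ?subr_le0//;
      split; ring.
  + by rewrite /cbump /cbump1 /cbump2 !(posX_le0 _ (_ : b - x <= 0)) ?subr_le0//;
      split; ring.
Qed.

Lemma cbump_ge0 a b x : 0 <= cbump a b x.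
Proof. by rewrite mulr_ge0// posX_ge0. Qed.

Lemma cbump_gt0 a b x : a < x < b -> 0 < cbump a b x.
Proof. by case/andP=> ax xb; rewrite mulr_gt0// posX_gt0 ?subr_gt0. Qed.

Section C2c_theory.
Context {a b : R} {p p1 p2 : R -> R}.
Hypothesis pC : C2c a b p p1 p2.

Lemma C2c_derive x : is_derive x 1 p (p1 x). Proof. by case: pC. Qed.
Lemma C2c_derive1 x : is_derive x 1 p1 (p2 x). Proof. by case: pC. Qed.
Lemma C2c_continuous : continuous p.
Proof. by move=> x; exact/is_derive1_continuous/C2c_derive. Qed.
Lemma C2c_continuous1 : continuous p1.
Proof. by move=> x; exact/is_derive1_continuous/C2c_derive1. Qed.
Lemma C2c_continuous2 : continuous p2. Proof. by case: pC. Qed.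
Lemma C2c_out x : ~~ (a < x < b) -> p x = 0. Proof. by move=> ?; case: pC => _ _ _ /(_ x)[]. Qed.
Lemma C2c_out1 x : ~~ (a < x < b) -> p1 x = 0.
Proof. by move=> ?; case: pC => _ _ _ /(_ x)[]. Qed.
Lemma C2c_out2 x : ~~ (a < x < b) -> p2 x = 0.
Proof. by move=> ?; case: pC => _ _ _ /(_ x)[]. Qed.

Lemma compact_support_bounded (f : R -> R) : continuous f ->
  (forall x, ~~ (a < x < b) -> f x = 0) -> exists2 M, 0 <= M & forall x, `|f x| <= M.
Proof.
move=> cf f0; have [ab|ba] := leP a b; last first.
  exists 0 => // x; rewrite f0 ?normr0//; apply/negP => /andP[ax xb].
  by move: (lt_trans ba (lt_trans ax xb)); rewrite ltxx.
have cnf : {within `[a, b], continuous (fun x => `|f x|)}.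
  apply: continuous_subspaceT => x.
  exact: (continuous_comp (cf x) (@norm_continuous _ _ _)).
have [c _ hc] := EVT_max ab cnf.
exists `|f c| => // x; have [xab|nxab] := boolP (a < x < b).
  by apply: hc; rewrite in_itv/=; case/andP: xab => /ltW -> /ltW ->.
by rewrite f0// normr0.
Qed.

Lemma C2c_bounded : exists2 M, 0 <= M &
  forall x, [/\ `|p x| <= M, `|p1 x| <= M & `|p2 x| <= M].
Proof.
have [M M0 hM] := compact_support_bounded C2c_continuous C2c_out.
have [M1 M10 hM1] := compact_support_bounded C2c_continuous1 C2c_out1.
have [M2 M20 hM2] := compact_support_bounded C2c_continuous2 C2c_out2.
exists (M + M1 + M2); first by rewrite !addr_ge0.
by move=> x; split; [rewrite (le_trans (hM x))|rewrite (le_trans (hM1 x))|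
  rewrite (le_trans (hM2 x))]; lra.
Qed.

Lemma C2c_mvt x h : 0 < h -> exists2 y, x < y < x + h & p (x + h) - p x = p1 y * h.
Proof.
move=> h0; have xh : x < x + h by rewrite ltrDl.
have [||y] := @MVT _ p p1 _ _ xh.
- by move=> y _; exact: C2c_derive.
- exact/continuous_subspaceT/C2c_continuous.
by rewrite in_itv/= addrAC subrr add0r => ? ?; exists y.
Qed.

(* Rolle applied to [F s - (s / h)^2 F h], where [F s = p (x + s) + p (x - s) - 2 p x], gives a
   point with [p1 (x + y) - p1 (x - y) = 2 y F h / h^2]; the mean value theorem for [p1]
   concludes. *)
Lemma C2c_second_diff x h : 0 < h ->
  exists2 y, x - h < y < x + h & 2 * p x - p (x + h) - p (x - h) = - p2 y * h ^+ 2.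
Proof.
move=> h0.
pose D := (p (x + h) + p (x - h) - 2 * p x) / h ^+ 2.
pose G s := p (x + s) + p (x - s) - D * s ^+ 2.
have dG (s : R) : is_derive s 1 G (p1 (x + s) - p1 (x - s) - D * (2 * s)).
  apply: is_derive1D; first apply: is_derive1D.
  - rewrite (_ : (fun y => p (x + y)) = fun y => p (y + x)); last by apply/funext => ?; rewrite addrC.
    by apply: is_derive1_addr; rewrite addrC; exact: C2c_derive.
  - exact/is_derive1_subl/C2c_derive.
  rewrite (_ : (fun y => _) = fun y => (- D) * (y * y)); last by apply/funext => ?; rewrite mulNr expr2.
  have dd : is_derive s 1 (fun y : R => y * y) (1 * s + s * 1) by apply: is_derive1M.
  apply: is_derive_eq (is_derive1Zl _ dd) _; ring.
have [|||y] := @Rolle _ G _ _ h0.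
- by move=> s _; case: (dG s).
- by apply: continuous_subspaceT => s; exact: is_derive1_continuous (dG s).
- by rewrite /G /D addr0 subr0; field; rewrite gt_eqF.
rewrite in_itv/= => /andP[y0 yh] [_ dGy].
have : p1 (x + y) - p1 (x - y) - D * (2 * y) = 0.
  by case: (dG y) => _ <-.
have xy : x - y < x + y by rewrite ltrD2l; lra.
have [||z] := @MVT _ p1 p2 _ _ xy.
- by move=> z _; exact: C2c_derive1.
- exact/continuous_subspaceT/C2c_continuous1.
rewrite in_itv/= => /andP[z1 z2] ->; rewrite (_ : x + y - _ = 2 * y); last by ring.
rewrite -mulrBl => /eqP; rewrite mulf_eq0 (gt_eqF (_ : 0 < 2 * y)) ?orbF; last lra.
rewrite subr_eq0 => /eqP p2D; exists z; first by apply/andP; split; lra.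
by rewrite p2D /D; field; rewrite gt_eqF.
Qed.

Lemma C2c_translate c : C2c (a + c) (b + c) (fun x => p (x - c)) (fun x => p1 (x - c))
  (fun x => p2 (x - c)).
Proof.
split.
- by move=> x; exact/is_derive1_addr/C2c_derive.
- by move=> x; exact/is_derive1_addr/C2c_derive1.
- move=> x; apply: (@continuous_comp _ _ _ (fun x => x - c)); last exact: C2c_continuous2.
  by apply: cvgB; [exact: cvg_id|exact: cvg_cst].
- move=> x; rewrite -(ltrBlDr x c b) -(ltrBrDr a x c) => xab.
  by split; [exact: C2c_out|exact: C2c_out1|exact: C2c_out2].
Qed.

Lemma C2c_widen a' b' : a' <= a -> b <= b' -> C2c a' b' p p1 p2.
Proof.
move=> aa bb; case: pC => h1 h2 h3 h4; split => // x xab; apply: h4.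
by apply: contra xab => /andP[ax xb]; rewrite (le_lt_trans aa)// (lt_le_trans xb).
Qed.

Lemma C2cZ k : C2c a b (fun x => k * p x) (fun x => k * p1 x) (fun x => k * p2 x).
Proof.
split.
- by move=> x; exact/is_derive1Zl/C2c_derive.
- by move=> x; exact/is_derive1Zl/C2c_derive1.
- by move=> x; apply: cvgM; [exact: cvg_cst|exact: C2c_continuous2].
- move=> x xab; rewrite (C2c_out xab) (C2c_out1 xab) (C2c_out2 xab) mulr0.
  by split.
Qed.

End C2c_theory.

Lemma C2cM a b p p1 p2 q q1 q2 : C2c a b p p1 p2 -> C2c a b q q1 q2 ->
  C2c a b (fun x => p x * q x) (fun x => p1 x * q x + p x * q1 x)
    (fun x => p2 x * q x + 2 * p1 x * q1 x + p x * q2 x).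
Proof.
move=> pC qC; split.
- by move=> x; exact: is_derive1M (C2c_derive pC x) (C2c_derive qC x).
- move=> x; apply: is_derive_eq.
    apply: is_derive1D.
      exact: is_derive1M (C2c_derive1 pC x) (C2c_derive qC x).
    exact: is_derive1M (C2c_derive pC x) (C2c_derive1 qC x).
  ring.
- move=> x; apply: cvgD; first apply: cvgD.
  + by apply: cvgM; [exact: (C2c_continuous2 pC)|exact: (C2c_continuous qC)].
  + apply: cvgM; last exact: (C2c_continuous1 qC).
    by apply: cvgM; [exact: cvg_cst|exact: (C2c_continuous1 pC)].
  + by apply: cvgM; [exact: (C2c_continuous pC)|exact: (C2c_continuous2 qC)].
- move=> x xab; rewrite (C2c_out pC)// (C2c_out1 pC)// (C2c_out2 pC)//.
  by rewrite (C2c_out qC)// (C2c_out1 qC)// (C2c_out2 qC)//; split; ring.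
Qed.

End OneVariable.

(** * Boxes and Borel sets *)

Notation TR R := (measurableTypeR R).
Notation XT R N := (RN R N * TR R)%type.

Section Boxes.
Variables (R : realType) (N : nat).
Implicit Types (a b c : 'rV[R]_N) (U : set 'rV[R]_N).

Lemma continuous_measurable_RN (f : 'rV[R]_N -> R) : continuous f ->
  measurable_fun setT (f : RN R N -> R).
Proof.
move=> /continuousP cf; apply: (measurability _ (measurable_realfun.RGenOpens.measurableE R)).
move=> _ [_ [x [y ->]] <-]; rewrite setTI; apply: sub_sigma_algebra.
by apply: cf; exact: interval_open.
Qed.

Lemma continuous_measurable_RN_RN (f : 'rV[R]_N -> 'rV[R]_N) : continuous f ->
  measurable_fun setT (f : RN R N -> RN R N).
Proof.
move=> /continuousP cf; apply: (measurability (@open 'rV[R]_N : set (set (RN R N))) erefl).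
by move=> _ [A oA <-]; rewrite setTI; apply: sub_sigma_algebra; exact: cf.
Qed.

Lemma open_measurable_RN U : open U -> measurable (U : set (RN R N)).
Proof. by move=> oU; exact: sub_sigma_algebra. Qed.

Lemma measurable_coord (i : 'I_N) :
  measurable_fun setT ((fun x : 'rV[R]_N => x 0 i) : RN R N -> R).
Proof. by apply: continuous_measurable_RN => x; exact: coord_continuous. Qed.

(** Half-open boxes are those on which [is_lebesgue] prescribes the volume. As [a] and [b] need not
    be ordered, the empty box is included and the family is closed under intersection. *)
Definition hbox a b : set 'rV[R]_N := [set x | forall i, a 0 i < x 0 i <= b 0 i].
Definition hboxes : set (set (RN R N)) := [set A | exists a b, A = hbox a b].

Lemma measurable_hbox a b : measurable (hbox a b : set (RN R N)).
Proof.
rewrite (_ : hbox a b = \bigcap_(i in [set: 'I_N])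
    ((fun x : 'rV[R]_N => x 0 i) @^-1` `]a 0 i, b 0 i]%classic)).
  apply: fin_bigcap_measurable => // i _; rewrite -[X in measurable X]setTI.
  exact: (measurable_coord i).
apply/seteqP; split => x /= h i; first by move=> _; rewrite /= in_itv/=; exact: h.
by have := h i I; rewrite /= in_itv.
Qed.

Lemma hboxI : setI_closed hboxes.
Proof.
move=> _ _ [a [b ->]] [a' [b' ->]].
exists (\row_i Num.max (a 0 i) (a' 0 i)), (\row_i Num.min (b 0 i) (b' 0 i)).
apply/seteqP; split => x /=.
  move=> [h h'] i; rewrite !mxE gt_max le_min.
  by have /andP[-> ->] := h i; have /andP[-> ->] := h' i.
move=> h; split=> i; have := h i; rewrite !mxE gt_max le_min.
  by move=> /andP[/andP[-> _] /andP[-> _]].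
by move=> /andP[/andP[_ ->] /andP[_ ->]].
Qed.

Lemma rat_near (x e : R) : 0 < e -> exists q : rat, `|x - ratr q| < e.
Proof.
move=> e0; have [] := @dense_rat R (ball x e).
- by exists x; exact: ballxx.
- exact: ball_open.
by move=> y [] /[swap] -[q _ <-] xq; exists q.
Qed.

Definition rbox (q : 'rV[rat]_N * nat) : set 'rV[R]_N :=
  hbox (\row_i (ratr (q.1 0 i) - q.2.+1%:R^-1)) (\row_i (ratr (q.1 0 i) + q.2.+1%:R^-1)).

Definition rbox_in U (q : 'rV[rat]_N * nat) := exists2 r : R, 0 < r &
  forall x : 'rV[R]_N, (forall i, `|x 0 i - ratr (q.1 0 i)| <= q.2.+1%:R^-1 + r) -> U x.

Lemma open_bigcup_rbox U : open U -> U = \bigcup_(q in rbox_in U) rbox q.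
Proof.
move=> oU; apply/seteqP; split => [x Ux|x [q [r r0 qU] qx]]; last first.
  apply: qU => i; have := qx i; rewrite !mxE => /andP[h1 h2].
  move: (_^-1) (ratr _) (x 0 i) h1 h2 => e s y h1 h2.
  by rewrite ler_norml; apply/andP; split; lra.
have [d /= d0 dU] := (nbhs_ballP x U).1 (open_nbhs_nbhs (conj oU Ux)).
(* With [e = n.+1%:R^-1], the centre is within [e] of [x] and the enlarged cube has half-side [2 e],
   so every point of it is within [3 e < d] of [x]. *)
have d30 : 0 < d / 3 by rewrite divr_gt0.
have [n hn] : exists n, n.+1%:R^-1 < d / 3.
  by have [n _ /(_ n (leqnn n))] := near_infty_natSinv_lt (PosNum d30); exists n.
have n0 : 0 < n.+1%:R^-1 :> R by rewrite invr_gt0 ltr0n.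
have /choice [q hq] i := rat_near (x 0 i) n0.
exists (\row_i q i, n); last first.
  move=> i; have := hq i; rewrite !mxE ltr_norml => /andP[h1 h2].
  by move: (_^-1) (ratr _) (x 0 i) h1 h2 => e s y h1 h2; apply/andP; split; lra.
exists n.+1%:R^-1 => // y hy; apply: dU; split=> // i j; rewrite ord1 {i}.
have := hy j; have := hq j; rewrite !mxE /ball/= ltr_norml ltr_norml ler_norml/=.
move=> /andP[h1 h2] /andP[h3 h4].
move: (_^-1) hn (ratr _) (x 0 j) (y 0 j) h1 h2 h3 h4 => e hn s u v h1 h2 h3 h4.
by apply/andP; split; lra.
Qed.

(** Open sets are countable unions of rational cubes, hence boxes generate the Borel sets. Two
    measures can then be compared on boxes alone. *)
Lemma measurable_hboxes : @measurable _ (RN R N) = <<s hboxes >>.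
Proof.
apply/seteqP; split; last first.
  apply: smallest_sub; first exact: sigma_algebra_measurable.
  by move=> _ [a [b ->]]; exact: measurable_hbox.
apply: smallest_sub; first exact: smallest_sigma_algebra.
move=> U oU; rewrite (open_bigcup_rbox oU) bigcup_mkcond.
apply: (@countable_bigcupT_measurable _ (g_sigma_algebraType hboxes)) => //.
move=> q; case: ifP => _; last exact: measurable0.
by apply: sub_gen_smallest; eexists; eexists.
Qed.

End Boxes.

(** * Lebesgue measure and translations *)

(** Sigma-finiteness of [m] follows from [is_lebesgue] but is not part of its type; this turns the
    property into the structure on which Fubini's theorem is stated. *)
Lemma sigma_finite_measureP d (T : measurableType d) (R : realType)
    (m : {measure set T -> \bar R}) : sigma_finite setT m ->
  exists m' : {sigma_finite_measure set T -> \bar R}, m = m'.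
Proof.
move=> sf; pose H1 := isSFinite.Build _ _ _ _ (sfinite_measure_sigma_finite sf).
pose H2 := isSigmaFinite.Build _ _ _ _ sf.
pose m' := HB.pack_for (SigmaFiniteMeasure.type T R) (Measure.sort m) H1 H2.
by exists m'; exact: eq_measure.
Qed.

Lemma finite_measureP d (T : measurableType d) (R : realType)
    (m : {measure set T -> \bar R}) : (m setT < +oo)%E ->
  exists m' : {finite_measure set T -> \bar R}, m = m'.
Proof.
move=> moo.
have fm : fin_num_fun m.
  move=> A mA; rewrite ge0_fin_numE//; apply: le_lt_trans moo.
  by apply: le_measure; rewrite ?inE.
have sf : sigma_finite setT m by apply: fin_num_fun_sigma_finite; rewrite ?measure0.
pose H1 := isSFinite.Build _ _ _ _ (sfinite_measure_sigma_finite sf).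
pose H2 := isSigmaFinite.Build _ _ _ _ sf.
pose H3 := isFinite.Build _ _ _ _ fm.
pose m' := HB.pack_for (FiniteMeasure.type T R) (Measure.sort m) H1 H2 H3.
by exists m'; exact: eq_measure.
Qed.

Section LebesgueMeasure.
Variables (R : realType) (N : nat) (m : {measure set (RN R N) -> \bar R}).
Hypothesis hm : is_lebesgue m.
Implicit Types (a b c : 'rV[R]_N).

Lemma hbox_measure a b : m (hbox a b) = (\prod_(i < N) Num.max (b 0 i - a 0 i) 0)%:E.
Proof.
have [ab|] := pselect (forall i, a 0 i <= b 0 i).
  rewrite hm//; congr EFin; apply: eq_bigr => i _.
  by rewrite max_l// subr_ge0.
move=> /existsNP[i /negP]; rewrite -ltNge => ba.
rewrite (_ : hbox a b = set0) ?measure0; last first.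
  apply/seteqP; split => // x /(_ i)/andP[ax xb].
  by move: (lt_trans ba (lt_le_trans ax xb)); rewrite ltxx.
by rewrite (bigD1 i)//= max_r ?mul0r// subr_le0 ltW.
Qed.

Lemma bigcup_hbox_setT : \bigcup_(n : nat) hbox (const_mx (- n%:R)) (const_mx n%:R) = [set: 'rV[R]_N].
Proof.
apply/seteqP; split => // x _.
pose M := \sum_(i < N) `|x 0 i|.
exists (Num.truncn M).+1 => // i; rewrite !mxE.
have xM : `|x 0 i| < (Num.truncn M).+1%:R.
  apply: le_lt_trans (truncnS_gt M); rewrite /M (bigD1 i)//= lerDl.
  by apply: sumr_ge0.
by move: xM; rewrite ltr_norml => /andP[-> /ltW ->].
Qed.

Lemma lebesgue_sigma_finite : sigma_finite setT m.
Proof.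
exists (fun n => hbox (const_mx (- n%:R)) (const_mx n%:R)).
  by rewrite bigcup_hbox_setT.
move=> n; split; first exact: measurable_hbox.
by rewrite hbox_measure ltry.
Qed.

Lemma measurable_translate c :
  measurable_fun setT ((fun x : 'rV[R]_N => x + c) : RN R N -> RN R N).
Proof.
apply: continuous_measurable_RN_RN => x.
by apply: continuousD; [exact: cvg_id|exact: cst_continuous].
Qed.

(** The measure and its image under the translation agree on boxes, a generating pi-system, and
    cubes of finite mass exhaust the space. *)
Lemma lebesgue_translate c (A : set (RN R N)) : measurable A ->
  m ((fun x : 'rV[R]_N => x + c) @^-1` A) = m A.
Proof.
move=> mA.
pose phi : {mfun RN R N >-> RN R N} :=
  HB.pack ((fun x : 'rV[R]_N => x + c) : RN R N -> RN R N)
    (isMeasurableFun.Build _ _ _ _ _ (measurable_translate c)).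
apply/esym.
apply: (measure_unique (@hboxes R N)
  (fun n => hbox (const_mx (- n%:R)) (const_mx n%:R)) _ _ _ _ m (pushforward m phi)) => //.
- exact: measurable_hboxes.
- exact: hboxI.
- by move=> n; eexists; eexists.
- exact: bigcup_hbox_setT.
- move=> _ [a [b ->]]; rewrite /pushforward.
  rewrite -[RHS]/(m (phi @^-1` hbox a b)) (_ : phi @^-1` hbox a b = hbox (a - c) (b - c)); last first.
    by apply/seteqP; split => x xab i; have := xab i; rewrite !mxE ltrBlDr lerBrDr.
  rewrite !hbox_measure; congr EFin; apply: eq_bigr => i _; rewrite !mxE.
  by congr (Num.max _ 0); ring.
- by move=> n; rewrite hbox_measure ltry.
Qed.

End LebesgueMeasure.

Lemma lebesgue_measure_translate (R : realType) (c : R) (A : set (measurableTypeR R)) :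
  measurable A ->
  @lebesgue_measure R ((fun x : R => x + c) @^-1` A) = lebesgue_measure A.
Proof.
move=> mA.
have mc : measurable_fun setT ((fun x : R => x + c) : TR R -> TR R).
  by apply: measurable_funD; [exact: measurable_id|exact: measurable_cst].
pose phi : {mfun TR R >-> TR R} :=
  HB.pack ((fun x : R => x + c) : TR R -> TR R) (isMeasurableFun.Build _ _ _ _ _ mc).
apply/esym; apply: (@lebesgue_measure_unique _ (pushforward lebesgue_measure phi)) => //.
move=> _ [[a b]] _ <-; rewrite /pushforward.
rewrite -[RHS]/(lebesgue_measure (phi @^-1` `]a, b]%classic))
  (_ : phi @^-1` `]a, b]%classic = `](a - c), (b - c)]%classic); last first.
  by apply/seteqP; split => x /=; rewrite !in_itv/= ltrBlDr lerBrDr.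
rewrite !lebesgue_measure_itv/= !lte_fin ltrD2r; case: ifP => // _.
by rewrite -!EFinB; congr EFin; ring.
Qed.

Section SpaceTime.
Variables (R : realType) (N : nat).
Implicit Types p q : XT R N.

Definition sp p : 'rV[R]_N := p.1.
Definition tm p : R := p.2.
Definition stshift q p : XT R N := (sp p + sp q, tm p + tm q).

Lemma stshiftNK q : cancel (stshift (- sp q, - tm q)) (stshift q).
Proof. by move=> [x t]; rewrite /stshift/sp/tm/= !addrNK. Qed.

Lemma measurable_tm : measurable_fun setT (tm : XT R N -> R).
Proof. exact: measurable_snd. Qed.

Lemma measurable_sp : measurable_fun setT (sp : XT R N -> RN R N).
Proof. exact: measurable_fst. Qed.

Lemma measurable_spi (i : 'I_N) : measurable_fun setT ((fun p => sp p 0 i) : XT R N -> R).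
Proof. exact: (measurableT_comp (measurable_coord i) measurable_sp). Qed.

Lemma measurable_stshift q : measurable_fun setT (stshift q).
Proof.
apply: measurable_fun_pair.
  exact: (measurableT_comp (measurable_translate (sp q)) measurable_sp).
apply: measurable_funD; [exact: measurable_tm|exact: measurable_cst].
Qed.

Lemma product_translate (m : {measure set (RN R N) -> \bar R}) : is_lebesgue m ->
  forall q (A : set (XT R N)), measurable A -> mQ m (stshift q @^-1` A) = mQ m A.
Proof.
move=> hm q A mA.
have [m' mm'] := sigma_finite_measureP (lebesgue_sigma_finite hm); subst m.
pose phi : {mfun XT R N >-> XT R N} :=
  HB.pack (stshift q) (isMeasurableFun.Build _ _ _ _ _ (measurable_stshift q)).
apply/esym; apply: (@product_measure_unique _ _ _ _ _ m' (@lebesgue_measure R)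
  (pushforward (mQ m') phi)) => // B C mB mC.
rewrite -[LHS]/((mQ m') (phi @^-1` (B `*` C))) (_ : phi @^-1` (B `*` C) =
  ((fun x : 'rV[R]_N => x + sp q) @^-1` B) `*` ((fun t : R => t + tm q) @^-1` C))//.
rewrite /mQ product_measure1E//.
- by congr (_ * _)%E; [exact: lebesgue_translate|exact: lebesgue_measure_translate].
- by rewrite -[X in measurable X]setTI; exact: (measurable_translate (sp q)).
- rewrite -[X in measurable X]setTI.
  have mc : measurable_fun setT (fun x : R => x + tm q).
    by apply: measurable_funD; [exact: measurable_id|exact: measurable_cst].
  exact: mc.
Qed.

End SpaceTime.

(** * Integration *)

Notation intg mu f := (integrable mu setT (EFin \o f)).

Section RintegralTools.
Context d (T : measurableType d) (R : realType) (mu : {measure set T -> \bar R}).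
Implicit Types f g h : T -> R.

Lemma intg_measurable f : intg mu f -> measurable_fun setT f.
Proof. by move=> /measurable_int /measurable_EFinP. Qed.

Lemma intg_le f g : measurable_fun setT f -> intg mu g ->
  (forall x, `|f x| <= g x) -> intg mu f.
Proof.
move=> mf ig fg; apply: (le_integrable _ _ _ ig) => //; first exact/measurable_EFinP.
by move=> x _; rewrite /= lee_fin (le_trans (fg x))// ler_norm.
Qed.

Lemma intgD f g : intg mu f -> intg mu g -> intg mu (fun x => f x + g x).
Proof.
move=> fi gi; have := integrableD measurableT fi gi.
by apply: eq_integrable => // x _ /=; rewrite EFinD.
Qed.

Lemma intgB f g : intg mu f -> intg mu g -> intg mu (fun x => f x - g x).
Proof.
move=> fi gi; have := integrableB measurableT fi gi.
by apply: eq_integrable => // x _ /=; rewrite EFinB.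
Qed.

Lemma intgZ k f : intg mu f -> intg mu (fun x => k * f x).
Proof.
move=> fi; have := integrableZl measurableT k fi.
by apply: eq_integrable => // x _ /=; rewrite EFinM.
Qed.

Lemma intg_norm f : intg mu f -> intg mu (fun x => `|f x|).
Proof. by move=> fi; exact: integrable_norm. Qed.

Lemma intg0 : intg mu (fun _ => 0).
Proof. exact: integrable0. Qed.

Lemma intgMb h f M : measurable_fun setT h -> (forall x, `|h x| <= M) -> intg mu f ->
  intg mu (fun x => h x * f x).
Proof.
move=> mh hM fi; apply: (@intg_le _ (fun x => M * `|f x|)).
- by apply: measurable_funM => //; exact: intg_measurable.
- exact/intgZ/intg_norm.
- by move=> x; rewrite normrM ler_wpM2r.
Qed.

Lemma intg_indic (A : set T) : measurable A -> (mu A < +oo)%E -> intg mu (\1_A : T -> R).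
Proof.
move=> mA Aoo; apply/integrableP; split; first exact/measurable_EFinP/measurable_indic.
under eq_integral do rewrite /= ger0_norm//.
by rewrite integral_indic// setIT.
Qed.

Lemma Rint_indic (A : set T) : measurable A -> \int[mu]_x (\1_A x : R) = fine (mu A).
Proof. by move=> mA; rewrite /Rintegral integral_indic// setIT. Qed.

Lemma RintD f g : intg mu f -> intg mu g ->
  \int[mu]_x (f x + g x) = \int[mu]_x f x + \int[mu]_x g x.
Proof. by move=> fi gi; rewrite RintegralD. Qed.

Lemma RintB f g : intg mu f -> intg mu g ->
  \int[mu]_x (f x - g x) = \int[mu]_x f x - \int[mu]_x g x.
Proof. by move=> fi gi; rewrite RintegralB. Qed.

Lemma RintZ k f : intg mu f -> \int[mu]_x (k * f x) = k * \int[mu]_x f x.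
Proof. by move=> fi; rewrite RintegralZl. Qed.

Lemma Rint_le f g : intg mu f -> intg mu g -> (forall x, f x <= g x) ->
  \int[mu]_x f x <= \int[mu]_x g x.
Proof. by move=> fi gi fg; apply: le_Rintegral. Qed.

Lemma Rint_ge0 f : (forall x, 0 <= f x) -> 0 <= \int[mu]_x f x.
Proof. by move=> f0; apply: Rintegral_ge0. Qed.

Lemma eq_Rint f g : f =1 g -> \int[mu]_x f x = \int[mu]_x g x.
Proof. by move=> fg; apply: eq_Rintegral => x _. Qed.

Lemma Rint_norm f : intg mu f -> `|\int[mu]_x f x| <= \int[mu]_x `|f x|.
Proof. by move=> fi; apply: le_normr_Rintegral. Qed.

Lemma Rint_normMb h f M : measurable_fun setT h -> (forall x, `|h x| <= M) ->
  intg mu f -> `|\int[mu]_x (h x * f x)| <= M * \int[mu]_x `|f x|.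
Proof.
move=> mh hM fi; have hf := intgMb mh hM fi.
apply: (le_trans (Rint_norm hf)); rewrite -RintZ; last exact: intg_norm.
apply: Rint_le; [exact: intg_norm|exact/intgZ/intg_norm|].
by move=> x; rewrite normrM ler_wpM2r.
Qed.

Lemma Rint_dominated (F : nat -> T -> R) f g : (forall n, measurable_fun setT (F n)) ->
  (forall x, F n x @[n --> \oo] --> f x) -> intg mu g ->
  (forall n x, `|F n x| <= g x) ->
  intg mu f /\ (\int[mu]_x F n x) @[n --> \oo] --> \int[mu]_x f x.
Proof.
move=> mF Ff ig Fg.
have mf : measurable_fun setT f by apply: (measurable_fun_cvg mF) => x _; exact: Ff.
have [//|||||fi _ Fi] := @dominated_convergence _ _ _ mu _ measurableT
    (fun n => EFin \o F n) (EFin \o f) (EFin \o g).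
- by move=> n; exact/measurable_EFinP.
- exact/measurable_EFinP.
- by apply: aeW => x _; apply: cvg_EFin; [exact: nearW|exact: Ff].
- exact: ig.
- by apply: aeW => x n _; rewrite /= lee_fin.
split=> //.
have fin : (\int[mu]_x (EFin \o f) x)%E \is a fin_num by exact: integrable_fin_num.
by apply: fine_cvg; rewrite fineK.
Qed.

Lemma Rint_sum (I : Type) (s : seq I) (F : I -> T -> R) : (forall i, intg mu (F i)) ->
  intg mu (fun x => \sum_(i <- s) F i x) /\
  \int[mu]_x (\sum_(i <- s) F i x) = \sum_(i <- s) \int[mu]_x F i x.
Proof.
move=> Fi; elim: s => [|i s [ih1 ih2]].
  rewrite big_nil; split.
    by under eq_fun do rewrite big_nil; exact: intg0.
  by under eq_Rintegral do rewrite big_nil; rewrite Rintegral_cst// mul0r.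
split.
  by under eq_fun do rewrite big_cons; apply: intgD.
under eq_Rintegral do rewrite big_cons.
by rewrite RintD// ih2 big_cons.
Qed.

End RintegralTools.

(** * A convex approximation of the positive part *)

Section ClampedConvex.
Variables (R : realType) (a : R).
Hypothesis a0 : 0 < a.
Implicit Types r s : R.

(** [cvxf] is a C^1 convex approximation of the positive part, with derivative [clamp]. *)
Definition clamp r : R := Num.min 1 (Num.max 0 (r / a)).
Definition cvxf r : R := clamp r * r - a / 2 * clamp r ^+ 2.

(** The middle case names the quotient [x = r / a], which removes the division from the arithmetic
    that follows. *)
Variant clamp_spec r : R -> Prop :=
| ClampNeg of r <= 0 : clamp_spec r 0
| ClampMid x of 0 <= x <= 1 & r = a * x & 0 <= r <= a : clamp_spec r x
| ClampBig of a <= r : clamp_spec r 1.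

Lemma clampP r : clamp_spec r (clamp r).
Proof.
rewrite /clamp; have [r0|r0] := leP r 0.
  by rewrite max_l ?ler_pdivrMr ?mul0r// min_r ?ler01//; constructor.
have ra : 0 < r / a by rewrite divr_gt0.
rewrite max_r ?(ltW ra)//; have [ar|ar] := leP 1 (r / a).
  by constructor; move: ar; rewrite ler_pdivlMr// mul1r.
constructor; first by rewrite !ltW.
  by rewrite mulrCA divff ?mulr1// gt_eqF.
by rewrite ltW//=; move: ar; rewrite ltr_pdivrMr// mul1r => /ltW.
Qed.

Lemma clamp_ge0 r : 0 <= clamp r.
Proof. by case: clampP => // x /andP[]. Qed.

Lemma clamp_le1 r : clamp r <= 1.
Proof. by case: clampP => // x /andP[]. Qed.

Lemma clamp_neg r : r <= 0 -> clamp r = 0.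
Proof. by move=> r0; rewrite /clamp max_l ?min_r ?ler01// ler_pdivrMr// mul0r. Qed.

Lemma clamp_lipschitz r s : `|clamp r - clamp s| <= a^-1 * `|r - s|.
Proof.
have ai : 0 < a^-1 by rewrite invr_gt0.
rewrite -[leLHS]mul1r -{1}(mulVf (lt0r_neq0 a0)) -mulrA ler_pM2l//.
rewrite -[X in X * _](gtr0_norm a0) -normrM mulrBr.
rewrite ler_norml; have [rs|rs] := ger0P (r - s);
  case: (clampP r) => [r0|x _ <- /andP[r0 ra]|ra];
  case: (clampP s) => [s0|y _ <- /andP[s0 sa]|sa]; rewrite ?mulr0 ?mulr1;
  have a0h := a0; apply/andP; split; lra.
Qed.

(** The value [cvxf r] is the maximum of [c * r - a / 2 * c ^+ 2] over [0 <= c <= 1], attained at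
    [c = clamp r]. The same [c] is a competitor in the maximum for [s], and this is the claimed
    supporting line. *)
Lemma cvxf_convex r s : cvxf r - cvxf s <= clamp r * (r - s).
Proof.
rewrite /cvxf; have c0 := clamp_ge0 r; have c1 := clamp_le1 r.
(* Left side minus right side factors into exactly this product. *)
have : (clamp r - clamp s) * (s - a * (clamp r + clamp s) / 2) <= 0; last by nra.
case: (clampP s) => [s0|y /andP[y0 y1] -> _|sa].
- by rewrite subr0 addr0; apply: mulr_ge0_le0 => //; have := mulr_ge0 (ltW a0) c0; lra.
- rewrite (_ : _ * _ = - (a / 2 * (clamp r - y) ^+ 2)); last by field.
  by rewrite oppr_le0 mulr_ge0 ?sqr_ge0// divr_ge0 ?ltW.
- apply: mulr_le0_ge0; first by rewrite subr_le0.
  by have := ler_wpM2l (ltW a0) c1; rewrite mulr1; lra.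
Qed.

Lemma cvxf_neg r : r <= 0 -> cvxf r = 0.
Proof. by move=> r0; rewrite /cvxf clamp_neg// mul0r expr0n/= mulr0 subr0. Qed.

Lemma cvxf_lipschitz r s : `|cvxf r - cvxf s| <= `|r - s|.
Proof.
have key u v : cvxf u - cvxf v <= `|u - v|.
  apply: (le_trans (cvxf_convex u v)); apply: (le_trans (ler_norm _)).
  by rewrite normrM ler_piMl// ger0_norm ?clamp_ge0// clamp_le1.
by rewrite ler_norml lerNl opprB {1}distrC !key.
Qed.

Lemma cvxf_norm r : `|cvxf r| <= `|r|.
Proof. by have := cvxf_lipschitz r 0; rewrite (cvxf_neg (lexx 0)) !subr0. Qed.

Lemma le_cvxf r : r <= cvxf r + a / 2.
Proof.
rewrite /cvxf; case: clampP => [r0|x /andP[x0 x1] -> _|ra].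
- by have := a0; lra.
- have : 0 <= a * (1 - x) ^+ 2 by rewrite mulr_ge0 ?sqr_ge0 ?ltW.
  nra.
- by lra.
Qed.

Lemma measurable_clamp : measurable_fun setT clamp.
Proof.
apply: measurable_minr; first exact: measurable_cst.
apply: measurable_maxr; first exact: measurable_cst.
by apply: measurable_funM; [exact: measurable_id|exact: measurable_cst].
Qed.

Lemma measurable_cvxf : measurable_fun setT cvxf.
Proof.
apply: measurable_funB.
  by apply: measurable_funM; [exact: measurable_clamp|exact: measurable_id].
apply: measurable_funM; first exact: measurable_cst.
by apply: measurable_funX; exact: measurable_clamp.
Qed.

End ClampedConvex.

(** * Finite differences and mollification *)

Section Translation.
Variables (R : realType) (N : nat) (lam : {measure set (XT R N) -> \bar R}).
Hypothesis lamT : forall (q : XT R N) (A : set (XT R N)), measurable A -> lam (stshift q @^-1` A) = lam A.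
Implicit Types (f g W z : XT R N -> R) (p q : XT R N).

Definition oppst q : XT R N := (- sp q, - tm q).

Lemma stshift_oppK q p : stshift q (stshift (oppst q) p) = p.
Proof. exact: stshiftNK. Qed.

Lemma ge0_integral_translate (F : XT R N -> \bar R) q : measurable_fun setT F ->
  (forall p, (0 <= F p)%E) ->
  (\int[lam]_p F (stshift q p) = \int[lam]_p F p)%E.
Proof.
move=> mF F0; have mq := measurable_stshift q.
rewrite -[LHS](@ge0_integral_pushforward _ _ _ _ _ _ mq lam setT)//.
by apply: eq_measure_integral => A mA _; rewrite /pushforward; exact: lamT.
Qed.

Lemma intg_translate f q : intg lam f -> intg lam (fun p => f (stshift q p)).
Proof.
move=> fi; have mf := intg_measurable fi; apply/integrableP; split.
  by apply/measurable_EFinP; exact: measurableT_comp (measurable_stshift q).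
rewrite (ge0_integral_translate (F := fun p => `|(f p)%:E|%E))//.
  by case/integrableP: fi.
by do 2 apply: measurableT_comp => //; exact/measurable_EFinP.
Qed.

Lemma Rint_translate f q : intg lam f ->
  \int[lam]_p f (stshift q p) = \int[lam]_p f p.
Proof.
move=> fi; have mf := intg_measurable fi; congr fine; rewrite integralE [RHS]integralE.
congr (_ - _)%E.
- have mp : measurable_fun setT (EFin \o f)^\+%E by apply/measurable_funepos/measurable_EFinP.
  rewrite -[RHS](ge0_integral_translate q mp (fun=> funepos_ge0 _ _)).
  by apply: eq_integral => p _; rewrite !funeposE.
- have mn : measurable_fun setT (EFin \o f)^\-%E by apply/measurable_funeneg/measurable_EFinP.
  rewrite -[RHS](ge0_integral_translate q mn (fun=> funeneg_ge0 _ _)).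
  by apply: eq_integral => p _; rewrite !funenegE.
Qed.

(** [s] is a stencil, a list of (weight, displacement) pairs. *)
Definition fdiff (s : seq (R * XT R N)) f p : R := \sum_(l <- s) l.1 * (f p - f (stshift l.2 p)).
(** The stencil of the adjoint operator, as translations preserve the measure. *)
Definition opps (s : seq (R * XT R N)) := [seq (l.1, oppst l.2) | l <- s].

Section KatoDifference.
Variables (a : R) (W z : XT R N -> R) (M : R).
Hypotheses (a0 : 0 < a) (Wi : intg lam W) (mz : measurable_fun setT z)
  (z0 : forall p, 0 <= z p) (zM : forall p, z p <= M).

Let zM' p : `|z p| <= M. Proof. by rewrite ger0_norm. Qed.

Lemma intg_cvxf : intg lam (fun p => cvxf a (W p)).
Proof.
apply: (intg_le _ (intg_norm Wi)); last by move=> p; exact: cvxf_norm.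
exact: measurableT_comp (measurable_cvxf a) (intg_measurable Wi).
Qed.

Lemma measurable_clampW : measurable_fun setT (fun p => clamp a (W p)).
Proof. exact: measurableT_comp (measurable_clamp a) (intg_measurable Wi). Qed.

Let mzc : measurable_fun setT (fun p => z p * clamp a (W p)).
Proof. by apply: measurable_funM => //; exact: measurable_clampW. Qed.

Let zcM p : `|z p * clamp a (W p)| <= M.
Proof.
rewrite normrM (ger0_norm (z0 p)) (ger0_norm (clamp_ge0 a0 (W p))).
by rewrite (le_trans _ (zM p))// ler_piMr// (clamp_le1 a0).
Qed.

Lemma kato_stshift q :
  \int[lam]_p (cvxf a (W p) * (z p - z (stshift q p))) <=
  \int[lam]_p (z p * clamp a (W p) * (W p - W (stshift (oppst q) p))).
Proof.
have ji := intg_cvxf.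
have jqi := intg_translate (oppst q) ji.
have zj : intg lam (fun p => z p * cvxf a (W p)) by exact: intgMb mz zM' ji.
have zq : measurable_fun setT (fun p => z (stshift q p)).
  exact: measurableT_comp mz (measurable_stshift q).
have zqj : intg lam (fun p => z (stshift q p) * cvxf a (W p)).
  by apply: (intgMb zq (M := M)) => // p; exact: zM'.
have zjq : intg lam (fun p => z p * cvxf a (W (stshift (oppst q) p))).
  exact: intgMb mz zM' jqi.
have -> : \int[lam]_p (cvxf a (W p) * (z p - z (stshift q p))) =
    \int[lam]_p (z p * (cvxf a (W p) - cvxf a (W (stshift (oppst q) p)))).
  under eq_Rintegral do rewrite mulrBr [X in X - _]mulrC [X in _ - X]mulrC.
  under [RHS]eq_Rintegral do rewrite mulrBr.
  rewrite !RintB//; congr (_ - _); rewrite -(Rint_translate (oppst q) zqj).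
  by apply: eq_Rint => p; rewrite stshift_oppK.
apply: Rint_le.
- by under eq_fun do rewrite mulrBr; exact: intgB.
- apply: (intgMb mzc zcM); apply: intgB => //; exact: intg_translate.
- by move=> p; rewrite -mulrA ler_wpM2l// (cvxf_convex a0).
Qed.

(** There is one convexity inequality per displacement, and they are added with the weights of the
    stencil; this is where the weights have to be nonnegative. *)
Lemma kato_fdiff (s : seq (R * XT R N)) : all (fun l => 0 <= l.1) s ->
  \int[lam]_p (cvxf a (W p) * fdiff s z p) <=
  \int[lam]_p (z p * clamp a (W p) * fdiff (opps s) W p).
Proof.
move=> s0; have ji := intg_cvxf.
pose F (l : R * XT R N) p := l.1 * (cvxf a (W p) * (z p - z (stshift l.2 p))).
pose G (l : R * XT R N) p := l.1 * (z p * clamp a (W p) * (W p - W (stshift (oppst l.2) p))).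
have Fi0 (l : R * XT R N) : intg lam (fun p => cvxf a (W p) * (z p - z (stshift l.2 p))).
  under eq_fun do rewrite mulrC; apply: (intgMb (M := M + M)) ji.
    by apply: measurable_funB => //; exact: measurableT_comp mz (measurable_stshift _).
  by move=> p; apply: (le_trans (ler_normB _ _)); rewrite lerD.
have Gi0 (l : R * XT R N) : intg lam (fun p => z p * clamp a (W p) * (W p - W (stshift (oppst l.2) p))).
  by apply: (intgMb mzc zcM); apply: intgB => //; exact: intg_translate.
have Fi l : intg lam (F l) by exact: (intgZ l.1 (Fi0 l)).
have Gi l : intg lam (G l) by exact: (intgZ l.1 (Gi0 l)).
have -> : \int[lam]_p (cvxf a (W p) * fdiff s z p) = \int[lam]_p (\sum_(l <- s) F l p).
  apply: eq_Rint => p; rewrite /fdiff mulr_sumr; apply: eq_bigr => l _.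
  by rewrite mulrCA.
have -> : \int[lam]_p (z p * clamp a (W p) * fdiff (opps s) W p) =
    \int[lam]_p (\sum_(l <- s) G l p).
  apply: eq_Rint => p; rewrite /fdiff big_map mulr_sumr; apply: eq_bigr => l _.
  by rewrite mulrCA.
rewrite (Rint_sum s Fi).2 (Rint_sum s Gi).2 big_seq [leRHS]big_seq.
apply: ler_sum => l ls; rewrite /F /G (RintZ _ (Fi0 l)) (RintZ _ (Gi0 l)).
by apply: ler_wpM2l; [exact: (allP s0 _ ls)|exact: kato_stshift].
Qed.

End KatoDifference.

End Translation.

(** * Integral operators with a nonnegative kernel of mass at most one *)

Section KernelOperator.
Context d1 d2 (T1 : measurableType d1) (T2 : measurableType d2) (R : realType).
Variables (m1 : {sigma_finite_measure set T1 -> \bar R})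
  (m2 : {sigma_finite_measure set T2 -> \bar R}).
Variables (J : T1 * T2 -> R) (C : R) (w : T2 -> R).
Hypotheses (mJ : measurable_fun setT J) (J0 : forall pq, 0 <= J pq) (JC : forall pq, J pq <= C)
  (J1 : forall q, (\int[m1]_p (J (p, q))%:E <= 1)%E) (wi : intg m2 w).

Lemma measurable_kernel_l q : measurable_fun setT (fun p => J (p, q)).
Proof. exact: measurableT_comp mJ (pair2_measurable q). Qed.

Lemma measurable_kernel_r p : measurable_fun setT (fun q => J (p, q)).
Proof. exact: measurableT_comp mJ (pair1_measurable p). Qed.

Lemma kernel_intg_r p : intg m2 (fun q => w q * J (p, q)).
Proof.
under eq_fun do rewrite mulrC.
apply: (intgMb (measurable_kernel_r p) (M := C)) wi => q.
by rewrite ger0_norm.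
Qed.

Lemma kernel_intg_l q : intg m1 (fun p => J (p, q)).
Proof.
apply/integrableP; split; first exact/measurable_EFinP/measurable_kernel_l.
under eq_integral do rewrite /= ger0_norm//.
exact: le_lt_trans (J1 q) (ltry _).
Qed.

Section Weighted.
Variables (z : T1 -> R) (M : R).
Hypotheses (mz : measurable_fun setT z) (M0 : 0 <= M) (zM : forall p, `|z p| <= M).

Let f (pq : T1 * T2) : \bar R := (z pq.1 * (w pq.2 * J pq))%:E.

Let mf : measurable_fun setT f.
Proof.
apply/measurable_EFinP; apply: measurable_funM.
  exact: measurableT_comp mz measurable_fst.
apply: measurable_funM => //.
exact: measurableT_comp (intg_measurable wi) measurable_snd.
Qed.

Let zJi q : intg m1 (fun p => z p * J (p, q)).
Proof. exact: intgMb mz zM (kernel_intg_l q). Qed.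

Lemma kernel_double_le :
  (\int[m2]_q \int[m1]_p `|f (p, q)| <= \int[m2]_q (M * `|w q|)%:E)%E.
Proof.
apply: ge0_le_integral => //.
- by move=> q _; exact: integral_ge0.
- apply: (measurable_fun_fubini_tonelli_G (m1 := m1) (fun pq => `|f pq|%E)) => //.
  exact: measurableT_comp.
- apply/measurable_EFinP; apply: measurable_funM => //.
  exact: measurableT_comp (intg_measurable wi).
- move=> q _.
  have -> : (M * `|w q|)%:E = ((M * `|w q|)%:E * 1)%E by rewrite mule1.
  have H : (0 <= (M * `|w q|)%:E)%E by rewrite lee_fin mulr_ge0.
  apply: (@le_trans _ _ ((M * `|w q|)%:E * \int[m1]_p (J (p, q))%:E)%E); last first.
    exact: lee_wpmul2l.
  rewrite -ge0_integralZl//; last 2 first.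
  + exact/measurable_EFinP/measurable_kernel_l.
  + by move=> p _; rewrite lee_fin.
  apply: ge0_le_integral => //.
  + by apply: measurableT_comp => //; exact: (measurableT_comp mf (pair2_measurable q)).
  + apply/measurable_EFinP; apply: measurable_funM => //; exact: measurable_kernel_l.
  + move=> p _; rewrite /f/= -EFinM lee_fin normrM -mulrA ler_pM//.
    by rewrite normrM (ger0_norm (J0 _)).
Qed.

Lemma kernel_weighted_integrable : (m1 \x m2)%E.-integrable setT f.
Proof.
apply/integrable21ltyP => //; apply: (le_lt_trans kernel_double_le).
have /integrableP[_] := intgZ M (intg_norm wi).
apply: le_lt_trans; apply: ge0_le_integral => //=.
- by move=> q _; rewrite lee_fin mulr_ge0.
- apply/measurable_EFinP; apply: measurable_funM => //.
  exact: measurableT_comp (intg_measurable wi).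
- do 2 apply: measurableT_comp => //; apply: measurable_funM => //.
  exact: measurableT_comp (intg_measurable wi).
- by move=> q _; rewrite lee_fin ler_norm.
Qed.

Lemma kernel_swap : \int[m1]_p (z p * \int[m2]_q (w q * J (p, q))) =
  \int[m2]_q (w q * \int[m1]_p (z p * J (p, q))).
Proof.
have := Fubini kernel_weighted_integrable.
have -> : (\int[m1]_x fubini_F m2 f x = \int[m1]_p (z p * \int[m2]_q (w q * J (p, q)))%:E)%E.
  apply: eq_integral => p _; rewrite /fubini_F /f/=.
  under eq_integral do rewrite EFinM.
  rewrite integralZl//; last exact: kernel_intg_r.
  by rewrite EFinM /Rintegral fineK//; exact: integrable_fin_num (kernel_intg_r p).
have -> : (\int[m2]_y fubini_G m1 f y = \int[m2]_q (w q * \int[m1]_p (z p * J (p, q)))%:E)%E.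
  apply: eq_integral => q _; rewrite /fubini_G /f/=.
  under eq_integral do rewrite mulrCA EFinM.
  rewrite integralZl//; last exact: zJi.
  by rewrite EFinM /Rintegral fineK//; exact: integrable_fin_num (zJi q).
by rewrite /Rintegral => ->.
Qed.

End Weighted.

Let one_le (p : T1) : `|cst (1 : R) p| <= 1. Proof. by rewrite normr1. Qed.

(** Contraction in L^1, by Tonelli and the bound on the mass of [J (., q)]; it is the weighted
    estimate with weight 1. The two spaces are kept distinct because the operator serves twice: it
    mollifies functions on space-time, and it spreads a finite measure on space into space-time. *)
Lemma kernel_intg_norm : intg m1 (fun p => \int[m2]_q (w q * J (p, q))) /\
  \int[m1]_p `|\int[m2]_q (w q * J (p, q))| <= \int[m2]_q `|w q|.
Proof.
have m1c : measurable_fun setT (cst (1 : R) : T1 -> R) by exact: measurable_cst.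
have fi := kernel_weighted_integrable m1c ler01 one_le.
have mW : measurable_fun setT (fun p => \int[m2]_q (w q * J (p, q))).
  have := measurable_fubini_F fi => /(measurableT_comp (fine_measurable measurableT)).
  apply: eq_measurable_fun => p _ /=.
  by congr fine; apply: eq_integral => q _; rewrite /cst mul1r.
have H : (\int[m1]_p `|(\int[m2]_q (w q * J (p, q)))%:E| <= \int[m2]_q `|w q|%:E)%E.
  have := kernel_double_le m1c ler01 one_le.
  under [X in (_ <= X)%E -> _]eq_integral do rewrite mul1r.
  apply: le_trans.
  rewrite -(fubini_tonelli (m1 := m1) (m2 := m2)
    (fun pq => `|(cst 1 pq.1 * (w pq.2 * J pq))%:E|%E))//; last first.
    apply: measurableT_comp => //; exact: measurable_int fi.
  apply: ge0_le_integral => //.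
  - by apply: measurableT_comp => //; exact/measurable_EFinP.
  - apply: (measurable_fun_fubini_tonelli_F (m2 := m2)
      (fun pq => `|(cst 1 pq.1 * (w pq.2 * J pq))%:E|%E)) => //.
    apply: measurableT_comp => //; exact: measurable_int fi.
  - move=> p _; rewrite [leLHS](_ : _ = (`|\int[m2]_q (w q * J (p, q))|)%:E)//.
    rewrite EFin_normr_Rintegral//; last exact: kernel_intg_r.
    under [leRHS]eq_integral do rewrite /cst mul1r.
    apply: le_abse_integral => //; exact: measurable_int (kernel_intg_r p).
have wfin : (\int[m2]_q `|w q|%:E < +oo)%E.
  by have /integrableP[] := wi.
have Wi : intg m1 (fun p => \int[m2]_q (w q * J (p, q))).
  apply/integrableP; split; first exact/measurable_EFinP.
  exact: le_lt_trans H wfin.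
split => //; apply: fine_le => //.
- exact: integrable_fin_num (intg_norm Wi).
- exact: integrable_fin_num (intg_norm wi).
Qed.

End KernelOperator.

(** * The one-sided mollifying kernel and boxes of space-time *)

Section Kernel.
Variables (R : realType) (N : nat).
Implicit Types (p q : XT R N) (d : R).

(** The support lies in the cube where all coordinates, time included, are between [- d] and [0].
    Being a product of C^2 bumps, every translate of the kernel can be used as a test function. *)
Definition kern0 d q : R := (\prod_(i < N) cbump (- d) 0 (sp q 0 i)) * cbump (- d) 0 (tm q).

Lemma kern0_ge0 d q : 0 <= kern0 d q.
Proof. by rewrite mulr_ge0// ?cbump_ge0// prodr_ge0// => i _; exact: cbump_ge0. Qed.

Lemma kern0_supp d q : kern0 d q != 0 ->
  (forall i, - d < sp q 0 i < 0) /\ - d < tm q < 0.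
Proof.
rewrite mulf_eq0 negb_or => /andP[/prodf_neq0 h1 h2]; split=> [i|].
  by apply: contraNT (h1 i isT) => h; rewrite (C2c_out (cbump_C2c (- d) 0)).
by apply: contraNT h2 => h; rewrite (C2c_out (cbump_C2c (- d) 0)).
Qed.

Lemma cbump_bounded a b : exists2 M : R, 0 <= M & forall x, cbump a b x <= M.
Proof.
have [M M0 hM] := C2c_bounded (cbump_C2c a b).
by exists M => // x; have [h _ _] := hM x; rewrite (le_trans _ h)// ler_norm.
Qed.

Lemma kern0_bounded d : exists2 M : R, 0 <= M & forall q, kern0 d q <= M.
Proof.
have [M M0 hM] := cbump_bounded (- d) 0.
exists (\prod_(i < N) M * M); first by rewrite mulr_ge0// prodr_ge0.
move=> q; rewrite ler_pM ?cbump_ge0// ?prodr_ge0//; first by move=> i _; exact: cbump_ge0.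
by apply: ler_prod => i _; rewrite cbump_ge0 hM.
Qed.

Lemma measurable_cbump a b : measurable_fun setT (cbump a b : R -> R).
Proof. exact: continuous_measurable_fun (C2c_continuous (cbump_C2c a b)). Qed.

(* The kernel is even about the centre [-d/2] of its support; this replaces reflection
   invariance of the measure by translation invariance. *)
Lemma kern0_sym d q :
  kern0 d (- (const_mx d + sp q), - (d + tm q)) = kern0 d q.
Proof.
have bs x : cbump (- d) 0 (- (d + x)) = cbump (- d) 0 x.
  by rewrite /cbump mulrC; congr (posX 3 _ * posX 3 _); ring.
rewrite /kern0 /sp /tm/= bs; congr (_ * _).
by apply: eq_bigr => i _; rewrite !mxE bs.
Qed.

Lemma measurable_kern0 d : measurable_fun setT (kern0 d).
Proof.
apply: measurable_funM; last exact: measurableT_comp (measurable_cbump _ _) (@measurable_tm _ _).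
apply: measurable_prod => i _.
exact: measurableT_comp (measurable_cbump _ _) (measurable_spi i).
Qed.

Lemma measurable_kern2 d :
  measurable_fun setT (fun pq : XT R N * XT R N => kern0 d (stshift (oppst pq.1) pq.2)).
Proof.
apply: measurable_funM.
  apply: measurable_prod => i _.
  have -> : (fun pq : XT R N * XT R N => cbump (- d) 0 (sp (stshift (oppst pq.1) pq.2) 0 i)) =
    cbump (- d) 0 \o (fun pq => sp pq.2 0 i - sp pq.1 0 i).
    by apply/funext => pq /=; rewrite /stshift/oppst/sp/= !mxE.
  apply: measurableT_comp (measurable_cbump _ _) _; apply: measurable_funB.
    exact: measurableT_comp (measurable_spi i) measurable_snd.
  exact: measurableT_comp (measurable_spi i) measurable_fst.
apply: measurableT_comp (measurable_cbump _ _) _; apply: measurable_funB.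
  exact: measurableT_comp (@measurable_tm _ _) measurable_snd.
exact: measurableT_comp (@measurable_tm _ _) measurable_fst.
Qed.

Definition stbox (a b : 'rV[R]_N) (c e : R) : set (XT R N) :=
  [set p | hbox a b (sp p) /\ c < tm p <= e].

Lemma measurable_stbox a b c e : measurable (stbox a b c e).
Proof.
rewrite (_ : stbox a b c e = hbox a b `*` `]c, e]%classic).
  by apply: measurableX; [exact: measurable_hbox|exact: measurable_itv].
by apply/seteqP; split => -[x t] [] /= h1 h2; split => //=; move: h2; rewrite in_itv.
Qed.

Lemma stboxI a b c e a' b' c' e' : exists a1 b1 c1 e1,
  stbox a b c e `&` stbox a' b' c' e' = stbox a1 b1 c1 e1.
Proof.
have [a1 [b1 h1]] : hboxes (hbox a b `&` hbox a' b') by apply: hboxI; eexists; eexists.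
exists a1, b1, (Num.max c c'), (Num.min e e').
apply/seteqP; split => -[x t]; rewrite /stbox/= gt_max le_min.
  move=> [[h2 /andP[-> ->]] [h3 /andP[-> ->]]]; split=> //.
  by have : (hbox a b `&` hbox a' b') x by []; rewrite h1.
rewrite -h1 => -[[h2 h3] /andP[/andP[-> ->] /andP[-> ->]]].
by split.
Qed.

Definition stboxes : set (set (XT R N)) :=
  [set A | exists a b c e, A = stbox a b c e].

Lemma bigcup_stbox : \bigcup_n stbox (const_mx (- n%:R)) (const_mx n%:R) (- n%:R) n%:R = setT.
Proof.
apply/seteqP; split => // -[x t] _.
have : [set: 'rV[R]_N] x by [].
rewrite -bigcup_hbox_setT => -[n _ nx].
exists (maxn n (Num.truncn `|t|).+1) => //; split => /=.
  move=> i; have := nx i; rewrite !mxE => /andP[h1 h2]; apply/andP; split.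
    by apply: le_lt_trans h1; rewrite lerN2 ler_nat leq_maxl.
  by apply: le_trans h2 _; rewrite ler_nat leq_maxl.
have tt : `|t| < (maxn n (Num.truncn `|t|).+1)%:R.
  by apply: (lt_le_trans (truncnS_gt _)); rewrite ler_nat leq_maxr.
by move: tt; rewrite ltr_norml => /andP[h1 /ltW h2]; apply/andP.
Qed.

Lemma measurable_stboxes : @measurable _ (XT R N) = <<s stboxes >>.
Proof.
apply/seteqP; split; last first.
  apply: smallest_sub; first exact: sigma_algebra_measurable.
  by move=> _ [a [b [c [e ->]]]]; exact: measurable_stbox.
rewrite measurable_prod_measurableType.
apply: smallest_sub; first exact: smallest_sigma_algebra.
(* The product sigma-algebra is generated by the two projections, so it suffices that both are
   measurable for the sigma-algebra generated by the boxes. The preimage of a box under a projection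
   is a countable union of boxes. *)
pose X' := g_sigma_algebraType stboxes.
have mbox a b c e : measurable (stbox a b c e : set X').
  by apply: sub_sigma_algebra; do 4 eexists.
have mfst : measurable_fun setT (fst : X' -> RN R N).
  apply: (measurability (@hboxes R N) (@measurable_hboxes R N)).
  move=> _ [_ [a [b ->]] <-]; rewrite setTI.
  rewrite (_ : _ @^-1` _ = \bigcup_n stbox a b (- n%:R) n%:R); last first.
    apply/seteqP; split => [[x t] /= hx|[x t] [n _ []]//].
    have : [set: XT R N] (x, t) by [].
    by rewrite -bigcup_stbox => -[n _ [_ h]]; exists n.
  by apply: bigcupT_measurable => n; exact: mbox.
have msnd : measurable_fun setT (snd : X' -> TR R).
  apply: (measurability (R.-ocitv.-measurable : set (set R)) erefl).
  move=> _ [_ [[c e] _ <-] <-]; rewrite setTI.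
  rewrite (_ : _ @^-1` _ = \bigcup_n stbox (const_mx (- n%:R)) (const_mx n%:R) c e); last first.
    apply/seteqP; split => [[x t] /= hx|[x t] [n _ [_ /=]]]; last by rewrite in_itv.
    have : [set: XT R N] (x, t) by [].
    rewrite -bigcup_stbox => -[n _ [h _]]; exists n => //; split=> //.
  by apply: bigcupT_measurable => n; exact: mbox.
move=> _ [A mA [B mB <-]].
rewrite (_ : A `*` B = (fst @^-1` A) `&` (snd @^-1` B))//.
have := measurableI _ _ (mfst measurableT A mA) (msnd measurableT B mB).
by rewrite !setTI.
Qed.

End Kernel.

Lemma cvg0_le (R : realType) (u v : nat -> R) : (forall n, 0 <= u n <= v n) ->
  v n @[n --> \oo] --> 0 -> u n @[n --> \oo] --> 0.
Proof.
move=> uv v0; have uvn : \forall n \near \oo, 0 <= u n <= v n by exact: nearW.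
exact: (squeeze_cvgr uvn (cvg_cst 0) v0).
Qed.

Lemma cvg0D (R : realType) (u v : nat -> R) : u n @[n --> \oo] --> 0 ->
  v n @[n --> \oo] --> 0 -> (u n + v n) @[n --> \oo] --> 0.
Proof. by move=> u0 v0; rewrite -[0]addr0; apply: cvgD. Qed.

(** * Mollification for a translation-invariant measure with finite, positive mass on boxes *)

Section Mollifier.
Variables (R : realType) (N : nat) (lam : {sigma_finite_measure set (XT R N) -> \bar R}).
Hypothesis lamT : forall (q : XT R N) (A : set (XT R N)), measurable A ->
  lam (stshift q @^-1` A) = lam A.
Hypothesis lam_box : forall (a b : 'rV[R]_N) (c e : R), (lam (stbox a b c e) < +oo)%E.
Hypothesis lam_pos : forall a b : R, a < b ->
  (0 < lam (stbox (const_mx a : 'rV[R]_N) (const_mx b) a b))%E.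
Implicit Types (p q : XT R N) (d : R) (w : XT R N -> R).

Lemma intg_stbox a b c e : intg lam (\1_(stbox a b c e) : XT R N -> R).
Proof. by apply: intg_indic; [exact: measurable_stbox|exact: lam_box]. Qed.

Lemma kern0_intg d : intg lam (kern0 d : XT R N -> R).
Proof.
have [M M0 hM] := @kern0_bounded R N d.
apply: (intg_le (@measurable_kern0 R N d)
  (intgZ M (intg_stbox (const_mx (- d)) (const_mx 0) (- d) 0))) => q.
rewrite ger0_norm ?kern0_ge0//.
have [->|/kern0_supp[h1 /andP[h2 h3]]] := eqVneq (kern0 d q) 0.
  by rewrite mulr_ge0.
rewrite indicE mem_set ?mulr1//; split; last by rewrite h2 ltW.
by move=> i; rewrite !mxE; have /andP[-> /ltW] := h1 i.
Qed.

Definition kernZ d := \int[lam]_q kern0 d q.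

Lemma posX_le n (x y : R) : x <= y -> posX n x <= posX n y.
Proof.
move=> xy; have m0 (z : R) : 0 <= Num.max z 0 by rewrite le_max lexx orbT.
by rewrite lerXn2r ?nnegrE// ge_max m0 le_max xy.
Qed.

Lemma kernZ_gt0 d : 0 < d -> 0 < kernZ d.
Proof.
(* On []a, b]] both [x + d] and [- x] are at least [d / 4], so every bump factor is at least [c]. *)
move=> d0; pose a := - (d * 3 / 4); pose b := - (d / 2); pose c := posX 3 (d / 4) ^+ 2.
have ab : a < b by rewrite /a /b; lra.
have c0 : 0 < c by rewrite exprn_gt0// posX_gt0// divr_gt0.
pose B : set (XT R N) := stbox (const_mx a) (const_mx b) a b.
have bc x : a < x <= b -> c <= cbump (- d) 0 x.
  rewrite /a /b => /andP[ax xb]; rewrite /c /cbump expr2.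
  by apply: ler_pM; rewrite ?posX_ge0//; apply: posX_le; lra.
apply: (@lt_le_trans _ _ (\int[lam]_q ((\prod_(i < N) c * c) * \1_B q))).
  rewrite RintZ; last exact: intg_stbox.
  rewrite mulr_gt0//; first by rewrite mulr_gt0// prodr_gt0.
  rewrite Rint_indic; last exact: measurable_stbox.
  by rewrite fine_gt0// lam_pos// lam_box.
apply: Rint_le; [exact/intgZ/intg_stbox|exact: kern0_intg|move=> q].
rewrite indicE; have [|_] := boolP (q \in B); last by rewrite mulr0 kern0_ge0.
rewrite inE mulr1 => -[h1 h2]; apply: ler_pM; rewrite ?(ltW c0)//.
- by apply: prodr_ge0 => i _; exact: ltW.
- apply: ler_prod => i _; rewrite (ltW c0)/= bc//.
  by have := h1 i; rewrite !mxE.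
- exact: bc.
Qed.

Definition mker d (pq : XT R N * XT R N) : R :=
  (kernZ d)^-1 * kern0 d (stshift (oppst pq.1) pq.2).

Lemma measurable_mker d : measurable_fun setT (mker d).
Proof. by apply: measurable_funM; [exact: measurable_cst|exact: measurable_kern2]. Qed.

Lemma mker_ge0 d pq : 0 <= mker d pq.
Proof.
rewrite mulr_ge0 ?kern0_ge0// invr_ge0; apply: Rint_ge0 => q; exact: kern0_ge0.
Qed.

Lemma mker_bounded d : exists2 M : R, 0 <= M & forall pq, mker d pq <= M.
Proof.
have [M M0 hM] := @kern0_bounded R N d.
have Z0 : 0 <= (kernZ d)^-1 by rewrite invr_ge0; apply: Rint_ge0 => q; exact: kern0_ge0.
exists ((kernZ d)^-1 * M); first exact: mulr_ge0.
by move=> pq; rewrite ler_wpM2l.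
Qed.

Lemma mker_supp d p q : mker d (p, q) != 0 ->
  (forall i, sp p 0 i - d < sp q 0 i < sp p 0 i) /\ tm p - d < tm q < tm p.
Proof.
rewrite mulf_eq0 negb_or => /andP[_ /kern0_supp[h1 h2]]; split=> [i|].
  have := h1 i; rewrite /stshift /oppst /sp/= !mxE.
  by move=> /andP[? ?]; apply/andP; split; lra.
by move: h2; rewrite /stshift /oppst /tm/= => /andP[? ?]; apply/andP; split; lra.
Qed.

Lemma intg_mker_r d p : intg lam (fun q => mker d (p, q)).
Proof. exact: (intgZ _ (intg_translate lamT (oppst p) (kern0_intg d))). Qed.

Lemma Rint_mker_r d p : 0 < d -> \int[lam]_q mker d (p, q) = 1.
Proof.
move=> d0; have := Rint_translate lamT (oppst p) (kern0_intg d) => H.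
rewrite RintZ; last exact: (intg_translate lamT (oppst p) (kern0_intg d)).
by rewrite H mulVf// gt_eqF// kernZ_gt0.
Qed.

Definition reflst d q : XT R N := (- (const_mx d + sp q), - (d + tm q)).

Lemma mkerE d p q : mker d (p, q) = (kernZ d)^-1 * kern0 d (stshift (reflst d q) p).
Proof.
rewrite /mker -kern0_sym; congr (_ * kern0 _ _); rewrite /reflst /stshift /oppst /sp /tm/=.
by congr pair; [apply/rowP => i; rewrite !mxE|]; ring.
Qed.

Lemma intg_mker_l d q : intg lam (fun p => mker d (p, q)).
Proof.
under eq_fun do rewrite mkerE.
exact: (intgZ _ (intg_translate lamT (reflst d q) (kern0_intg d))).
Qed.

Lemma Rint_mker_l d q : 0 < d -> \int[lam]_p mker d (p, q) = 1.
Proof.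
move=> d0; under eq_Rintegral do rewrite mkerE.
have := Rint_translate lamT (reflst d q) (kern0_intg d) => H.
rewrite RintZ; last exact: (intg_translate lamT (reflst d q) (kern0_intg d)).
by rewrite H mulVf// gt_eqF// kernZ_gt0.
Qed.

Lemma integral_mker_l d q : 0 < d -> (\int[lam]_p (mker d (p, q))%:E <= 1)%E.
Proof.
move=> d0; rewrite -[leLHS]fineK; last exact: integrable_fin_num (intg_mker_l d q).
by rewrite lee_fin -/(Rintegral _ _ _) Rint_mker_l.
Qed.

Definition moll d w p : R := \int[lam]_q (w q * mker d (p, q)).

Lemma intg_moll_r d w p : intg lam w -> intg lam (fun q => w q * mker d (p, q)).
Proof.
move=> wi; have [M M0 hM] := mker_bounded d.
under eq_fun do rewrite mulrC.
apply: (intgMb (M := M)) wi; first exact: intg_measurable (intg_mker_r d p).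
by move=> q; rewrite ger0_norm ?mker_ge0.
Qed.

Lemma moll_intg d w : 0 < d -> intg lam w -> intg lam (moll d w).
Proof.
move=> d0 wi; have [M M0 hM] := mker_bounded d.
exact: (kernel_intg_norm (measurable_mker d) (mker_ge0 d) hM
  (fun q => integral_mker_l q d0) wi).1.
Qed.

Lemma moll_norm d w : 0 < d -> intg lam w ->
  \int[lam]_p `|moll d w p| <= \int[lam]_p `|w p|.
Proof.
move=> d0 wi; have [M M0 hM] := mker_bounded d.
exact: (kernel_intg_norm (measurable_mker d) (mker_ge0 d) hM
  (fun q => integral_mker_l q d0) wi).2.
Qed.

Lemma mollB d w1 w2 p : intg lam w1 -> intg lam w2 ->
  moll d (fun q => w1 q - w2 q) p = moll d w1 p - moll d w2 p.
Proof.
move=> w1i w2i; rewrite -RintB; [|exact: intg_moll_r..].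
by apply: eq_Rint => q; rewrite mulrBl.
Qed.

Lemma moll_locally_cst d w p c : 0 < d -> (forall q, mker d (p, q) != 0 -> w q = c) ->
  moll d w p = c.
Proof.
move=> d0 wc; rewrite -[RHS]mulr1 -(Rint_mker_r p d0) -RintZ; last exact: intg_mker_r.
apply: eq_Rint => q; have [->|/wc ->//] := eqVneq (mker d (p, q)) 0.
by rewrite !mulr0.
Qed.

Variable dn : nat -> R.
Hypotheses (dn0 : forall n, 0 < dn n) (dn_cvg : dn n @[n --> \oo] --> 0)
  (dn1 : forall n, dn n <= 1).

Definition moll_L1 w := (\int[lam]_p `|moll (dn n) w p - w p|) @[n --> \oo] --> 0.

Let md_intg n w : intg lam w -> intg lam (fun p => `|moll (dn n) w p - w p|).
Proof. by move=> wi; apply/intg_norm/intgB => //; exact: moll_intg. Qed.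

Lemma moll_L1B w1 w2 : intg lam w1 -> intg lam w2 -> moll_L1 w1 -> moll_L1 w2 ->
  moll_L1 (fun p => w1 p - w2 p).
Proof.
move=> w1i w2i h1 h2; rewrite /moll_L1.
apply: cvg0_le (cvg0D h1 h2) => n.
rewrite Rint_ge0//=; rewrite -RintD; [|exact: md_intg..].
apply: Rint_le.
- by apply/md_intg/intgB.
- by apply: intgD; exact: md_intg.
- move=> p; rewrite mollB// (_ : _ - _ = moll (dn n) w1 p - w1 p - (moll (dn n) w2 p - w2 p)).
    exact: ler_normB.
  by ring.
Qed.

(** Mollification is an L^1 contraction, uniformly in its width, so the functions that it
    approximates form a closed set. *)
Lemma moll_L1_closed w : intg lam w ->
  (forall e, 0 < e -> exists w', [/\ intg lam w', moll_L1 w' & \int[lam]_p `|w p - w' p| <= e]) ->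
  moll_L1 w.
Proof.
move=> wi h; apply/cvgr0Pnorm_lt => e e0.
have e30 : 0 < e / 3 by rewrite divr_gt0.
have [w' [w'i /cvgr0Pnorm_lt/(_ _ e30) w'L0 ww']] := h _ e30.
near=> n; have w'L : `|\int[lam]_p `|moll (dn n) w' p - w' p| | < e / 3 by near: n.
rewrite ger0_norm in w'L; last by apply: Rint_ge0.
rewrite ger0_norm; last by apply: Rint_ge0.
have wBi : intg lam (fun p => w p - w' p) by exact: intgB.
have H : \int[lam]_p `|moll (dn n) w p - w p| <=
    \int[lam]_p `|moll (dn n) (fun p => w p - w' p) p| +
    \int[lam]_p `|moll (dn n) w' p - w' p| + \int[lam]_p `|w p - w' p|.
  have i1 : intg lam (fun p => `|moll (dn n) (fun p => w p - w' p) p|).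
    by apply/intg_norm/moll_intg.
  rewrite -RintD//; last exact: md_intg.
  rewrite -RintD//; last 2 first.
  - by apply: intgD => //; exact: md_intg.
  - exact: intg_norm.
  apply: Rint_le; first exact: md_intg.
    by apply: intgD; [apply: intgD => //; exact: md_intg|exact: intg_norm].
  move=> p; rewrite mollB//.
  rewrite (_ : _ - w p = moll (dn n) w p - moll (dn n) w' p + (moll (dn n) w' p - w' p)
    - (w p - w' p)); last by ring.
  by apply: (le_trans (ler_normB _ _)); rewrite lerD2r; exact: ler_normD.
have := moll_norm (dn0 n) wBi; lra.
Unshelve. all: by end_near.
Qed.

Lemma dn_near e : 0 < e -> \forall n \near \oo, dn n < e.
Proof.
move=> e0; have /cvgr0Pnorm_lt/(_ _ e0) := dn_cvg.
by apply: filterS => n; rewrite gtr0_norm.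
Qed.

(** The kernel at [p] sees only points strictly below [p] in each coordinate. Moving slightly down
    neither leaves an interval []a, b]] nor enters it from outside, so the indicator is eventually
    constant on what the kernel sees. This holds at every point, not just almost every one. *)
Lemma moll_stbox_cvg a b c e p : \forall n \near \oo,
  moll (dn n) (\1_(stbox a b c e)) p = \1_(stbox a b c e) p.
Proof.
suff : \forall n \near \oo, forall q, mker (dn n) (p, q) != 0 ->
    \1_(stbox a b c e) q = \1_(stbox a b c e) p :> R.
  by apply: filterS => n h; exact: moll_locally_cst.
rewrite (_ : \1_(stbox a b c e) p = (p \in stbox a b c e)%:R :> R) ?indicE//; have [|] := boolP (p \in stbox a b c e).
  rewrite inE => -[h1 /andP[ct te]].
  have hs : \forall n \near \oo, forall i : 'I_N, dn n < sp p 0 i - a 0 i.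
    by apply: filter_forall => i; apply: dn_near; have /andP[? ?] := h1 i; rewrite subr_gt0.
  have ht : \forall n \near \oo, dn n < tm p - c by apply: dn_near; rewrite subr_gt0.
  near=> n.
  have hd : forall i, dn n < sp p 0 i - a 0 i by near: n.
  have hd' : dn n < tm p - c by near: n.
  move=> q /mker_supp[q1 /andP[q2 q3]].
  rewrite indicE mem_set//; split.
    move=> i; have /andP[q1l q1r] := q1 i; have /andP[h1l h1r] := h1 i.
    by have hdi := hd i; apply/andP; split; lra.
  by apply/andP; split; lra.
rewrite notin_setE /stbox/= => /not_andP[/existsNP[i]|] /negP; rewrite negb_and -!leNgt -ltNge.
  move=> /orP[pa|bp].
    apply: nearW => n q /mker_supp[/(_ i)/andP[q1 q2] _].
    rewrite indicE memNset// => -[/(_ i)/andP[h _] _]; lra.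
  have ht : \forall n \near \oo, dn n < sp p 0 i - b 0 i by apply: dn_near; rewrite subr_gt0.
  apply: filterS ht => n ht q /mker_supp[/(_ i)/andP[q1 q2] _].
  by rewrite indicE memNset// => -[/(_ i)/andP[_ h] _]; lra.
move=> /orP[pa|bp].
  apply: nearW => n q /mker_supp[_ /andP[q1 q2]].
  by rewrite indicE memNset// => -[_ /andP[h _]]; lra.
have ht : \forall n \near \oo, dn n < tm p - e by apply: dn_near; rewrite subr_gt0.
apply: filterS ht => n ht q /mker_supp[_ /andP[q1 q2]].
by rewrite indicE memNset// => -[_ /andP[_ h]]; lra.
Unshelve. all: by end_near.
Qed.

Lemma moll_indic_le1 d (A : set (XT R N)) p : 0 < d -> measurable A ->
  (lam A < +oo)%E -> 0 <= moll d \1_A p <= 1.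
Proof.
move=> d0 mA Aoo; rewrite Rint_ge0 ?mulr_ge0//=; last by move=> q; rewrite mulr_ge0// mker_ge0.
rewrite -(Rint_mker_r p d0); apply: Rint_le.
- exact/intg_moll_r/intg_indic.
- exact: intg_mker_r.
- by move=> q; rewrite ler_piMl ?mker_ge0// indicE lern1 leq_b1.
Qed.

Lemma moll_L1_stbox a b c e : moll_L1 \1_(stbox a b c e).
Proof.
(* The kernel looks down by less than [dn n <= 1], hence the mollified indicator lives in the box
   enlarged by 1 at its upper ends. *)
pose B' : set (XT R N) := stbox a (b + const_mx 1) c (e + 1).
have Bi := intg_stbox a b c e.
have mBi n : intg lam (fun p => `|moll (dn n) \1_(stbox a b c e) p - \1_(stbox a b c e) p|).
  exact: md_intg.
have := @Rint_dominated _ _ _ lam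
  (fun n p => `|moll (dn n) \1_(stbox a b c e) p - \1_(stbox a b c e) p|) (fun=> 0) \1_B'.
move=> /(_ (fun n => intg_measurable (mBi n)))[]//.
- move=> p; apply: cvg_near_cst; have := moll_stbox_cvg a b c e p.
  by apply: filterS => n ->; rewrite subrr normr0.
- exact: intg_stbox.
- move=> n p; rewrite normr_id.
  have /andP[m0 m1] := moll_indic_le1 p (dn0 n) (measurable_stbox a b c e) (lam_box a b c e).
  have : 0 <= (\1_(stbox a b c e) p : R) <= 1 by rewrite indicE ler0n lern1 leq_b1.
  move=> /andP[i0 i1].
  have [pB|pB] := boolP (p \in B').
    by rewrite [leRHS]indicE pB (_ : true%:R = 1)// ler_norml; apply/andP; split; lra.
  have hq q : stbox a b c e q -> mker (dn n) (p, q) != 0 -> False.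
    move=> [q1 /andP[q2 q3]] /mker_supp[pq1 /andP[pq2 pq3]].
    move: pB; rewrite notin_setE; apply; split.
      move=> i; rewrite !mxE; have /andP[h1 h2] := q1 i; have /andP[h3 h4] := pq1 i.
      by have h5 := dn1 n; apply/andP; split; lra.
    by have h5 := dn1 n; apply/andP; split; lra.
  rewrite (moll_locally_cst (c := 0) (dn0 n)); last first.
    by move=> q pq; rewrite indicE memNset// => /hq/(_ pq).
  rewrite [X in _ - X]indicE memNset ?subr0 ?normr0//.
  move=> [p1 /andP[p2 p3]]; move: pB; rewrite notin_setE; apply; split.
    by move=> i; rewrite !mxE; have /andP[h1 h2] := p1 i; apply/andP; split; lra.
  by apply/andP; split; lra.
move=> _; rewrite Rintegral_cst// mul0r => H.
by apply: H.
Qed.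

End Mollifier.

(** * Convergence of mollifications in L^1, from boxes to all integrable functions *)

Section MollifierConvergence.
Variables (R : realType) (N : nat) (lam : {sigma_finite_measure set (XT R N) -> \bar R}).
Hypothesis lamT : forall (q : XT R N) (A : set (XT R N)), measurable A ->
  lam (stshift q @^-1` A) = lam A.
Hypothesis lam_box : forall (a b : 'rV[R]_N) (c e : R), (lam (stbox a b c e) < +oo)%E.
Hypothesis lam_pos : forall a b : R, a < b ->
  (0 < lam (stbox (const_mx a : 'rV[R]_N) (const_mx b) a b))%E.
Variable dn : nat -> R.
Hypotheses (dn0 : forall n, 0 < dn n) (dn_cvg : dn n @[n --> \oo] --> 0)
  (dn1 : forall n, dn n <= 1).
Implicit Types (p q : XT R N) (w : XT R N -> R) (A : set (XT R N)).

Notation mL1 := (moll_L1 lam dn).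

Let mB := moll_L1B lamT lam_box lam_pos dn0.
Let mclosed := moll_L1_closed lamT lam_box lam_pos dn0.

Lemma moll_L10 : mL1 (fun=> 0).
Proof.
rewrite /moll_L1; apply: cvg_near_cst; apply: nearW => n.
rewrite (_ : (fun p => _) = fun=> 0) ?Rintegral_cst ?mul0r//.
apply/funext => p; rewrite subr0 /moll; under eq_Rintegral do rewrite mul0r.
by rewrite Rintegral_cst// mul0r normr0.
Qed.

Lemma moll_L1D w1 w2 : intg lam w1 -> intg lam w2 -> mL1 w1 -> mL1 w2 ->
  mL1 (fun p => w1 p + w2 p).
Proof.
move=> w1i w2i h1 h2; have zi : intg lam (fun p => 0 - w2 p) by apply: intgB => //; exact: intg0.
have hz := mB (intg0 lam) w2i moll_L10 h2.
have := mB w1i zi h1 hz; congr moll_L1; apply/funext => p; ring.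
Qed.

Lemma moll_L1Z k w : intg lam w -> mL1 w -> mL1 (fun p => k * w p).
Proof.
move=> wi h; rewrite /moll_L1.
have -> : (fun n => \int[lam]_p `|moll lam (dn n) (fun p => k * w p) p - k * w p|) =
    fun n => `|k| * \int[lam]_p `|moll lam (dn n) w p - w p|.
  apply/funext => n; rewrite -RintZ; last first.
    by apply/intg_norm/intgB => //; exact: moll_intg.
  apply: eq_Rint => p; rewrite -normrM mulrBr; congr `|_ - _|.
  rewrite /moll -RintZ; last exact: intg_moll_r.
  by apply: eq_Rint => q; rewrite mulrA.
by rewrite -(mulr0 `|k|); apply: cvgM => //; exact: cvg_cst.
Qed.

Lemma stbox_lty A a b c e : measurable A -> (lam (A `&` stbox a b c e) < +oo)%E.
Proof.
move=> mA; apply: le_lt_trans (lam_box a b c e); apply: le_measure; rewrite ?inE.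
- by apply: measurableI => //; exact: measurable_stbox.
- exact: measurable_stbox.
- by move=> ? [].
Qed.

Lemma intg_indic_stbox A a b c e : measurable A ->
  intg lam (\1_(A `&` stbox a b c e) : XT R N -> R).
Proof.
move=> mA; apply: intg_indic; last exact: stbox_lty.
by apply: measurableI => //; exact: measurable_stbox.
Qed.

Lemma moll_L1_increasing (F : nat -> set (XT R N)) A : (forall n, measurable (F n)) ->
  measurable A -> (lam A < +oo)%E -> (forall n, F n `<=` A) ->
  (forall p, A p -> \forall n \near \oo, F n p) ->
  (forall n, mL1 \1_(F n)) -> mL1 \1_A.
Proof.
move=> mF mA Aoo FA Fp h; apply: mclosed; first exact: intg_indic.
have Fi n : intg lam (\1_(F n) : XT R N -> R).
  apply: intg_indic => //; apply: le_lt_trans Aoo.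
  by apply: le_measure; rewrite ?inE//; exact: FA.
have Ai := intg_indic mA Aoo.
have [||||_] := @Rint_dominated _ _ _ lam (fun n p => `|\1_A p - \1_(F n) p|) (fun=> 0) \1_A.
- by move=> n; exact: (intg_measurable (intg_norm (intgB Ai (Fi n)))).
- move=> p; apply: cvg_near_cst; have [pA|pA] := pselect (A p).
    by apply: filterS (Fp p pA) => n Fnp; rewrite !indicE !mem_set// subrr normr0.
  apply: nearW => n; rewrite !indicE !memNset ?subrr ?normr0//.
  by move=> /FA.
- exact: Ai.
- move=> n p; rewrite normr_id !indicE.
  have [pF|pF] := boolP (p \in F n).
    have -> : p \in A by rewrite inE; apply: (FA n); rewrite -inE.
    by rewrite subrr normr0.
  by rewrite subr0 ger0_norm.
rewrite Rintegral_cst// mul0r => /cvgr0Pnorm_lt H e e0.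
have [n _ /(_ n (leqnn n)) Hn] := H e e0.
exists \1_(F n); split => //.
by move: Hn; rewrite ger0_norm ?Rint_ge0// => /ltW.
Qed.

(** Dynkin induction on [A]. The intersection with a box keeps every indicator integrable, in
    particular that of a complement. *)
Lemma moll_L1_indic_stbox A : measurable A ->
  forall a b c e, mL1 \1_(A `&` stbox a b c e).
Proof.
rewrite measurable_stboxes.
apply: (@dynkin_induction _ (XT R N) (@stboxes R N)
  (fun A => forall a b c e, mL1 \1_(A `&` stbox a b c e)) (@measurable_stboxes R N)).
- move=> _ _ [a [b [c [e ->]]]] [a' [b' [c' [e' ->]]]].
  by have [a1 [b1 [c1 [e1 ->]]]] := stboxI a b c e a' b' c' e'; do 4 eexists.
- by move=> a b c e; rewrite setTI; exact: moll_L1_stbox.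
- move=> _ [a [b [c [e ->]]]] a' b' c' e'.
  by have [a1 [b1 [c1 [e1 ->]]]] := stboxI a b c e a' b' c' e'; exact: moll_L1_stbox.
- move=> S mS PS a b c e.
  have := mB (intg_stbox lam_box a b c e) (intg_indic_stbox a b c e mS)
    (moll_L1_stbox lamT lam_box lam_pos dn0 dn_cvg dn1 a b c e) (PS a b c e).
  congr moll_L1; apply/funext => p; rewrite !indicE !in_setI in_setC.
  by case: (p \in S); rewrite /= ?subr0 ?subrr.
- move=> F mF tF PF a b c e; pose B : set (XT R N) := stbox a b c e.
  pose U n := \big[setU/set0]_(k < n) F k.
  have mU n : measurable (U n) by apply: bigsetU_measurable.
  have mFT : measurable (\bigcup_k F k) by apply: bigcupT_measurable.
  apply: (@moll_L1_increasing (fun n => U n `&` B)).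
  + by move=> n; apply: measurableI => //; exact: measurable_stbox.
  + by apply: measurableI => //; exact: measurable_stbox.
  + exact: stbox_lty.
  + by move=> n p [Up Bp]; split => //; exact: bigsetU_bigcup Up.
  + move=> p [[k _ Fkp] Bp]; exists k.+1 => // n /= kn; split => //.
    by rewrite /U -bigcup_mkord; exists k.
  + elim=> [|n ih].
      rewrite /U big_ord0 set0I (_ : \1_set0 = fun=> 0); first exact: moll_L10.
      by apply/funext => p; rewrite indicE in_set0.
    have := moll_L1D (intg_indic_stbox a b c e (mU n)) (intg_indic_stbox a b c e (mF n))
      ih (PF n a b c e).
    congr moll_L1; apply/funext => p; rewrite !indicE !in_setI /U big_ord_recr/= in_setU.
    have [pU|pU] := boolP (p \in \big[setU/set0]_(i < n) F i); last first.
      by rewrite add0r.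
    have [pF|_] := boolP (p \in F n); last by rewrite addr0.
    move: pU pF; rewrite !inE -bigcup_mkord => -[k /= kn Fk] Fn.
    have /trivIsetP/(_ k n I I) := tF; rewrite (ltn_eqF kn) => /(_ isT) h.
    by have : (F k `&` F n) p by []; rewrite h.
Qed.

Lemma moll_L1_indic A : measurable A -> (lam A < +oo)%E -> mL1 \1_A.
Proof.
move=> mA Aoo.
pose B n : set (XT R N) := stbox (const_mx (- n%:R)) (const_mx n%:R) (- n%:R) n%:R.
apply: (@moll_L1_increasing (fun n => A `&` B n)) => //.
- by move=> n; apply: measurableI => //; exact: measurable_stbox.
- move=> p Ap; have : [set: XT R N] p by [].
  rewrite -bigcup_stbox => -[k _ [h1 /andP[h2 h3]]]; exists k => // n /= kn; split => //.
  have kn' : k%:R <= n%:R :> R by rewrite ler_nat.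
  split.
    move=> i; have := h1 i; rewrite !mxE => /andP[h4 h5].
    by apply/andP; split; lra.
  by apply/andP; split; lra.
- by move=> n; exact: moll_L1_indic_stbox.
Qed.

Lemma intg_indic_lty A : measurable A -> intg lam (\1_A : XT R N -> R) -> (lam A < +oo)%E.
Proof.
move=> mA /integrableP[_]; under eq_integral do rewrite /= ger0_norm//.
by rewrite integral_indic// setIT.
Qed.

Import HBSimple.

Lemma moll_L1_sfun (f : {sfun XT R N >-> R}) : intg lam f -> mL1 f.
Proof.
move=> fi; pose s := finmap.enum_fset (fset_set (range f)).
have fE p : f p = \sum_(y <- s) y * \1_(f @^-1` [set y]) p.
  by rewrite {1}fimfunE fsbig_finite.
have mf y : measurable (f @^-1` [set y]) by exact: measurable_sfunP.
have term y : intg lam (fun p => y * \1_(f @^-1` [set y]) p) /\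
    mL1 (fun p => y * \1_(f @^-1` [set y]) p).
  (* The level set of the value 0 may have infinite measure and is treated apart. *)
  have [->|y0] := eqVneq y 0.
    under eq_fun do rewrite mul0r; split; first exact: intg0.
    exact: moll_L10.
  have ii : intg lam (\1_(f @^-1` [set y]) : XT R N -> R).
    apply: (intg_le _ (intgZ (`|y|^-1) (intg_norm fi))).
      exact: measurable_indic.
    move=> p; rewrite indicE; have [|_] := boolP (_ \in _); last first.
      by rewrite normr0 mulr_ge0// invr_ge0.
    by rewrite inE /= => ->; rewrite normr1 mulVf// normr_eq0.
  split; first exact: intgZ.
  by apply: moll_L1Z => //; apply: moll_L1_indic => //; exact: intg_indic_lty.
have -> : (f : XT R N -> R) = fun p => \sum_(y <- s) y * \1_(f @^-1` [set y]) p.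
  exact/funext.
elim: s {fE} => [|y s ih].
  by under eq_fun do rewrite big_nil; exact: moll_L10.
under eq_fun do rewrite big_cons; apply: moll_L1D => //.
- exact: (term y).1.
- exact: (Rint_sum s (fun y => (term y).1)).1.
- exact: (term y).2.
Qed.

Theorem moll_L1_cvg w : intg lam w -> mL1 w.
Proof.
move=> wi; apply: mclosed => // e e0.
have [g [gi _ gw]] := approximation_sfun_integrable measurableT wi.
have gwi n : intg lam (fun p => `|w p - g n p|) by apply/intg_norm/intgB => //; exact: gi.
have gw' : (\int[lam]_p `|w p - g n p|) @[n --> \oo] --> 0.
  exact: (fine_cvg gw).
have /cvgr0Pnorm_lt/(_ e e0)[n _ /(_ n (leqnn n)) Hn] := gw'.
exists (g n); split; first exact: gi.
  exact/moll_L1_sfun/gi.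
by move: Hn; rewrite ger0_norm ?Rint_ge0// => /ltW.
Qed.

(** * A measure on the slice [t = 0] as a source term *)

Section InitialTrace.
Variables (alpha : {finite_measure set (RN R N) -> \bar R}) (z : XT R N -> R) (M : R).
Hypotheses (mz : measurable_fun setT z) (M0 : 0 <= M) (zM : forall p, `|z p| <= M).
Hypothesis zc : forall (y : 'rV[R]_N) e, 0 < e -> \forall n \near \oo,
  forall p, mker lam (dn n) (p, (y, 0)) != 0 -> `|z p - z (y, 0)| <= e.

(** The mollification of the measure [alpha], placed on the slice [t = 0], as a function on
    space-time. *)
Definition mtrace n p : R := \int[alpha]_y mker lam (dn n) (p, (y, 0)).

Let J n (py : XT R N * RN R N) : R := mker lam (dn n) (py.1, (py.2, 0)).

Let mJ n : measurable_fun setT (J n).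
Proof.
apply: (measurableT_comp (measurable_mker lam (dn n))).
apply: measurable_fun_pair; first exact: measurable_fst.
by apply: measurable_fun_pair; [exact: measurable_snd|exact: measurable_cst].
Qed.

Let one_intg : intg alpha (fun _ : RN R N => 1 : R).
Proof. exact: finite_measure_integrable_cst. Qed.

Let mtraceE n : mtrace n = fun p => \int[alpha]_y (1 * J n (p, y)).
Proof. by apply/funext => p; apply: eq_Rint => y; rewrite mul1r. Qed.

Let J1 n y : (\int[lam]_p (J n (p, y))%:E <= 1)%E.
Proof. exact: (integral_mker_l lamT lam_box lam_pos (y, 0) (dn0 n)). Qed.

Lemma mtrace_intg n : intg lam (mtrace n).
Proof.
have [C _ hC] := mker_bounded lam (dn n).
have hC' py : J n py <= C by exact: hC.
rewrite mtraceE.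
exact: (kernel_intg_norm (mJ n) (fun py => mker_ge0 _ _ _) hC' (J1 n) one_intg).1.
Qed.

(** Fubini puts the average of [z] around [(y, 0)] under the integral against [alpha]. These
    averages converge to [z (y, 0)] by [zc] and are bounded by [M], which is integrable since
    [alpha] is finite. *)
Lemma mtrace_cvg :
  (\int[lam]_p (z p * mtrace n p)) @[n --> \oo] --> \int[alpha]_y z (y, 0).
Proof.
have E n : \int[lam]_p (z p * mtrace n p) =
    \int[alpha]_y \int[lam]_p (z p * J n (p, y)).
  have [C _ hC] := mker_bounded lam (dn n).
  have hC' py : J n py <= C by exact: hC.
  rewrite mtraceE (kernel_swap (mJ n) (fun py => mker_ge0 _ _ _) hC' (J1 n) one_intg mz M0 zM).
  by apply: eq_Rint => y; rewrite mul1r.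
under eq_fun do rewrite E.
have Ji n y : intg lam (fun p => J n (p, y)) by exact: (intg_mker_l lamT lam_box (dn n) (y, 0)).
have zJi n y : intg lam (fun p => z p * J n (p, y)) by exact: (intgMb mz zM).
have Rn n y : \int[lam]_p J n (p, y) = 1 by exact: (Rint_mker_l lamT lam_box lam_pos (y, 0) (dn0 n)).
have J0 n py : 0 <= J n py by exact: mker_ge0.
apply: (@Rint_dominated _ _ _ alpha _ _ (fun=> M) _ _ _ _).2.
- move=> n; have [C _ hC] := mker_bounded lam (dn n).
  have hC' py : J n py <= C by exact: hC.
  have := measurable_fubini_G (kernel_weighted_integrable (mJ n) (J0 n) (J1 n) one_intg mz M0 zM).
  move=> /(measurableT_comp (fine_measurable measurableT)).
  apply: eq_measurable_fun => y _ /=.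
  by congr fine; apply: eq_integral => p _; rewrite mul1r.
- move=> y; apply/cvgrPdist_le => e e0; apply: filterS (zc y e0) => n hn.
  rewrite -[X in `|X - _|]mulr1 -(Rn n y) -RintZ// -RintB//; last exact: intgZ.
  have -> : e = \int[lam]_p (e * J n (p, y)) by rewrite RintZ// Rn mulr1.
  have di : intg lam (fun p => z (y, 0) * J n (p, y) - z p * J n (p, y)).
    by apply: intgB => //; exact: intgZ.
  apply: (le_trans (Rint_norm di)); apply: Rint_le; [exact: intg_norm|exact: intgZ|].
  move=> p; rewrite -mulrBl normrM (ger0_norm (J0 _ _)).
  have [->|h] := eqVneq (J n (p, y)) 0; first by rewrite !mulr0.
  by rewrite ler_wpM2r// distrC; exact: hn.
- exact: finite_measure_integrable_cst.
- move=> n y; apply: (le_trans (Rint_normMb mz zM (Ji n y))).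
  under eq_Rintegral do rewrite (ger0_norm (J0 _ _)).
  by rewrite Rn mulr1.
Qed.

End InitialTrace.

End MollifierConvergence.

(** * Products of one-variable functions *)

Section ProductTests.
Variables (R : realType) (N : nat).
Implicit Types (x a b : 'rV[R]_N) (p q : XT R N) (f g Lf Lg : 'rV[R]_N -> R).

Definition prodf (P : 'I_N -> R -> R) x : R := \prod_i P i (x 0 i).
Definition lapf (P P2 : 'I_N -> R -> R) x : R :=
  \sum_j P2 j (x 0 j) * \prod_(i | i != j) P i (x 0 i).

(** In [tspan a b f Lf], the function [Lf] is the Laplacian of [f]. *)
Inductive tspan a b : ('rV[R]_N -> R) -> ('rV[R]_N -> R) -> Prop :=
| TspanProd P P1 P2 of (forall i, C2c (a 0 i) (b 0 i) (P i) (P1 i) (P2 i)) :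
    tspan a b (prodf P) (lapf P P2)
| TspanLin c f Lf g Lg of tspan a b f Lf & tspan a b g Lg :
    tspan a b (fun x => c * f x + g x) (fun x => c * Lf x + Lg x).

Lemma tspan_eq a b f Lf g Lg : f =1 g -> Lf =1 Lg -> tspan a b f Lf -> tspan a b g Lg.
Proof. by move=> /funext -> /funext ->. Qed.

Lemma tspanZ c a b f Lf : tspan a b f Lf -> tspan a b (fun x => c * f x) (fun x => c * Lf x).
Proof.
by move=> h; apply: tspan_eq (TspanLin (c - 1) h h) => x; ring.
Qed.

Lemma tspanD a b f Lf g Lg : tspan a b f Lf -> tspan a b g Lg ->
  tspan a b (fun x => f x + g x) (fun x => Lf x + Lg x).
Proof. by move=> h1 h2; apply: tspan_eq (TspanLin 1 h1 h2) => x; ring. Qed.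

Lemma tspanB a b f Lf g Lg : tspan a b f Lf -> tspan a b g Lg ->
  tspan a b (fun x => f x - g x) (fun x => Lf x - Lg x).
Proof. by move=> h1 h2; apply: tspan_eq (TspanLin (- 1) h2 h1) => x; ring. Qed.

(** The span is an algebra, which later allows polynomials in a bump to approximate indicators.
    Nested inductions reduce the claim to two products, where the factors multiply coordinate by
    coordinate. *)
Lemma tspanM a b f Lf g Lg : tspan a b f Lf -> tspan a b g Lg ->
  exists L, tspan a b (fun x => f x * g x) L.
Proof.
move=> hf; elim: hf g Lg => {f Lf} [P P1 P2 hP g Lg|c f Lf f' Lf' _ ih _ ih' g Lg hg].
  elim=> {g Lg} [Q Q1 Q2 hQ|c g Lg g' Lg' _ [L h] _ [L' h']].
    eexists; apply: tspan_eq (TspanProd (fun i => C2cM (hP i) (hQ i))) => [x|x].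
      by rewrite /prodf big_split.
    reflexivity.
  eexists; apply: tspan_eq (TspanLin c h h') => [x|x]; last reflexivity.
  by ring.
have [L h] := ih _ _ hg; have [L' h'] := ih' _ _ hg.
eexists; apply: tspan_eq (TspanLin c h h') => [x|x]; last reflexivity.
by ring.
Qed.

Lemma tspan_widen a b a' b' f Lf : (forall i, a' 0 i <= a 0 i) -> (forall i, b 0 i <= b' 0 i) ->
  tspan a b f Lf -> tspan a' b' f Lf.
Proof.
move=> aa bb; elim=> {f Lf} [P P1 P2 h|c f Lf g Lg _ h1 _ h2].
  by apply: TspanProd => i; exact: (C2c_widen (h i) (aa i) (bb i)).
exact: TspanLin.
Qed.

Lemma continuous_coord_comp (h : R -> R) (i : 'I_N) : continuous h ->
  continuous (fun x : 'rV[R]_N => h (x 0 i)).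
Proof. by move=> ch x; apply: (continuous_comp (@coord_continuous _ _ _ _ _ x) (ch _)). Qed.

Lemma continuous_prod_seq (I : Type) (s : seq I) (Q : pred I) (F : I -> 'rV[R]_N -> R) :
  (forall i, continuous (F i)) -> continuous (fun x => \prod_(i <- s | Q i) F i x).
Proof.
move=> cF; elim: s => [|i s ih].
  rewrite (_ : (fun x => _) = fun=> 1); first by move=> x; exact: cst_continuous.
  by apply/funext => x; rewrite big_nil.
have [Qi|Qi] := boolP (Q i).
  rewrite (_ : (fun x => _) = fun x => F i x * \prod_(i <- s | Q i) F i x).
    by move=> x; apply: continuousM; [exact: cF|exact: ih].
  by apply/funext => x; rewrite big_cons Qi.
rewrite (_ : (fun x => _) = fun x => \prod_(i <- s | Q i) F i x)//.
by apply/funext => x; rewrite big_cons (negbTE Qi).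
Qed.

Lemma continuous_sum_seq (I : Type) (s : seq I) (F : I -> 'rV[R]_N -> R) :
  (forall i, continuous (F i)) -> continuous (fun x => \sum_(i <- s) F i x).
Proof.
move=> cF; elim: s => [|i s ih].
  rewrite (_ : (fun x => _) = fun=> 0); first by move=> x; exact: cst_continuous.
  by apply/funext => x; rewrite big_nil.
rewrite (_ : (fun x => _) = fun x => F i x + \sum_(i <- s) F i x).
  by move=> x; apply: continuousD; [exact: cF|exact: ih].
by apply/funext => x; rewrite big_cons.
Qed.

Lemma prodf_continuous a b P P1 P2 :
  (forall i, C2c (a 0 i) (b 0 i) (P i) (P1 i) (P2 i)) -> continuous (prodf P).
Proof.
move=> h; apply: continuous_prod_seq => i; apply: continuous_coord_comp.
exact: C2c_continuous (h i).
Qed.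

Lemma lapf_continuous a b P P1 P2 :
  (forall i, C2c (a 0 i) (b 0 i) (P i) (P1 i) (P2 i)) -> continuous (lapf P P2).
Proof.
move=> h; apply: continuous_sum_seq => j x; apply: continuousM.
  exact: (continuous_coord_comp (C2c_continuous2 (h j))).
apply: continuous_prod_seq => i; apply: continuous_coord_comp.
exact: C2c_continuous (h i).
Qed.

Lemma tspan_continuous a b f Lf : tspan a b f Lf -> continuous f /\ continuous Lf.
Proof.
elim=> {f Lf} [P P1 P2 h|c f Lf g Lg _ [h1 h1'] _ [h2 h2']].
  by split; [exact: prodf_continuous h|exact: lapf_continuous h].
have cM (u v : 'rV[R]_N -> R) : continuous u -> continuous v ->
    continuous (fun x => c * u x + v x).
  move=> cu cv x.
  have cx : {for x, continuous (fun x => c * u x)}.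
    by apply: continuousM; [exact: cst_continuous|exact: cu].
  exact: (continuousD cx (cv x)).
by split; exact: cM.
Qed.

Lemma prodf_out (a b : 'rV[R]_N) P x (Q : pred 'I_N) i :
  (forall i y, ~~ (a 0 i < y < b 0 i) -> P i y = 0 :> R) ->
  Q i -> ~~ (a 0 i < x 0 i < b 0 i) -> \prod_(j | Q j) P j (x 0 j) = 0.
Proof. by move=> h Qi hi; rewrite (bigD1 i)//= h// mul0r. Qed.

Lemma tspan_out a b f Lf : tspan a b f Lf ->
  forall x, ~ (forall i, a 0 i < x 0 i < b 0 i) -> f x = 0 /\ Lf x = 0.
Proof.
move=> + x /existsNP[i /negP xi].
elim=> {f Lf} [P P1 P2 h|c f Lf g Lg _ [h1 h1'] _ [h2 h2']]; last first.
  by rewrite h1 h1' h2 h2' !mulr0 addr0.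
have P0 j y : ~~ (a 0 j < y < b 0 j) -> P j y = 0 by move=> hy; exact: (C2c_out (h j) hy).
split; first exact: (prodf_out P0 _ xi).
rewrite /lapf big1// => j _; have [ij|ij] := eqVneq i j.
  by rewrite -ij (C2c_out2 (h i) xi) mul0r.
by rewrite (prodf_out P0 _ xi) ?mulr0.
Qed.

(** The product may have fewer than [N] factors; [1 <= M] gives one bound for all of them. *)
Lemma prod_bounded (P : 'I_N -> R -> R) (M : R) (Q : pred 'I_N) x : 1 <= M ->
  (forall i y, `|P i y| <= M) -> `|\prod_(i | Q i) P i (x 0 i)| <= M ^+ N.
Proof.
move=> M1 hP; rewrite normr_prod; have M0 : 0 <= M by rewrite (le_trans ler01).
apply: (@le_trans _ _ (\prod_(i < N | Q i) M)).
  by apply: ler_prod => i _; rewrite normr_ge0/= hP.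
rewrite prodr_const -[X in _ <= _ ^+ X]card_ord; apply: ler_weXn2l => //.
exact: max_card.
Qed.

Lemma C2c_bounded_fam a b P P1 P2 :
  (forall i, C2c (a 0 i) (b 0 i) (P i) (P1 i) (P2 i)) ->
  exists2 M, 1 <= M & forall i y, [/\ `|P i y| <= M, `|P1 i y| <= M & `|P2 i y| <= M].
Proof.
move=> h.
have /choice[M hM] : forall i, exists M, 0 <= M /\
    forall y, [/\ `|P i y| <= M, `|P1 i y| <= M & `|P2 i y| <= M].
  by move=> i; have [M M0 hM] := C2c_bounded (h i); exists M.
have S0 : 0 <= \sum_i M i by apply: sumr_ge0 => i _; exact: (hM i).1.
exists (1 + \sum_i M i); first by rewrite lerDl.
move=> i y; have Mi : M i <= 1 + \sum_i M i.
  rewrite (bigD1 i)//= addrCA lerDl addr_ge0// sumr_ge0// => j _; exact: (hM j).1.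
have [h1 h2 h3] := (hM i).2 y.
by split; [exact: le_trans h1 Mi|exact: le_trans h2 Mi|exact: le_trans h3 Mi].
Qed.

Lemma tspan_bounded a b f Lf : tspan a b f Lf ->
  exists2 M, 0 <= M & forall x, `|f x| <= M /\ `|Lf x| <= M.
Proof.
elim=> {f Lf} [P P1 P2 h|c f Lf g Lg _ [M M0 hM] _ [M' M0' hM']].
  have [M M1 hM] := C2c_bounded_fam h; have M0 : 0 <= M by rewrite (le_trans ler01).
  have PM i y : `|P i y| <= M by have [] := hM i y.
  exists (M ^+ N + \sum_(j < N) (M * M ^+ N)).
    by rewrite addr_ge0 ?exprn_ge0// sumr_ge0// => i _; rewrite mulr_ge0 ?exprn_ge0.
  move=> x; split.
    rewrite (le_trans (prod_bounded _ _ M1 PM))// lerDl sumr_ge0// => i _.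
    by rewrite mulr_ge0 ?exprn_ge0.
  apply: (le_trans (ler_norm_sum _ _ _)); rewrite -[leLHS]add0r lerD ?exprn_ge0//.
  apply: ler_sum => j _; rewrite normrM ler_pM//; first by have [] := hM j (x 0 j).
  exact: prod_bounded.
exists (`|c| * M + M'); first by rewrite addr_ge0 ?mulr_ge0.
move=> x; have [h1 h2] := hM x; have [h1' h2'] := hM' x.
by split; apply: (le_trans (ler_normD _ _)); rewrite lerD// normrM ler_wpM2l.
Qed.

End ProductTests.

Lemma cvg_sum_seq (R : realType) (I : Type) (s : seq I) (u : I -> nat -> R) (l : I -> R) :
  (forall i, u i n @[n --> \oo] --> l i) ->
  (\sum_(i <- s) u i n) @[n --> \oo] --> \sum_(i <- s) l i.
Proof.
move=> ul; elim: s => [|i s ih].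
  by under eq_fun do rewrite big_nil; rewrite big_nil; exact: cvg_cst.
under eq_fun do rewrite big_cons; rewrite big_cons.
by apply: cvgD; [exact: ul|exact: ih].
Qed.

(** * Finite differences for the backward heat operator *)

Section Stencil.
Variables (R : realType) (N : nat).
Implicit Types (x a b : 'rV[R]_N) (p q : XT R N) (f g Lf Lg : 'rV[R]_N -> R) (F : XT R N -> R).

Definition hn (n : nat) : R := n.+1%:R^-1.

Lemma hn_gt0 n : 0 < hn n. Proof. by rewrite invr_gt0 ltr0n. Qed.

(** A forward difference in time, which has the sign of [- d/dt], and the two neighbours in each
    coordinate, which give minus the second difference. All weights are positive, as the discrete
    Kato inequality requires. *)
Definition sten (n : nat) : seq (R * XT R N) :=
  ((hn n)^-1, (0, hn n) : XT R N) ::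
  [seq ((hn n)^-2, (hn n *: @ei R N i, 0) : XT R N) | i <- index_enum 'I_N] ++
  [seq ((hn n)^-2, (- hn n *: @ei R N i, 0) : XT R N) | i <- index_enum 'I_N].

Lemma sten_ge0 n : all (fun l => 0 <= l.1) (sten n).
Proof.
have h0 := hn_gt0 n; rewrite /= all_cat !all_map invr_ge0 (ltW h0)/=.
by rewrite !(eq_all (a2 := xpredT)) ?all_predT// => i /=; rewrite invr_ge0 exprn_ge0 ?ltW.
Qed.

Lemma fdiff_lin s c F G p :
  fdiff s (fun q => c * F q + G q) p = c * fdiff s F p + fdiff s G p.
Proof.
rewrite /fdiff mulr_sumr -big_split; apply: eq_bigr => l _ /=; ring.
Qed.

Lemma near_point_cvg (h : R -> R) (u : nat -> R) y : continuous h ->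
  (forall n, exists2 y', y - hn n < y' < y + hn n & u n = h y') -> u n @[n --> \oo] --> h y.
Proof.
move=> ch hu; apply/cvgrPdist_lt => e e0.
have /cvgrPdist_lt/(_ e e0)/nbhs_ballP[d /= d0 hd] := ch y.
have := near_infty_natSinv_lt (PosNum d0); apply: filterS => n /= hnd.
have [y' /andP[y1 y2] ->] := hu n; apply: hd; rewrite /ball/= ltr_norml.
move: hnd; rewrite -/(hn n); move: (hn n) y1 y2 => k y1 y2 kd; apply/andP; split; lra.
Qed.

Lemma C2c_diff1 (c d : R) (u u1 u2 : R -> R) (y : R) (n : nat) : C2c c d u u1 u2 ->
  exists2 y', y - hn n < y' < y + hn n & (hn n)^-1 * (u y - u (y + hn n)) = - u1 y'.
Proof.
move=> h; have h0 := hn_gt0 n; have [y' /andP[y1 y2] e] := C2c_mvt h y h0.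
exists y'; first by move: (hn n) h0 y1 y2 => h0' h0 y1 y2; apply/andP; split; lra.
by rewrite -opprB e mulrN mulrCA mulVf ?mulr1// gt_eqF.
Qed.

Lemma C2c_diff2 (c d : R) (u u1 u2 : R -> R) (y : R) (n : nat) : C2c c d u u1 u2 ->
  exists2 y', y - hn n < y' < y + hn n &
    (hn n)^-2 * (2 * u y - u (y + hn n) - u (y - hn n)) = - u2 y'.
Proof.
move=> h; have h0 := hn_gt0 n; have [y' yy e] := C2c_second_diff h y h0.
by exists y' => //; rewrite e mulrCA mulVf ?mulr1// expf_neq0// gt_eqF.
Qed.

Section Products.
Variables (P P1 P2 : 'I_N -> R -> R) (a b : 'rV[R]_N) (a0 b0 : R) (eta eta1 eta2 : R -> R).
Hypotheses (hP : forall i, C2c (a 0 i) (b 0 i) (P i) (P1 i) (P2 i))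
  (he : C2c a0 b0 eta eta1 eta2).

Let z p : R := prodf P (sp p) * eta (tm p).

(** For a product, space-time differences reduce to differences of single factors. Each of them is a
    derivative at an intermediate point, which yields both the limit and a bound uniform in [n]. *)
Lemma fdiff_stenE n p : fdiff (sten n) z p =
  prodf P (sp p) * ((hn n)^-1 * (eta (tm p) - eta (tm p + hn n))) +
  \sum_j (\prod_(i | i != j) P i (sp p 0 i)) * eta (tm p) *
    ((hn n)^-2 * (2 * P j (sp p 0 j) - P j (sp p 0 j + hn n) - P j (sp p 0 j - hn n))).
Proof.
rewrite /fdiff /sten big_cons big_cat !big_map/= -[X in _ + X]big_split/=; congr (_ + _).
  by rewrite /z /stshift /sp /tm/= addr0; ring.
apply: eq_bigr => j _.
have E h : z (stshift ((h *: @ei R N j, 0) : XT R N) p) =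
    (\prod_(i | i != j) P i (sp p 0 i)) * eta (tm p) * P j (sp p 0 j + h).
  rewrite /z /stshift [tm (_, _)]/= addr0 /prodf (bigD1 j)//=.
  rewrite /sp /ei/= !mxE !eqxx/= mulr1 [RHS]mulrC -mulrA; congr (_ * (_ * _)).
  by apply: eq_bigr => i ij; rewrite !mxE (negbTE ij) andbF mulr0 addr0.
rewrite !E {1 2}/z /prodf (bigD1 j)//=; ring.
Qed.

Lemma fdiff_sten_prod_cvg p : fdiff (sten n) z p @[n --> \oo] -->
  - (prodf P (sp p) * eta1 (tm p)) - lapf P P2 (sp p) * eta (tm p).
Proof.
under eq_fun do rewrite fdiff_stenE.
have -> : - (prodf P (sp p) * eta1 (tm p)) - lapf P P2 (sp p) * eta (tm p) =
  prodf P (sp p) * (- eta1 (tm p)) +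
  \sum_j (\prod_(i | i != j) P i (sp p 0 i)) * eta (tm p) * (- P2 j (sp p 0 j)).
  rewrite mulrN; congr (_ + _); rewrite -mulNr -sumrN mulr_suml.
  by apply: eq_bigr => j _; ring.
apply: cvgD.
  apply: cvgM; first exact: cvg_cst.
  apply: (@near_point_cvg (fun y => - eta1 y)).
    by move=> y; apply: cvgN; exact: (C2c_continuous1 he).
  by move=> n; exact: C2c_diff1 he.
apply: cvg_sum_seq => j; apply: cvgM; first exact: cvg_cst.
apply: (@near_point_cvg (fun y => - P2 j y)).
  by move=> y; apply: cvgN; exact: (C2c_continuous2 (hP j)).
by move=> n; exact: C2c_diff2 (hP j).
Qed.

Lemma fdiff_sten_prod_bounded : exists2 C, 0 <= C & forall n p, `|fdiff (sten n) z p| <= C.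
Proof.
have [M M1 hM] := C2c_bounded_fam hP; have M0 : 0 <= M by rewrite (le_trans ler01).
have PM i y : `|P i y| <= M by have [] := hM i y.
have [K K0 hK] := C2c_bounded he.
exists (M ^+ N * K + \sum_(j < N) M ^+ N * K * M).
  by rewrite addr_ge0 ?sumr_ge0// => [|j _]; rewrite ?mulr_ge0 ?exprn_ge0.
move=> n p; rewrite fdiff_stenE; apply: (le_trans (ler_normD _ _)); apply: lerD.
  rewrite normrM ler_pM//; first exact: prod_bounded.
  have [y _ ->] := C2c_diff1 (tm p) n he.
  by rewrite normrN; have [] := hK y.
apply: (le_trans (ler_norm_sum _ _ _)); apply: ler_sum => j _.
rewrite normrM; apply: ler_pM => //.
  rewrite normrM; apply: ler_pM => //; first exact: prod_bounded.
  by have [] := hK (tm p).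
have [y _ ->] := C2c_diff2 (sp p 0 j) n (hP j).
by rewrite normrN; have [] := hM j y.
Qed.

End Products.

Section Span.
Variables (a b : 'rV[R]_N) (a0 b0 : R) (eta eta1 eta2 : R -> R).
Hypothesis he : C2c a0 b0 eta eta1 eta2.

(** The action of the backward operator [- d/dt - Lap] on [f(x) eta(t)]. *)
Definition bheat f Lf p : R := - (f (sp p) * eta1 (tm p)) - Lf (sp p) * eta (tm p).

Lemma fdiff_sten_cvg f Lf p : tspan a b f Lf ->
  fdiff (sten n) (fun q => f (sp q) * eta (tm q)) p @[n --> \oo] --> bheat f Lf p.
Proof.
elim=> {f Lf} [P P1 P2 h|c f Lf g Lg _ h1 _ h2]; first exact: (fdiff_sten_prod_cvg h he).
have -> : bheat (fun x => c * f x + g x) (fun x => c * Lf x + Lg x) p =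
    c * bheat f Lf p + bheat g Lg p by rewrite /bheat; ring.
under eq_fun => n.
  rewrite (_ : (fun q => _) = fun q => c * (f (sp q) * eta (tm q)) + g (sp q) * eta (tm q));
    last by apply/funext => q; ring.
  rewrite fdiff_lin; over.
by apply: cvgD => //; apply: cvgM => //; exact: cvg_cst.
Qed.

Lemma fdiff_sten_bounded f Lf : tspan a b f Lf -> exists2 C, 0 <= C &
  forall n p, `|fdiff (sten n) (fun q => f (sp q) * eta (tm q)) p| <= C.
Proof.
elim=> {f Lf} [P P1 P2 h|c f Lf g Lg _ [C C0 hC] _ [C' C0' hC']].
  exact: (fdiff_sten_prod_bounded h he).
exists (`|c| * C + C'); first by rewrite addr_ge0 ?mulr_ge0.
move=> n p.
rewrite (_ : (fun q => _) = fun q => c * (f (sp q) * eta (tm q)) + g (sp q) * eta (tm q));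
  last by apply/funext => q; ring.
rewrite fdiff_lin; apply: (le_trans (ler_normD _ _)).
by rewrite lerD// normrM ler_wpM2l.
Qed.

Lemma measurable_tspan f Lf : tspan a b f Lf ->
  measurable_fun setT (fun p => f (sp p)) /\ measurable_fun setT (fun p => Lf (sp p)).
Proof.
move=> h; have [h1 h2] := tspan_continuous h; split.
  exact: measurableT_comp (continuous_measurable_RN h1) (@measurable_sp R N).
exact: measurableT_comp (continuous_measurable_RN h2) (@measurable_sp R N).
Qed.

Lemma measurable_tm_comp (h : R -> R) : continuous h ->
  measurable_fun setT (fun p : XT R N => h (tm p)).
Proof.
by move=> ch; exact: measurableT_comp (continuous_measurable_fun ch) (@measurable_tm R N).
Qed.

Lemma measurable_bheat f Lf : tspan a b f Lf -> measurable_fun setT (bheat f Lf).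
Proof.
move=> h; have [h1 h2] := measurable_tspan h; apply: measurable_funB.
  apply: measurableT_comp => //; apply: measurable_funM => //.
  exact: measurable_tm_comp (C2c_continuous1 he).
by apply: measurable_funM => //; exact: measurable_tm_comp (C2c_continuous he).
Qed.

Lemma bheat_bounded f Lf : tspan a b f Lf ->
  exists2 C, 0 <= C & forall p, `|bheat f Lf p| <= C.
Proof.
move=> h; have [M M0 hM] := tspan_bounded h; have [K K0 hK] := C2c_bounded he.
exists (M * K + M * K); first by rewrite addr_ge0 ?mulr_ge0.
move=> p; have [h1 h2] := hM (sp p); have [k1 k2 _] := hK (tm p).
apply: (le_trans (ler_normB _ _)).
by rewrite normrN !normrM lerD// ler_pM.
Qed.

End Span.

End Stencil.

(** * The localised weak identity *)

Section TensorTests.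
Variables (R : realType) (N : nat).
Implicit Types (x : 'rV[R]_N) (P Q D : 'I_N -> R -> R) (e : R -> R) (i j : 'I_N) (c : R).

Definition tensor Q e (p : 'rV[R]_N * R) : R := prodf Q p.1 * e p.2.

Definition upd Q (j : 'I_N) (D : 'I_N -> R -> R) i : R -> R := if i == j then D i else Q i.

Lemma prodf_upd Q j D x : prodf (upd Q j D) x = D j (x 0 j) * \prod_(i | i != j) Q i (x 0 i).
Proof.
rewrite /prodf (bigD1 j)//= /upd eqxx; congr (_ * _).
by apply: eq_bigr => i /negbTE ->.
Qed.

Lemma is_derive_line Q D j x c : (forall y : R, is_derive y 1 (Q j) (D j y)) ->
  is_derive (0 : R) 1 (fun h : R => prodf Q (x + h *: @ei R N j) * c)
    (prodf (upd Q j D) x * c).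
Proof.
move=> hQ.
have -> : (fun h : R => prodf Q (x + h *: @ei R N j) * c) =
    fun h => (\prod_(i | i != j) Q i (x 0 i) * c) * Q j (h + x 0 j).
  apply/funext => h; rewrite /prodf (bigD1 j)//= /ei !mxE !eqxx/= mulr1 (addrC h).
  rewrite [RHS]mulrC mulrA; congr (_ * _ * _).
  by apply: eq_bigr => i ij; rewrite !mxE (negbTE ij) andbF mulr0 addr0.
have H : is_derive (0 : R) 1 (fun h : R => Q j (h + x 0 j)) (D j (x 0 j)).
  by apply: is_derive1_addr; rewrite add0r; exact: hQ.
apply: is_derive_eq (is_derive1Zl _ H) _.
by rewrite prodf_upd; ring.
Qed.

Lemma dx_tensor Q D j e : (forall y : R, is_derive y 1 (Q j) (D j y)) ->
  dx j (tensor Q e) = tensor (upd Q j D) e.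
Proof.
by move=> hQ; apply/funext => p; exact: is_derive1_derive1 (is_derive_line p.1 (e p.2) hQ).
Qed.

Lemma derivable_tensor Q D j e p : (forall y : R, is_derive y 1 (Q j) (D j y)) ->
  derivable (fun h : R => tensor Q e (p.1 + h *: @ei R N j, p.2)) 0 1.
Proof. by move=> hQ; case: (is_derive_line p.1 (e p.2) hQ). Qed.

Lemma tensor_continuous Q e : (forall i, continuous (Q i)) -> continuous e ->
  continuous (tensor Q e).
Proof.
move=> cQ ce p.
have cP : continuous (prodf Q).
  by apply: continuous_prod_seq => i; apply: continuous_coord_comp; exact: cQ.
have h1 : {for p, continuous (fun p : 'rV[R]_N * R => prodf Q p.1)}.
  exact: (@continuous_comp _ _ _ fst (prodf Q) p (@cvg_fst _ _ _ _ _) (cP _)).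
have h2 : {for p, continuous (fun p : 'rV[R]_N * R => e p.2)}.
  exact: (@continuous_comp _ _ _ snd e p (@cvg_snd _ _ _ _ _) (ce _)).
exact: (continuousM h1 h2).
Qed.

Variables (a b : 'rV[R]_N) (a0 b0 : R) (P P1 P2 : 'I_N -> R -> R) (eta eta1 eta2 : R -> R).
Hypotheses (hP : forall i, C2c (a 0 i) (b 0 i) (P i) (P1 i) (P2 i))
  (he : C2c a0 b0 eta eta1 eta2).

(** Derivatives of the factors of [upd P j P1], in which the factor [j] has already been
    differentiated once. *)
Let D2 (j : 'I_N) (i : 'I_N) : R -> R := if i == j then P2 i else P1 i.

Lemma dx_tensor1 j : dx j (tensor P eta) = tensor (upd P j P1) eta.
Proof. by apply: dx_tensor => y; exact: C2c_derive. Qed.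

Let hD2 i j (y : R) : is_derive y 1 (upd P j P1 i) (D2 j i y).
Proof. by rewrite /upd /D2; case: eqP => _; [exact: C2c_derive1|exact: C2c_derive]. Qed.

Lemma dx_tensor2 i j : dx i (dx j (tensor P eta)) = tensor (upd (upd P j P1) i (D2 j)) eta.
Proof. by rewrite dx_tensor1; apply: dx_tensor => y; exact: hD2. Qed.

Lemma dt_tensor : dt (tensor P eta) = tensor P eta1.
Proof.
apply/funext => p; apply: is_derive1_derive1.
exact: (is_derive1Zl (prodf P p.1) (C2c_derive he p.2)).
Qed.

Lemma lap_tensor p : lap (tensor P eta) p = lapf P P2 p.1 * eta p.2.
Proof.
rewrite /lap /lapf mulr_suml; apply: eq_bigr => j _.
rewrite dx_tensor2 /tensor prodf_upd /D2 eqxx; congr (_ * _ * _).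
by apply: eq_bigr => i /negbTE ij; rewrite /upd ij.
Qed.

(** Only the upper end [b0] of the time support is restricted: the function may be nonzero at
    [t = 0], and this is how initial measures enter. Boundary points lie outside the open set [O],
    hence outside the box. *)
Lemma tensor_test_fun (O : set 'rV[R]_N) (T : R) :
  (forall x, (forall i, a 0 i < x 0 i < b 0 i) -> O x) -> b0 <= T ->
  test_fun O T (tensor P eta).
Proof.
move=> abO b0T.
have c0 i : continuous (P i) by exact: C2c_continuous (hP i).
have c1 i : continuous (P1 i) by exact: C2c_continuous1 (hP i).
have c2 i : continuous (P2 i) by exact: C2c_continuous2 (hP i).
have ce : continuous eta by exact: C2c_continuous he.
have cu j i : continuous (upd P j P1 i) by rewrite /upd; case: ifP.
have cD j i : continuous (D2 j i) by rewrite /D2; case: ifP.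
have ext F : continuous F -> ext_cont (QT O T) F.
  by move=> cF; exists F; split=> //; exact: continuous_subspaceT.
split.
- move=> p _; split; first by case: (is_derive1Zl (prodf P p.1) (C2c_derive he p.2)).
  move=> i; split; first by apply: derivable_tensor => y; exact: C2c_derive (hP i) y.
  by move=> j; rewrite dx_tensor1; apply: derivable_tensor (hD2 i j).
- exact/continuous_subspaceT/tensor_continuous.
- split; first by rewrite dt_tensor; apply/ext/tensor_continuous => //; exact: C2c_continuous1 he.
  split=> [i|i j]; first by rewrite dx_tensor1; apply/ext/tensor_continuous.
  rewrite dx_tensor2; apply/ext/tensor_continuous => // k.
  by rewrite {1}/upd; case: ifP.
- move=> x t [_ Ox] _; rewrite /tensor/=.
  have [-> _] := tspan_out (TspanProd hP) (x := x) (fun h => Ox (abO x h)).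
  by rewrite mul0r.
- by move=> x _; rewrite /tensor/= (C2c_out he) ?mulr0// negb_and -!leNgt b0T orbT.
Qed.

End TensorTests.

Section OpenBox.
Variables (R : realType) (N : nat).
Implicit Types a b : 'rV[R]_N.

Definition obox a b : set (RN R N) := [set x | forall i, a 0 i < (x : 'rV[R]_N) 0 i < b 0 i].

Lemma measurable_obox a b : measurable (obox a b).
Proof.
rewrite (_ : obox a b = \bigcap_(i in [set: 'I_N])
    ((fun x : 'rV[R]_N => x 0 i) @^-1` `]a 0 i, b 0 i[%classic)).
  apply: fin_bigcap_measurable => // i _; rewrite -[X in measurable X]setTI.
  exact: (measurable_coord i).
apply/seteqP; split => x /= h i; first by move=> _; rewrite /= in_itv/=; exact: h.
by have := h i I; rewrite /= in_itv.
Qed.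

End OpenBox.

Section WeakIdentity.
Variables (R : realType) (N : nat) (m : {measure set (RN R N) -> \bar R})
  (O : set 'rV[R]_N) (T : R) (g : R -> R) (lam : {measure set (RN R N) -> \bar R})
  (u : 'rV[R]_N * R -> R).
Hypothesis hu : weak_sol m O T g lam u.
Variables (a b : 'rV[R]_N) (c : R).
Hypotheses (mO : measurable (O : set (RN R N)))
  (abO : forall x, obox a b x -> O x)
  (mg : measurable_fun setT g)
  (c0 : 0 < c) (abrho : forall x, obox a b x -> c <= rho O x)
  (lamab : (lam (obox a b) < +oo)%E).

Lemma measurable_QT : measurable (QT O T : set (XT R N)).
Proof.
rewrite (_ : QT O T = O `*` `]0, T[%classic).
  by apply: measurableX => //; exact: measurable_itv.
by apply/seteqP; split => -[x t] [] /= h1 h2; split => //=; move: h2; rewrite in_itv.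
Qed.

Definition zext : XT R N -> R := u \_ (QT O T).
(** Cut to the box because [g u] is integrable only with the weight [rho], which is at least [c]
    there. Test functions vanish off the box, so the weak identity does not see the cut. *)
Definition absorb : XT R N -> R := (g \o u) \_ (QT O T `&` [set p | obox a b p.1]).

Lemma zext_intg : intg (mQ m) zext.
Proof.
case: hu => /(integrable_mkcond _ measurable_QT) + _ _.
by apply: eq_integrable => // p _; rewrite /zext restrict_EFin.
Qed.

Lemma measurable_QTbox : measurable (QT O T `&` [set p | obox a b p.1] : set (XT R N)).
Proof.
apply: measurableI; first exact: measurable_QT.
rewrite -[X in measurable X]setTI; exact: (@measurable_fst _ _ (RN R N) (TR R) measurableT _ (measurable_obox a b)).
Qed.

Lemma absorb_intg : intg (mQ m) absorb.
Proof.
have [hu1 /(integrable_mkcond _ measurable_QT) hu2 _] := hu.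
have mu : measurable_fun (QT O T : set (XT R N)) u.
  by have /measurable_int/measurable_EFinP := hu1.
have hu3 : intg (mQ m) ((fun p => g (u p) * rho O p.1) \_ (QT O T) : XT R N -> R).
  by move: hu2; apply: eq_integrable => // p _; rewrite restrict_EFin.
apply: (intg_le _ (intgZ c^-1 (intg_norm hu3))).
  apply/(measurable_restrictT _ measurable_QTbox).
  apply: (measurableT_comp mg); apply: measurable_funS mu; first exact: measurable_QT.
  by move=> p [].
move=> p; rewrite /absorb patchE; case: ifPn => [|_]; last first.
  by rewrite normr0 mulr_ge0// invr_ge0 ltW.
rewrite inE => -[pQ pO]; rewrite patchE mem_set//= normrM mulrCA ler_peMr//.
by rewrite mulrC ler_pdivlMr// mul1r (le_trans (abrho pO))// ler_norm.
Qed.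

Variables (a0 b0 : R) (eta eta1 eta2 : R -> R).
Hypotheses (he : C2c a0 b0 eta eta1 eta2) (b0T : b0 <= T).

Lemma tspan_intg f Lf : tspan a b f Lf -> intg lam (f : RN R N -> R).
Proof.
move=> h; have [M M0 hM] := tspan_bounded h; have [cf _] := tspan_continuous h.
apply: (intg_le (continuous_measurable_RN cf) (intgZ M (intg_indic (measurable_obox a b) lamab))) => x.
rewrite indicE; have [_|] := boolP (x \in obox a b); first by rewrite mulr1; exact: (hM x).1.
by rewrite notin_setE => xo; have [-> _] := tspan_out h xo; rewrite normr0 mulr0.
Qed.

Let wint f Lf (p : XT R N) : R :=
  zext p * bheat eta eta1 f Lf p + f (sp p) * eta (tm p) * absorb p.

Let wint_intg f Lf : tspan a b f Lf -> intg (mQ m) (wint f Lf).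
Proof.
move=> h; have [C C0 hC] := bheat_bounded he h.
have [M M0 hM] := tspan_bounded h; have [K K0 hK] := C2c_bounded he.
apply: intgD.
  under eq_fun do rewrite mulrC.
  by apply: (intgMb (measurable_bheat he h) hC); exact: zext_intg.
apply: (intgMb (M := M * K)) absorb_intg.
  apply: measurable_funM; first exact: (measurable_tspan h).1.
  exact: measurable_tm_comp (C2c_continuous he).
by move=> p; rewrite normrM ler_pM//; [exact: (hM _).1|have [] := hK (tm p)].
Qed.

(** A single product is a test function for [weak_sol]. Both sides are linear in [f] and all
    integrals are finite, so the identity passes to the span. *)
Lemma weak_identity f Lf : tspan a b f Lf ->
  \int[mQ m]_p (wint f Lf p) = eta 0 * \int[lam]_x f x.
Proof.
move=> h; elim: h => {f Lf} [P P1 P2 hP|k f Lf f' Lf' h ih h' ih']; last first.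
  have fi := tspan_intg h; have f'i := tspan_intg h'.
  have wi := wint_intg h; have wi' := wint_intg h'.
  rewrite (RintD (intgZ k fi) f'i) (RintZ k fi) mulrDr mulrCA -ih -ih'.
  rewrite -(RintZ k wi) -(RintD (intgZ k wi) wi').
  by apply: eq_Rint => p; rewrite /wint /bheat; ring.
have [_ _ /(_ _ (tensor_test_fun hP he abO b0T)) H] := hu.
have hT := TspanProd hP.
have -> : \int[mQ m]_p wint (prodf P) (lapf P P2) p =
    \int[mQ m]_(p in (QT O T : set (XT R N))) (- u p * dt (tensor P eta) p
      - u p * lap (tensor P eta) p + tensor P eta p * g (u p)).
  rewrite [RHS]Rintegral_mkcond; apply: eq_Rint => p; rewrite patchE /wint /zext /absorb !patchE.
  have [pQ|pQ] := boolP (p \in (QT O T : set (XT R N))); last first.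
    rewrite memNset; first by rewrite mul0r mulr0 addr0.
    by move=> [/mem_set]; rewrite (negbTE pQ).
  rewrite (dt_tensor P he) (lap_tensor eta hP) /bheat /tensor -/(sp p) -/(tm p).
  case: ifPn => [_|]; first by rewrite /=; ring.
  rewrite notin_setE => /not_andP[]; first by move: pQ; rewrite inE.
  by move=> /(tspan_out hT)[-> ->]; ring.
rewrite /Rintegral H -/(Rintegral _ _ _) [LHS]Rintegral_mkcond -RintZ; last exact: tspan_intg hT.
apply: eq_Rint => x; rewrite patchE; case: ifPn => [_|]; first exact: mulrC.
rewrite notin_setE => xO; rewrite -/(prodf P x); have [-> _] := tspan_out hT (fun h => xO (abO h)).
by rewrite mulr0.
Qed.

End WeakIdentity.

(** * Kato's inequality *)

(** The factor [f] is merely integrable, so the Lipschitz bound alone does not suffice. Split [|f|]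
    at a level [k]: on the bounded part the Lipschitz constant [a^-1] of the clamp gives a multiple
    of the L^1 distance, and on the small tail the clamps differ by at most 1. No almost everywhere
    convergent subsequence is involved. *)
Lemma clamp_L1_cvg d (T : measurableType d) (R : realType) (mu : {measure set T -> \bar R})
    (a : R) (W : nat -> T -> R) (w f : T -> R) : 0 < a ->
  (forall n, intg mu (W n)) -> intg mu w -> intg mu f ->
  (\int[mu]_x `|W n x - w x|) @[n --> \oo] --> 0 ->
  (\int[mu]_x (`|clamp a (W n x) - clamp a (w x)| * `|f x|)) @[n --> \oo] --> 0.
Proof.
move=> a0 Wi wi fi Ww.
have mc n : measurable_fun setT (fun x => `|clamp a (W n x) - clamp a (w x)|).
  apply: measurableT_comp => //; apply: measurable_funB.
    exact: measurableT_comp (measurable_clamp a) (intg_measurable (Wi n)).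
  exact: measurableT_comp (measurable_clamp a) (intg_measurable wi).
have c1 n x : `| `|clamp a (W n x) - clamp a (w x)| | <= 1.
  rewrite normr_id ler_norml; have := clamp_ge0 a0 (W n x); have := clamp_ge0 a0 (w x).
  have := clamp_le1 a0 (W n x); have := clamp_le1 a0 (w x).
  by move=> h1 h2 h3 h4; apply/andP; split; lra.
have mf := intg_measurable fi.
pose tail (k : nat) x := `|f x| - Num.min `|f x| k%:R.
have mtail k : measurable_fun setT (tail k).
  apply: measurable_funB; first exact: measurableT_comp.
  by apply: measurable_minr => //; exact: measurableT_comp.
have tail0 k x : 0 <= tail k x by rewrite subr_ge0 ge_min lexx.
have tailf k x : `|tail k x| <= `|f x|.
  by rewrite ger0_norm// lerBlDr lerDl le_min normr_ge0/=.
have taili k : intg mu (tail k) by exact: intg_le (mtail k) (intg_norm fi) (tailf k).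
have [||||_] := @Rint_dominated _ _ _ mu tail (fun=> 0) (fun x => `|f x|) => //.
- move=> x; apply: cvg_near_cst; exists (Num.truncn `|f x|).+1 => // n /= fn.
  rewrite /tail min_l ?subrr// (le_trans (ltW (truncnS_gt _)))// ler_nat//.
- exact: intg_norm.
rewrite Rintegral_cst// mul0r => /cvgr0Pnorm_lt tl.
apply/cvgr0Pnorm_lt => e e0; have e20 : 0 < e / 2 by rewrite divr_gt0.
have [k _ /(_ k (leqnn k)) hk] := tl _ e20.
(* The added 1 keeps the factor positive for [k = 0]. *)
have ka0 : 0 < (k%:R + 1) / a by rewrite divr_gt0// ltr_wpDl.
have ek : 0 < e / 2 / ((k%:R + 1) / a) by rewrite divr_gt0.
move/cvgr0Pnorm_lt/(_ _ ek) : Ww; apply: filterS => n.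
have di : intg mu (fun x => `|W n x - w x|) by apply/intg_norm/intgB.
rewrite ger0_norm; last exact: Rint_ge0.
rewrite ltr_pdivlMr// => hn.
rewrite ger0_norm; last by apply: Rint_ge0 => x; rewrite mulr_ge0.
rewrite ger0_norm in hk; last exact: Rint_ge0.
apply: (@le_lt_trans _ _ (\int[mu]_x ((k%:R + 1) / a * `|W n x - w x| + tail k x))).
  apply: Rint_le.
  - exact: (intgMb (mc n) (c1 n) (intg_norm fi)).
  - by apply: intgD => //; exact: intgZ.
  - move=> x; have fE : `|f x| = Num.min `|f x| k%:R + tail k x by rewrite /tail; ring.
    rewrite {1}fE mulrDr; apply: lerD; last first.
      by rewrite ler_piMl//; have := c1 n x; rewrite normr_id.
    apply: (@le_trans _ _ (a^-1 * `|W n x - w x| * (k%:R + 1))); last by rewrite le_eqVlt; apply/orP; left; apply/eqP; ring.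
    have m0 : 0 <= Num.min `|f x| k%:R by rewrite le_min normr_ge0/=.
    have m1 : Num.min `|f x| k%:R <= k%:R + 1 by rewrite ge_min lerDl ler01 orbT.
    have cl := clamp_lipschitz a0 (W n x) (w x).
    exact: ler_pM.
rewrite RintD//; last exact: intgZ.
rewrite RintZ//; move: hn hk; rewrite [_ * ((_ + _) / _)]mulrC; lra.
Qed.

Section Kato.
Variables (R : realType) (N : nat) (lam : {sigma_finite_measure set (XT R N) -> \bar R}).
Hypothesis lamT : forall (q : XT R N) (A : set (XT R N)), measurable A ->
  lam (stshift q @^-1` A) = lam A.
Hypothesis lam_box : forall (a b : 'rV[R]_N) (c e : R), (lam (stbox a b c e) < +oo)%E.
Hypothesis lam_pos : forall a b : R, a < b ->
  (0 < lam (stbox (const_mx a : 'rV[R]_N) (const_mx b) a b))%E.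
Implicit Types (p q : XT R N) (f Lf : 'rV[R]_N -> R).

Section FixedScale.
Variable d : R.
Hypothesis d0 : 0 < d.

Let P (i : 'I_N) : R -> R := cbump (- d) 0.
Let P1 (i : 'I_N) : R -> R := cbump1 (- d) 0.
Let P2 (i : 'I_N) : R -> R := cbump2 (- d) 0.
Let kap (t : R) : R := (kernZ lam d)^-1 * cbump (- d) 0 t.
Let kap1 (t : R) : R := (kernZ lam d)^-1 * cbump1 (- d) 0 t.
Let kap2 (t : R) : R := (kernZ lam d)^-1 * cbump2 (- d) 0 t.

Let k0 q : R := prodf P (sp q) * kap (tm q).

Let hP i : C2c ((const_mx (- d) : 'rV[R]_N) 0 i) ((const_mx 0 : 'rV[R]_N) 0 i) (P i) (P1 i) (P2 i).
Proof. by rewrite !mxE; exact: cbump_C2c. Qed.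

Let hkap : C2c (- d) 0 kap kap1 kap2.
Proof. exact: C2cZ (cbump_C2c _ _) _. Qed.

Let mkerk0 p q : mker lam d (p, q) = k0 (stshift (oppst p) q).
Proof. by rewrite /mker /k0 /kern0 /kap /prodf; ring. Qed.

Definition bkern q : R := bheat kap kap1 (prodf P) (lapf P P2) q.

(** The kernel depends only on [q - p], so differencing a mollification in [p] by the adjoint
    stencil is differencing the kernel in [q] by the original one. Differences of the mollified
    function thus fall on a smooth kernel. *)
Let moll_fdiff w s p : intg lam w ->
  fdiff (opps s) (moll lam d w) p = \int[lam]_q (w q * fdiff s k0 (stshift (oppst p) q)).
Proof.
move=> wi; rewrite /fdiff big_map/=.
pose F (l : R * XT R N) q := l.1 *
  (w q * mker lam d (p, q) - w q * mker lam d (stshift (oppst l.2) p, q)).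
have mi p' : intg lam (fun q => w q * mker lam d (p', q)) by exact: intg_moll_r.
have Fi l : intg lam (F l) by apply/intgZ/intgB.
transitivity (\int[lam]_q (\sum_(l <- s) F l q)).
  rewrite (Rint_sum s Fi).2; apply: eq_bigr => l _.
  by rewrite /F RintZ ?RintB//; exact: intgB.
apply: eq_Rint => q; rewrite mulr_sumr; apply: eq_bigr => l _; rewrite /F !mkerk0.
have -> : stshift (oppst (stshift (oppst l.2) p)) q = stshift l.2 (stshift (oppst p) q).
  rewrite /stshift /oppst /sp /tm/=; congr pair; last by ring.
  by apply/rowP => i; rewrite !mxE; ring.
by ring.
Qed.

Let k0_bounded : exists2 C, 0 <= C & forall n q, `|fdiff (sten R N n) k0 q| <= C.
Proof. exact: (fdiff_sten_bounded hkap (TspanProd hP)). Qed.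

Let k0_cvg q : fdiff (sten R N n) k0 q @[n --> \oo] --> bkern q.
Proof. exact: (fdiff_sten_cvg hkap (TspanProd hP)). Qed.

Let measurable_k0 : measurable_fun setT k0.
Proof.
apply: measurable_funM; first exact: (measurable_tspan (TspanProd hP)).1.
exact: (measurable_tm_comp (C2c_continuous hkap)).
Qed.

Lemma measurable_fdiff s (F : XT R N -> R) : measurable_fun setT F ->
  measurable_fun setT (fdiff s F).
Proof.
move=> mF; apply: measurable_sum => l; apply: measurable_funM => //.
apply: measurable_funB => //; exact: measurableT_comp mF (measurable_stshift _).
Qed.

Variables (w : XT R N -> R) (a b : 'rV[R]_N) (a0 b0 : R) (eta eta1 eta2 : R -> R)
  (f Lf : 'rV[R]_N -> R).
Hypotheses (wi : intg lam w) (hf : tspan a b f Lf) (he : C2c a0 b0 eta eta1 eta2)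
  (f0 : forall x, 0 <= f x) (eta0 : forall t, 0 <= eta t).

Let z p : R := f (sp p) * eta (tm p).

Lemma measurable_tensor : measurable_fun setT z.
Proof.
apply: measurable_funM; first exact: (measurable_tspan hf).1.
exact: (measurable_tm_comp (C2c_continuous he)).
Qed.

Lemma tensor_le : exists2 M, 0 <= M & forall p, z p <= M.
Proof.
have [M M0 hM] := tspan_bounded hf; have [K K0 hK] := C2c_bounded he.
exists (M * K); first exact: mulr_ge0.
move=> p; have [h1 _] := hM (sp p); have [h2 _ _] := hK (tm p).
by rewrite ler_pM// (le_trans (ler_norm _)).
Qed.

Lemma tensor_intg : intg lam z.
Proof.
have [M M0 hM] := tensor_le.
apply: (intg_le measurable_tensor (intgZ M (intg_stbox lam_box a b a0 b0))) => p.
rewrite ger0_norm ?mulr_ge0// indicE.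
have [_|] := boolP (p \in stbox a b a0 b0); first by rewrite mulr1.
rewrite notin_setE /stbox/= mulr0 => /not_andP[h|h].
  rewrite /z (tspan_out hf _).1 ?mul0r// => h'; apply: h => i.
  by have /andP[-> /ltW] := h' i.
rewrite /z (C2c_out he) ?mulr0//; apply/negP => /andP[h1 h2]; apply: h.
by rewrite h1 ltW.
Qed.

(** The limit of the discrete Kato inequality for the mollified function. On the left, the
    differences of [z] are bounded. On the right, those of the mollification fall on the kernel and
    are at most a constant times the L^1 norm of [w], while [z] is integrable. *)
Lemma kato_moll (e : R) : 0 < e ->
  intg lam (fun p => z p * clamp e (moll lam d w p) *
    \int[lam]_q (w q * bkern (stshift (oppst p) q))) /\
  \int[lam]_p (cvxf e (moll lam d w p) * bheat eta eta1 f Lf p) <=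
  \int[lam]_p (z p * clamp e (moll lam d w p) *
    \int[lam]_q (w q * bkern (stshift (oppst p) q))).
Proof.
move=> e0; have Wi := moll_intg lamT lam_box lam_pos d0 wi.
have [M M0 hM] := tensor_le; have mz := measurable_tensor.
have z0 p : 0 <= z p by rewrite mulr_ge0.
have jW := intg_cvxf e0 Wi.
have mcl := measurable_clampW e Wi.
have [C C0 hC] := fdiff_sten_bounded he hf.
have [K K0 hK] := k0_bounded.
have [||||_ L] := @Rint_dominated _ _ _ lam
  (fun n p => cvxf e (moll lam d w p) * fdiff (sten R N n) z p)
  (fun p => cvxf e (moll lam d w p) * bheat eta eta1 f Lf p)
  (fun p => C * `|moll lam d w p|).
- move=> n; apply: measurable_funM; first exact: (intg_measurable jW).
  exact: measurable_fdiff.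
- move=> p; apply: cvgM; first exact: cvg_cst.
  exact: (fdiff_sten_cvg he hf).
- exact/intgZ/intg_norm.
- move=> n p; rewrite normrM mulrC ler_pM// ?hC//; exact: cvxf_norm.
pose Ef n p := \int[lam]_q (w q * fdiff (sten R N n) k0 (stshift (oppst p) q)).
have mk n p : measurable_fun setT (fun q => fdiff (sten R N n) k0 (stshift (oppst p) q)).
  exact: measurableT_comp (measurable_fdiff _ measurable_k0) (measurable_stshift _).
have Efb n p : `|Ef n p| <= K * \int[lam]_q `|w q|.
  rewrite /Ef; under eq_Rintegral do rewrite mulrC.
  by apply: Rint_normMb (mk n p) _ wi => q; exact: hK.
have Efc p : Ef n p @[n --> \oo] --> \int[lam]_q (w q * bkern (stshift (oppst p) q)).
  apply: (@Rint_dominated _ _ _ lam _ _ (fun q => K * `|w q|) _ _ _ _).2.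
  + by move=> n; apply: measurable_funM => //; exact: intg_measurable wi.
  + by move=> q; apply: cvgM; [exact: cvg_cst|exact: k0_cvg].
  + exact/intgZ/intg_norm.
  + by move=> n q; rewrite normrM mulrC ler_wpM2r// hK.
have EfE n p : Ef n p = fdiff (opps (sten R N n)) (moll lam d w) p by rewrite moll_fdiff.
have [||||Ri Rr] := @Rint_dominated _ _ _ lam
  (fun n p => z p * clamp e (moll lam d w p) * Ef n p)
  (fun p => z p * clamp e (moll lam d w p) * \int[lam]_q (w q * bkern (stshift (oppst p) q)))
  (fun p => (K * \int[lam]_q `|w q|) * z p).
- move=> n; apply: measurable_funM; first exact: measurable_funM.
  rewrite (_ : Ef n = fdiff (opps (sten R N n)) (moll lam d w)); last exact/funext/EfE.
  exact: measurable_fdiff (intg_measurable Wi).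
- by move=> p; apply: cvgM; [exact: cvg_cst|exact: Efc].
- exact/intgZ/tensor_intg.
- move=> n p; rewrite normrM mulrC ler_pM// ?Efb//.
  by rewrite normrM (ger0_norm (z0 p)) ger0_norm ?clamp_ge0// ler_piMr// clamp_le1.
split; first exact: Ri.
apply: (ler_cvg_to L Rr); apply: nearW => n.
apply: (le_trans (kato_fdiff lamT e0 Wi mz z0 hM (sten_ge0 R N n))).
by rewrite le_eqVlt; apply/orP; left; apply/eqP; apply: eq_Rint => p; rewrite EfE.
Qed.

(** The translated kernel [q |-> mker lam d (p, q)] as an admissible test function. *)
Definition kerx p x : R := prodf (fun i r => P i (r - sp p 0 i)) x.
Definition kerLx p x : R :=
  lapf (fun i r => P i (r - sp p 0 i)) (fun i r => P2 i (r - sp p 0 i)) x.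
Definition kert p t : R := kap (t - tm p).
Definition kert1 p t : R := kap1 (t - tm p).
Definition kert2 p t : R := kap2 (t - tm p).

Lemma kerx_tspan p (va vb : 'rV[R]_N) : (forall i, va 0 i <= sp p 0 i - d) ->
  (forall i, sp p 0 i <= vb 0 i) -> tspan va vb (kerx p) (kerLx p).
Proof.
move=> h1 h2; apply: (@TspanProd _ _ _ _ _ (fun i r => P1 i (r - sp p 0 i))) => i.
apply: (C2c_widen (C2c_translate (cbump_C2c (- d) 0) (sp p 0 i))).
  by rewrite addrC.
by rewrite add0r.
Qed.

Lemma kert_C2c p : C2c (- d + tm p) (tm p) (kert p) (kert1 p) (kert2 p).
Proof. by have := C2c_translate hkap (tm p); rewrite add0r. Qed.

Lemma kerxt p q : kerx p (sp q) * kert p (tm q) = mker lam d (p, q).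
Proof.
rewrite mkerk0 /k0 /kerx /kert /stshift /oppst /sp /tm /prodf/=; congr (_ * _).
by apply: eq_bigr => i _; rewrite !mxE.
Qed.

Lemma ker_bheat p q : bheat (kert p) (kert1 p) (kerx p) (kerLx p) q =
  bkern (stshift (oppst p) q).
Proof.
rewrite /bkern /bheat /kerx /kerLx /kert /kert1 /stshift /oppst /sp /tm /prodf /lapf/=.
have E i : (q.1 + - p.1) 0 i = q.1 0 i - p.1 0 i by rewrite !mxE.
congr (- (_ * _) - _ * _); first by apply: eq_bigr => i _; rewrite E.
apply: eq_bigr => j _; rewrite E; congr (_ * _).
by apply: eq_bigr => i _; rewrite E.
Qed.

Lemma kerx_ge0 p x : 0 <= kerx p x.
Proof. by apply: prodr_ge0 => i _; exact: cbump_ge0. Qed.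

Lemma kert_ge0 p t : 0 <= kert p t.
Proof.
rewrite mulr_ge0 ?cbump_ge0// invr_ge0; apply: Rint_ge0 => q; exact: kern0_ge0.
Qed.

End FixedScale.
End Kato.

(** * Kato's inequality for an integrable subsolution with measure data *)

Section KatoLimit.
Variables (R : realType) (N : nat) (lam : {sigma_finite_measure set (XT R N) -> \bar R}).
Hypothesis lamT : forall (q : XT R N) (A : set (XT R N)), measurable A ->
  lam (stshift q @^-1` A) = lam A.
Hypothesis lam_box : forall (a b : 'rV[R]_N) (c e : R), (lam (stbox a b c e) < +oo)%E.
Hypothesis lam_pos : forall a b : R, a < b ->
  (0 < lam (stbox (const_mx a : 'rV[R]_N) (const_mx b) a b))%E.
Implicit Types (p q : XT R N) (f Lf : 'rV[R]_N -> R).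
Variables (alpha : {finite_measure set (RN R N) -> \bar R}) (w h : XT R N -> R)
  (va vb ua ub : 'rV[R]_N) (dl T : R).
Hypotheses (wi : intg lam w) (hi : intg lam h) (dl0 : 0 < dl) (dl1 : dl <= 1)
  (uva : forall i, va 0 i + dl <= ua 0 i) (uvb : forall i, ub 0 i <= vb 0 i).
Hypothesis subsol : forall f Lf a0 b0 eta eta1 eta2, tspan va vb f Lf -> (forall x, 0 <= f x) ->
  C2c a0 b0 eta eta1 eta2 -> (forall t, 0 <= eta t) -> b0 <= T ->
  \int[lam]_p (w p * bheat eta eta1 f Lf p + f (sp p) * eta (tm p) * h p)
    <= eta 0 * \int[alpha]_x f x.
Hypothesis sgn : forall p, 0 < w p -> 0 <= h p.

Lemma finite_tspan_intg a b f Lf : tspan a b f Lf -> intg alpha (f : RN R N -> R).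
Proof.
move=> hf; have [M M0 hM] := tspan_bounded hf; have [cf _] := tspan_continuous hf.
apply: (intg_le (continuous_measurable_RN cf) (@finite_measure_integrable_cst _ _ _ alpha setT M measurableT)).
by move=> x; exact: (hM x).1.
Qed.

(** This is [subsol] tested with the kernel of [p], that is, the mollified differential inequality.
    The collar of width [dl] keeps the kernel inside the larger box, and [tm p <= T] keeps it below
    time [T]. *)
Lemma kernel_subsol d p : 0 < d -> d <= dl -> obox ua ub (sp p) -> tm p <= T ->
  \int[lam]_q (w q * bkern lam d (stshift (oppst p) q)) <=
  (\int[alpha]_y mker lam d (p, (y, 0))) - moll lam d h p.
Proof.
move=> d0 ddl up pT.
have hx : tspan va vb (kerx d p) (kerLx d p).
  apply: kerx_tspan => i; have /andP[u1 u2] := up i.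
    by have := uva i; lra.
  by rewrite (le_trans (ltW u2)).
have ht := kert_C2c lam d p.
have := subsol hx (kerx_ge0 d p) ht (kert_ge0 lam d p) pT.
have [C C0 hC] := bheat_bounded ht hx.
have wb : intg lam (fun q => w q * bkern lam d (stshift (oppst p) q)).
  under eq_fun do rewrite -ker_bheat mulrC.
  exact: (intgMb (measurable_bheat ht hx) hC wi).
have hm : intg lam (fun q => h q * mker lam d (p, q)) by exact: intg_moll_r.
have -> : \int[lam]_q (w q * bheat (kert lam d p) (kert1 lam d p) (kerx d p) (kerLx d p) q +
    kerx d p (sp q) * kert lam d p (tm q) * h q) =
    \int[lam]_q (w q * bkern lam d (stshift (oppst p) q)) + moll lam d h p.
  rewrite /moll -RintD//; apply: eq_Rint => q.
  by rewrite ker_bheat kerxt [X in _ + X]mulrC.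
have -> : kert lam d p 0 * \int[alpha]_x kerx d p x = \int[alpha]_y mker lam d (p, (y, 0)).
  rewrite -RintZ; last exact: finite_tspan_intg hx.
  by apply: eq_Rint => y; rewrite -kerxt mulrC.
by lra.
Qed.

Variables (f Lf : 'rV[R]_N -> R) (a0 b0 : R) (eta eta1 eta2 : R -> R).
Hypotheses (hf : tspan ua ub f Lf) (f0 : forall x, 0 <= f x) (he : C2c a0 b0 eta eta1 eta2)
  (eta0 : forall t, 0 <= eta t) (b0T : b0 <= T).

Let z p : R := f (sp p) * eta (tm p).

(** Where [z] does not vanish the point is in reach of [kernel_subsol], which is multiplied by [z]
    times the clamp. In front of the mollified measure the clamp may be replaced by 1, because
    [alpha] is a positive measure. *)
Lemma kato_moll_trace (e d : R) : 0 < e -> 0 < d -> d <= dl ->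
  intg lam (fun p => \int[alpha]_y mker lam d (p, (y, 0))) ->
  \int[lam]_p (cvxf e (moll lam d w p) * bheat eta eta1 f Lf p) <=
  \int[lam]_p (z p * \int[alpha]_y mker lam d (p, (y, 0))) -
  \int[lam]_p (z p * clamp e (moll lam d w p) * moll lam d h p).
Proof.
move=> e0 d0 ddl Ti.
have [Ei Ek] := kato_moll lamT lam_box lam_pos d0 wi hf he f0 eta0 e0.
apply: (le_trans Ek).
have Wi := moll_intg lamT lam_box lam_pos d0 wi.
have Hi := moll_intg lamT lam_box lam_pos d0 hi.
have [M M0 hM] := tensor_le hf he f0 eta0; have mz := measurable_tensor hf he.
have z0 p : 0 <= z p by rewrite mulr_ge0.
have zM p : `|z p| <= M by rewrite ger0_norm//; exact: hM.
have mzc : measurable_fun setT (fun p => z p * clamp e (moll lam d w p)).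
  by apply: measurable_funM => //; exact: measurable_clampW Wi.
have zcM p : `|z p * clamp e (moll lam d w p)| <= M.
  rewrite normrM (ger0_norm (z0 p)) (ger0_norm (clamp_ge0 e0 _)).
  by rewrite (le_trans _ (hM p))// ler_piMr// clamp_le1.
have i1 : intg lam (fun p => z p * \int[alpha]_y mker lam d (p, (y, 0))).
  exact: (intgMb mz zM Ti).
have i2 : intg lam (fun p => z p * clamp e (moll lam d w p) * moll lam d h p).
  exact: (intgMb mzc zcM Hi).
rewrite -RintB//.
have Tr0 p : 0 <= \int[alpha]_y mker lam d (p, (y, 0)) by apply: Rint_ge0 => y; exact: mker_ge0.
pose E p := \int[lam]_q (w q * bkern lam d (stshift (oppst p) q)).
apply: Rint_le => //; first exact: intgB.
move=> p; rewrite -!/(z p); have [->|zp] := eqVneq (z p) 0.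
  by rewrite !mul0r subr0.
have up : obox ua ub (sp p).
  apply: contrapT => nup; move: zp; rewrite /z (tspan_out hf nup).1 mul0r.
  by rewrite eqxx.
have pT : tm p <= T.
  have [//|Tp] := leP (tm p) T; move: zp.
  rewrite /z (C2c_out he) ?mulr0 ?eqxx// negb_and -!leNgt (le_trans b0T (ltW Tp)).
  by rewrite orbT.
have K := kernel_subsol d0 ddl up pT.
have c0 := clamp_ge0 e0 (moll lam d w p); have c1 := clamp_le1 e0 (moll lam d w p).
apply: (@le_trans _ _ (z p * clamp e (moll lam d w p) *
    ((\int[alpha]_y mker lam d (p, (y, 0))) - moll lam d h p))).
  by apply: ler_wpM2l => //; rewrite mulr_ge0.
by rewrite mulrBr lerD2r ler_wpM2r// ler_piMr.
Qed.

Theorem kato_limit (e : R) : 0 < e ->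
  \int[lam]_p (cvxf e (w p) * bheat eta eta1 f Lf p) <= eta 0 * \int[alpha]_x f x.
Proof.
move=> e0.
(* Widths at most [dl], so that [kernel_subsol] applies to each of them. *)
pose dn n : R := dl * hn R n.
have dn0 n : 0 < dn n by rewrite mulr_gt0// hn_gt0.
have hn1 n : hn R n <= 1 by rewrite invf_le1 ?ltr0n// ler1n.
have dndl n : dn n <= dl by rewrite ler_piMr// ltW.
have dn1 n : dn n <= 1 by exact: le_trans (dndl n) dl1.
have dn_cvg : dn n @[n --> \oo] --> 0.
  by rewrite -(mulr0 dl); apply: cvgM; [exact: cvg_cst|exact: cvg_harmonic].
have [M M0 hM] := tensor_le hf he f0 eta0; have mz := measurable_tensor hf he.
have z0 p : 0 <= z p by rewrite mulr_ge0.
have zM p : `|z p| <= M by rewrite ger0_norm//; exact: hM.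
have Wi n := moll_intg lamT lam_box lam_pos (dn0 n) wi.
have Hi n := moll_intg lamT lam_box lam_pos (dn0 n) hi.
have Wc := moll_L1_cvg lamT lam_box lam_pos dn0 dn_cvg dn1 wi.
have Hc := moll_L1_cvg lamT lam_box lam_pos dn0 dn_cvg dn1 hi.
have [C C0 hC] := bheat_bounded he hf; have mb := measurable_bheat he hf.
have L1 : \int[lam]_p (cvxf e (moll lam (dn n) w p) * bheat eta eta1 f Lf p) @[n --> \oo] -->
    \int[lam]_p (cvxf e (w p) * bheat eta eta1 f Lf p).
  apply/subr_cvg0; apply/cvgr0Pnorm_lt => r r0.
  have rC : 0 < r / (C + 1) by rewrite divr_gt0// ltr_wpDl.
  move/cvgr0Pnorm_lt/(_ _ rC) : Wc; apply: filterS => n.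
  have di : intg lam (fun p => cvxf e (moll lam (dn n) w p) - cvxf e (w p)).
    exact: (intgB (intg_cvxf e0 (Wi n)) (intg_cvxf e0 wi)).
  rewrite ger0_norm; last exact: Rint_ge0.
  rewrite ltr_pdivlMr ?ltr_wpDl// => hr.
  have jb W : intg lam W -> intg lam (fun p => cvxf e (W p) * bheat eta eta1 f Lf p).
    move=> Wi'; under eq_fun do rewrite mulrC.
    exact: (intgMb mb hC (intg_cvxf e0 Wi')).
  rewrite -(RintB (jb _ (Wi n)) (jb _ wi)).
  have -> : \int[lam]_p (cvxf e (moll lam (dn n) w p) * bheat eta eta1 f Lf p -
      cvxf e (w p) * bheat eta eta1 f Lf p) =
      \int[lam]_p (bheat eta eta1 f Lf p * (cvxf e (moll lam (dn n) w p) - cvxf e (w p))).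
    by apply: eq_Rint => p; ring.
  apply: (le_lt_trans (Rint_normMb mb hC di)).
  apply: le_lt_trans hr; rewrite mulrC; apply: ler_pM => //; last by rewrite lerDl.
    exact: Rint_ge0.
  apply: Rint_le; [exact: intg_norm|by apply/intg_norm/intgB|].
  by move=> p; exact: cvxf_lipschitz.
have zc (y : 'rV[R]_N) r : 0 < r -> \forall n \near \oo,
    forall p, mker lam (dn n) (p, (y, 0)) != 0 -> `|z p - z (y, 0)| <= r.
  move=> r0; have [cf _] := tspan_continuous hf.
  have ce : continuous eta by exact: C2c_continuous he.
  have h1 : {for ((y, 0) : 'rV[R]_N * R), continuous (fun p : 'rV[R]_N * R => f p.1)}.
    exact: (@continuous_comp _ _ _ fst f _ (@cvg_fst _ _ _ _ _) (cf _)).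
  have h2 : {for ((y, 0) : 'rV[R]_N * R), continuous (fun p : 'rV[R]_N * R => eta p.2)}.
    exact: (@continuous_comp _ _ _ snd eta _ (@cvg_snd _ _ _ _ _) (ce _)).
  have /cvgrPdist_le/(_ r r0)/nbhs_ballP[s /= s0 hs] := continuousM h1 h2.
  have := dn_near dn0 dn_cvg s0; apply: filterS => n dns p /mker_supp[m1 /andP[m2 m3]].
  rewrite distrC; apply: (hs p); split => /=.
    split=> // i j; rewrite ord1; have /andP[m4 m5] := m1 j.
    by rewrite /ball/= ltr_norml; move: m4 m5; rewrite /sp/=; lra.
  by rewrite /ball/= sub0r normrN ltr_norml; move: m2 m3; rewrite /tm/=; lra.
have L2 := mtrace_cvg (alpha := alpha) lamT lam_box lam_pos dn0 mz M0 zM zc.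
have Ti n := mtrace_intg lamT lam_box lam_pos dn0 alpha n.
have -> : eta 0 * \int[alpha]_x f x = \int[alpha]_y z (y, 0).
  rewrite -RintZ; last exact: finite_tspan_intg hf.
  by apply: eq_Rint => y; rewrite /z mulrC.
(* The price of replacing the mollified [h] by [h] and the clamp of the mollified [w] by the clamp
   of [w]. What then remains, [z] times [clamp e (w p) * h p], is nonnegative by [sgn] and is
   dropped. *)
pose err n := M * \int[lam]_p (`|clamp e (moll lam (dn n) w p) - clamp e (w p)| * `|h p|) +
  M * \int[lam]_p `|moll lam (dn n) h p - h p|.
have L3 : err n @[n --> \oo] --> 0.
  apply: cvg0D; rewrite -(mulr0 M); apply: cvgM; try exact: cvg_cst; last exact: Hc.
  exact: clamp_L1_cvg.
have L23 : (\int[lam]_p (z p * mtrace lam dn alpha n p) + err n) @[n --> \oo] -->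
    \int[alpha]_y z (y, 0).
  by rewrite -[X in _ --> X]addr0; apply: cvgD.
apply: (ler_cvg_to L1 L23); apply: nearW => n.
apply: (le_trans (kato_moll_trace e0 (dn0 n) (dndl n) (Ti n))).
rewrite /mtrace/= lerD2l lerNl.
have mzc : measurable_fun setT (fun p => z p * clamp e (moll lam (dn n) w p)).
  by apply: measurable_funM => //; exact: measurable_clampW (Wi n).
have zcM p : `|z p * clamp e (moll lam (dn n) w p)| <= M.
  rewrite normrM (ger0_norm (z0 p)) (ger0_norm (clamp_ge0 e0 _)).
  by rewrite (le_trans _ (hM p))// ler_piMr// clamp_le1.
have mc1 : measurable_fun setT (fun p => `|clamp e (moll lam (dn n) w p) - clamp e (w p)|).
  apply: measurableT_comp => //; apply: measurable_funB; first exact: measurable_clampW (Wi n).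
  exact: measurable_clampW wi.
have c1 p : `| `|clamp e (moll lam (dn n) w p) - clamp e (w p)| | <= 1.
  rewrite normr_id ler_norml; have := clamp_ge0 e0 (moll lam (dn n) w p).
  have := clamp_ge0 e0 (w p); have := clamp_le1 e0 (moll lam (dn n) w p).
  by have := clamp_le1 e0 (w p) => k1 k2 k3 k4; apply/andP; split; lra.
have i1 := intgMb mc1 c1 (intg_norm hi).
have i2 : intg lam (fun p => `|moll lam (dn n) h p - h p|) by apply/intg_norm/intgB.
rewrite /err -(RintZ M i1) -(RintZ M i2) -RintD; [|exact: intgZ|exact: intgZ].
have -> : - (\int[lam]_p (M * (`|clamp e (moll lam (dn n) w p) - clamp e (w p)| * `|h p|) +
    M * `|moll lam (dn n) h p - h p|)) =
    \int[lam]_p (- 1 * (M * (`|clamp e (moll lam (dn n) w p) - clamp e (w p)| * `|h p|) +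
    M * `|moll lam (dn n) h p - h p|)).
  by rewrite RintZ ?mulN1r//; apply: intgD; exact: intgZ.
apply: Rint_le.
- by apply/intgZ/intgD; exact: intgZ.
- exact: (intgMb mzc zcM (Hi n)).
move=> p; rewrite mulN1r lerNl.
have ch : 0 <= clamp e (w p) * h p.
  have [wp|wp] := leP (w p) 0; first by rewrite clamp_neg// mul0r.
  by rewrite mulr_ge0 ?clamp_ge0// sgn.
have zch : 0 <= z p * (clamp e (w p) * h p) by rewrite mulr_ge0.
set c' := clamp e (moll _ _ _ _); set h' := moll _ _ _ _.
move: zch; set c := clamp e (w p) => zch.
have -> : - (z p * c' * h') = - (z p * (c * h p)) - z p * (c' - c) * h p - z p * c' * (h' - h p).
  by ring.
have t1 : - (z p * (c' - c) * h p) <= M * (`|c' - c| * `|h p|).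
  apply: (le_trans (ler_norm _)); rewrite normrN normrM (normrM (z p) (c' - c)) -mulrA.
  by rewrite ler_wpM2r ?mulr_ge0.
have t2 : - (z p * c' * (h' - h p)) <= M * `|h' - h p|.
  apply: (le_trans (ler_norm _)); rewrite normrN normrM ler_wpM2r//; exact: zcM.
lra.
Qed.

End KatoLimit.

(** * Traces and local comparison *)

Section TimeCutoff.
Variables (R : realType) (T : R).
Hypothesis T0 : 0 < T.

Definition en (n : nat) : R := T * hn R n.
(** The bump on []- en n, en n[] equals [en n ^+ 6] at [0]; the normalisation makes the cut-off
    equal to 1 there. *)
Definition cut (n : nat) (t : R) : R := (en n ^+ 6)^-1 * cbump (- en n) (en n) t.
Definition cut1 (n : nat) (t : R) : R := (en n ^+ 6)^-1 * cbump1 (- en n) (en n) t.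
Definition cut2 (n : nat) (t : R) : R := (en n ^+ 6)^-1 * cbump2 (- en n) (en n) t.

Lemma en_gt0 n : 0 < en n. Proof. by rewrite mulr_gt0// hn_gt0. Qed.

Lemma en_leT n : en n <= T.
Proof. by rewrite ler_piMr ?(ltW T0)// invf_le1 ?ltr0n// ler1n. Qed.

Lemma cut_C2c n : C2c (- en n) (en n) (cut n) (cut1 n) (cut2 n).
Proof. exact: C2cZ (cbump_C2c _ _) _. Qed.

Lemma cut0 n : cut n 0 = 1.
Proof.
have e0 := en_gt0 n; rewrite /cut /cbump /posX sub0r opprK subr0 max_l; last exact: ltW.
by rewrite -exprD mulVf// expf_neq0// gt_eqF.
Qed.

Lemma cut_ge0 n t : 0 <= cut n t.
Proof. by rewrite mulr_ge0 ?cbump_ge0// invr_ge0 exprn_ge0// ltW// en_gt0. Qed.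

Lemma cut_le1 n t : cut n t <= 1.
Proof.
have e0 := en_gt0 n; rewrite /cut mulrC ler_pdivrMr ?exprn_gt0// mul1r.
have [/andP[t1 t2]|nt] := boolP (- en n < t < en n); last first.
  by rewrite (C2c_out (cbump_C2c _ _) nt) exprn_ge0// ltW.
rewrite /cbump /posX !max_l; [|lra|lra].
rewrite -exprMn (_ : en n ^+ 6 = (en n ^+ 2) ^+ 3); last by rewrite -exprM.
rewrite lerXn2r ?nnegrE ?sqr_ge0//; first by rewrite mulr_ge0//; lra.
have := sqr_ge0 t; rewrite opprK; move: (en n) => e; rewrite !expr2; nra.
Qed.

Lemma cut1_le0 n t : 0 <= t -> cut1 n t <= 0.
Proof.
move=> t0; have e0 := en_gt0 n.
rewrite /cut1 mulr_ge0_le0 ?invr_ge0 ?exprn_ge0// ?(ltW e0)//.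
have [/andP[t1 t2]|nt] := boolP (- en n < t < en n); last first.
  by rewrite (C2c_out1 (cbump_C2c _ _) nt).
rewrite /cbump1 /posX !max_l; [|lra|lra].
have -> : 3%:R * (t - - en n) ^+ 2 * (en n - t) ^+ 3 -
    (t - - en n) ^+ 3 * (3%:R * (en n - t) ^+ 2) =
    - (6%:R * t * ((t + en n) ^+ 2 * (en n - t) ^+ 2)) by ring.
rewrite oppr_le0; apply: mulr_ge0; first exact: mulr_ge0.
by apply: mulr_ge0; exact: sqr_ge0.
Qed.

Lemma cut_near0 t : 0 < t -> \forall n \near \oo, cut n t = 0.
Proof.
move=> t0; have tT : 0 < t / T by rewrite divr_gt0.
have := near_infty_natSinv_lt (PosNum tT); apply: filterS => n /= nt.
rewrite (C2c_out (cut_C2c n))//; apply/negP => /andP[_]; apply/negP; rewrite -leNgt.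
by move: nt; rewrite ltr_pdivlMr// mulrC /en /hn => /ltW.
Qed.

End TimeCutoff.

Lemma cvg_cstD0 (R : realType) (r : R) (u : nat -> R) :
  u n @[n --> \oo] --> 0 -> (r + u n) @[n --> \oo] --> r.
Proof. by move=> u0; rewrite -[X in _ --> X]addr0; apply: cvgD => //; exact: cvg_cst. Qed.

Section LocalComparison.
Variables (R : realType) (N : nat) (m : {measure set (RN R N) -> \bar R})
  (lam : {sigma_finite_measure set (XT R N) -> \bar R}).
Hypothesis lam_intg : forall F : XT R N -> R, intg (mQ m) F -> intg lam F.
Hypothesis lam_Rint : forall F : XT R N -> R, \int[mQ m]_p F p = \int[lam]_p F p.
Variables (O : set 'rV[R]_N) (T : R) (va vb : 'rV[R]_N) (c : R).
Hypotheses (T0 : 0 < T) (mO : measurable (O : set (RN R N)))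
  (VO : forall x, obox va vb x -> O x) (c0 : 0 < c)
  (Vrho : forall x, obox va vb x -> c <= rho O x).
Implicit Types (p q : XT R N) (f Lf : 'rV[R]_N -> R) (g : R -> R)
  (mu nu : {measure set (RN R N) -> \bar R}) (u v : 'rV[R]_N * R -> R).

Notation ext u := (zext O T u).
Notation abs g u := (absorb O T g u va vb).
Notation ct := (cut T).
Notation ct1 := (cut1 T).

Let mg g : admissible_g g -> measurable_fun setT g.
Proof. by case=> cg _ _; exact: continuous_measurable_fun. Qed.

Lemma admissible_ge0 g r : admissible_g g -> 0 <= g r.
Proof.
case=> _ mono g0; have [r0|r0] := leP r 0; first by rewrite g0.
by rewrite -(g0 0)//; apply: mono; exact: ltW.
Qed.

Lemma ext_intg g mu u : weak_sol m O T g mu u -> intg lam (ext u).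
Proof. by move=> hu; exact: lam_intg (zext_intg hu mO). Qed.

Lemma abs_intg g mu u : admissible_g g -> weak_sol m O T g mu u -> intg lam (abs g u).
Proof.
by move=> ag hu; exact: lam_intg (absorb_intg hu mO (mg ag) c0 Vrho).
Qed.

Lemma ext_le0 u p : tm p <= 0 -> ext u p = 0.
Proof.
move=> p0; rewrite /zext patchE memNset//= => -[_ /andP[h _]].
by move: p0; rewrite leNgt h.
Qed.

Lemma abs_le0 g u p : tm p <= 0 -> abs g u p = 0.
Proof.
move=> p0; rewrite /absorb patchE memNset//= => -[[_ /andP[h _]] _].
by move: p0; rewrite leNgt h.
Qed.

Lemma ident g mu u f Lf a0 b0 eta eta1 eta2 : admissible_g g -> weak_sol m O T g mu u ->
  (mu (obox va vb) < +oo)%E -> tspan va vb f Lf -> C2c a0 b0 eta eta1 eta2 -> b0 <= T ->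
  \int[lam]_p (ext u p * bheat eta eta1 f Lf p + f (sp p) * eta (tm p) * abs g u p) =
  eta 0 * \int[mu]_x f x.
Proof.
move=> ag hu muV hf he b0T.
by rewrite -lam_Rint; exact: (weak_identity hu mO VO (mg ag) c0 Vrho muV he b0T hf).
Qed.

(** The cut-off equals 1 at [t = 0] but tends to 0 at every positive time, and [F] vanishes at the
    other times. *)
Lemma decay (F : XT R N -> R) : intg lam F -> (forall p, tm p <= 0 -> F p = 0) ->
  (\int[lam]_p (ct n (tm p) * F p)) @[n --> \oo] --> 0.
Proof.
move=> Fi F0.
have [||||_] := @Rint_dominated _ _ _ lam (fun n p => ct n (tm p) * F p) (fun=> 0)
  (fun p => `|F p|).
- move=> n; apply: measurable_funM; last exact: intg_measurable Fi.
  exact: (measurable_tm_comp (C2c_continuous (cut_C2c T n))).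
- move=> p; apply: cvg_near_cst; have [p0|p0] := leP (tm p) 0.
    by apply: nearW => n; rewrite F0// mulr0.
  by apply: filterS (cut_near0 T0 p0) => n ->; rewrite mul0r.
- exact: intg_norm.
- by move=> n p; rewrite normrM ler_piMl// ger0_norm ?cut_ge0// cut_le1.
by rewrite Rintegral_cst// mul0r.
Qed.

Section SpaceTest.
Variables (f Lf : 'rV[R]_N -> R).
Hypothesis hf : tspan va vb f Lf.

(** On [t >= 0] the factor [- ct1 n] is nonnegative with integral 1 and concentrates at [t = 0]: an
    approximate unit mass that reads off the initial trace. *)
Definition slope n p : R := f (sp p) * - ct1 n (tm p).

Let mf : measurable_fun setT (fun p : XT R N => f (sp p)).
Proof. exact: (measurable_tspan hf).1. Qed.
Let mLf : measurable_fun setT (fun p : XT R N => Lf (sp p)).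
Proof. exact: (measurable_tspan hf).2. Qed.

Let mulf_intg (h : 'rV[R]_N -> R) (F : XT R N -> R) :
  (h = f \/ h = Lf) -> intg lam F -> intg lam (fun p => h (sp p) * F p).
Proof.
have [M M0 hM] := tspan_bounded hf.
move=> [->|->] Fi; [apply: (intgMb mf _ Fi)|apply: (intgMb mLf _ Fi)] => p.
  exact: (hM _).1.
exact: (hM _).2.
Qed.

Lemma bheatE n p : bheat (ct n) (ct1 n) f Lf p = slope n p - ct n (tm p) * Lf (sp p).
Proof. by rewrite /bheat /slope; ring. Qed.

Lemma slope_bounded n : exists2 C, 0 <= C & forall p, `|slope n p| <= C.
Proof.
have [M M0 hM] := tspan_bounded hf; have [K K0 hK] := C2c_bounded (cut_C2c T n).
exists (M * K); first exact: mulr_ge0.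
move=> p; rewrite normrM normrN ler_pM//; first exact: (hM _).1.
by have [] := hK (tm p).
Qed.

Lemma measurable_slope n : measurable_fun setT (slope n).
Proof.
apply: measurable_funM => //; apply: measurableT_comp => //.
exact: (measurable_tm_comp (C2c_continuous1 (cut_C2c T n))).
Qed.

Lemma slope_intg n (F : XT R N -> R) : intg lam F -> intg lam (fun p => slope n p * F p).
Proof.
move=> Fi; have [C C0 hC] := slope_bounded n.
exact: (intgMb (measurable_slope n) hC Fi).
Qed.

(** In the weak identity with the time factor [ct n], every term except the slope term carries the
    cut-off itself and disappears by [decay]. *)
Lemma trace_cvg g mu u : admissible_g g -> weak_sol m O T g mu u ->
  (mu (obox va vb) < +oo)%E ->
  (\int[lam]_p (slope n p * ext u p)) @[n --> \oo] --> \int[mu]_x f x.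
Proof.
move=> ag hu muV; have ui := ext_intg hu; have ai := abs_intg ag hu.
pose F p := Lf (sp p) * ext u p - f (sp p) * abs g u p.
have Fi : intg lam F.
  by apply: intgB; apply: mulf_intg => //; [right|left].
have F0 p : tm p <= 0 -> F p = 0.
  by move=> p0; rewrite /F ext_le0// abs_le0// !mulr0 subr0.
have E n : \int[lam]_p (slope n p * ext u p) =
    \int[mu]_x f x + \int[lam]_p (ct n (tm p) * F p).
  have := ident ag hu muV hf (cut_C2c T n) (en_leT T0 n); rewrite cut0// mul1r => <-.
  have cFi : intg lam (fun p => ct n (tm p) * F p).
    apply: (intgMb (M := 1) _ _ Fi).
      exact: (measurable_tm_comp (C2c_continuous (cut_C2c T n))).
    by move=> p; rewrite ger0_norm ?cut_ge0// cut_le1.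
  have si := slope_intg n ui.
  have -> : \int[lam]_p (ext u p * bheat (ct n) (ct1 n) f Lf p +
      f (sp p) * ct n (tm p) * abs g u p) =
      \int[lam]_p (slope n p * ext u p - ct n (tm p) * F p).
    by apply: eq_Rint => p; rewrite bheatE /F; ring.
  by rewrite RintB// subrK.
rewrite (_ : (fun n => _) = fun n => \int[mu]_x f x + \int[lam]_p (ct n (tm p) * F p)).
  by apply: cvg_cstD0; exact: decay.
exact/funext/E.
Qed.

End SpaceTest.

Lemma L1_mul_cvg (F : nat -> XT R N -> R) (G b : XT R N -> R) (C : R) :
  (forall k, intg lam (F k)) -> intg lam G -> measurable_fun setT b ->
  (forall p, `|b p| <= C) -> 0 <= C ->
  (\int[lam]_p `|F k p - G p|) @[k --> \oo] --> 0 ->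
  (\int[lam]_p (b p * F k p)) @[k --> \oo] --> \int[lam]_p (b p * G p).
Proof.
move=> Fi Gi mb bC C0 FG; apply/subr_cvg0; apply/norm_cvg0P.
have CFG : (C * \int[lam]_p `|F k p - G p|) @[k --> \oo] --> 0.
  by rewrite -(mulr0 C); apply: cvgM => //; exact: cvg_cst.
apply: cvg0_le CFG => k; rewrite normr_ge0/= -RintB; last 2 first.
- exact: intgMb mb bC (Fi k).
- exact: intgMb mb bC Gi.
have -> : \int[lam]_p (b p * F k p - b p * G p) = \int[lam]_p (b p * (F k p - G p)).
  by apply: eq_Rint => p; rewrite mulrBr.
exact: Rint_normMb mb bC (intgB (Fi k) Gi).
Qed.

Lemma ext_L1_cvg (gk : nat -> R -> R) g mu nu (uk : nat -> 'rV[R]_N * R -> R) u :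
  (forall k, weak_sol m O T (gk k) mu (uk k)) -> weak_sol m O T g nu u ->
  (fun k => (\int[mQ m]_(q in (QT O T : set ((RN R N) * R)))
                   (`|uk k q - u q|)%:E)%E) @ \oo --> 0%E ->
  (\int[lam]_p `|ext (uk k) p - ext u p|) @[k --> \oo] --> 0.
Proof.
move=> huk hu /fine_cvg; apply: cvg_trans; apply: near_eq_cvg; apply: nearW => k.
rewrite /= -lam_Rint -/(Rintegral _ _ _) [LHS]Rintegral_mkcond; apply: eq_Rint => p.
by rewrite /zext !patchE; case: ifP => // _; rewrite subrr normr0.
Qed.

(** Since [g_k (u_k) >= 0], dropping the absorption term and letting first [k] tend to infinity
    and then the support of the cut-off shrink to [t = 0] bounds the trace of the limit. *)
Lemma trace_le (gk : nat -> R -> R) g mu nu (uk : nat -> 'rV[R]_N * R -> R) u f Lf :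
  (forall k, admissible_g (gk k)) -> admissible_g g ->
  (forall k, weak_sol m O T (gk k) mu (uk k)) -> weak_sol m O T g nu u ->
  (\int[lam]_p `|ext (uk k) p - ext u p|) @[k --> \oo] --> 0 ->
  (mu (obox va vb) < +oo)%E -> (nu (obox va vb) < +oo)%E ->
  tspan va vb f Lf -> (forall x, 0 <= f x) ->
  \int[nu]_x f x <= \int[mu]_x f x.
Proof.
move=> agk ag huk hu uku muV nuV hf f0.
have ui := ext_intg hu; have uki k := ext_intg (huk k).
have Lui : intg lam (fun p => Lf (sp p) * ext u p).
  have [M M0 hM] := tspan_bounded hf.
  exact: (intgMb (measurable_tspan hf).2 (fun p => (hM _).2) ui).
have step n : \int[lam]_p (bheat (ct n) (ct1 n) f Lf p * ext u p) <= \int[mu]_x f x.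
  have [C C0 hC] := bheat_bounded (cut_C2c T n) hf.
  have mb := measurable_bheat (cut_C2c T n) hf.
  apply: (cvgr_to_le (L1_mul_cvg uki ui mb hC C0 uku)); apply: nearW => k.
  have := ident (agk k) (huk k) muV hf (cut_C2c T n) (en_leT T0 n).
  rewrite cut0// mul1r => <-.
  have ai := abs_intg (agk k) (huk k).
  have i1 := intgMb mb hC (uki k).
  have [M M0 hM] := tensor_le hf (cut_C2c T n) f0 (cut_ge0 T0 n).
  have mz := measurable_tensor hf (cut_C2c T n).
  have z0 (p : XT R N) : 0 <= f (sp p) * ct n (tm p) by rewrite mulr_ge0// cut_ge0.
  have i2 : intg lam (fun p => f (sp p) * ct n (tm p) * abs (gk k) (uk k) p).
    by apply: (intgMb mz (M := M) _ ai) => p; rewrite ger0_norm.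
  apply: Rint_le => //.
    by apply: intgD => //; under eq_fun do rewrite mulrC.
  move=> p; rewrite mulrC lerDl mulr_ge0// /absorb patchE; case: ifP => // _.
  exact: admissible_ge0.
have L1 := trace_cvg hf ag hu nuV.
have L2 : (\int[lam]_p (ct n (tm p) * (Lf (sp p) * ext u p))) @[n --> \oo] --> 0.
  by apply: decay => // p p0; rewrite ext_le0// mulr0.
have L12 : (\int[lam]_p (slope f n p * ext u p) -
    \int[lam]_p (ct n (tm p) * (Lf (sp p) * ext u p))) @[n --> \oo] --> \int[nu]_x f x.
  by rewrite -[X in _ --> X]subr0; apply: cvgB.
apply: (cvgr_to_le L12); apply: nearW => n; apply: le_trans (step n).
have i1 := slope_intg hf n ui.
have i2 : intg lam (fun p => ct n (tm p) * (Lf (sp p) * ext u p)).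
  apply: (intgMb (M := 1) _ _ Lui).
    exact: (measurable_tm_comp (C2c_continuous (cut_C2c T n))).
  by move=> p; rewrite ger0_norm ?cut_ge0// cut_le1.
rewrite -RintB// le_eqVlt; apply/orP; left; apply/eqP; apply: eq_Rint => p.
by rewrite bheatE; ring.
Qed.

End LocalComparison.

(** * Comparison of the traces of two limit solutions *)

Section Comparison.
Variables (R : realType) (N : nat) (m : {measure set (RN R N) -> \bar R})
  (lam : {sigma_finite_measure set (XT R N) -> \bar R}).
Hypothesis lam_intg : forall F : XT R N -> R, intg (mQ m) F -> intg lam F.
Hypothesis lam_Rint : forall F : XT R N -> R, \int[mQ m]_p F p = \int[lam]_p F p.
Hypothesis lamT : forall (q : XT R N) (A : set (XT R N)), measurable A ->
  lam (stshift q @^-1` A) = lam A.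
Hypothesis lam_box : forall (a b : 'rV[R]_N) (c e : R), (lam (stbox a b c e) < +oo)%E.
Hypothesis lam_pos : forall a b : R, a < b ->
  (0 < lam (stbox (const_mx a : 'rV[R]_N) (const_mx b) a b))%E.
Variables (O : set 'rV[R]_N) (T : R) (va vb ua ub : 'rV[R]_N) (c dl : R).
Hypotheses (T0 : 0 < T) (mO : measurable (O : set (RN R N)))
  (VO : forall x, obox va vb x -> O x) (c0 : 0 < c)
  (Vrho : forall x, obox va vb x -> c <= rho O x) (dl0 : 0 < dl) (dl1 : dl <= 1)
  (uva : forall i, va 0 i + dl <= ua 0 i) (uvb : forall i, ub 0 i <= vb 0 i).
Variables (mu nu mu' nu' : {measure set (RN R N) -> \bar R})
  (alpha beta : {finite_measure set (RN R N) -> \bar R}).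
Hypotheses (muV : (mu (obox va vb) < +oo)%E) (nuV : (nu (obox va vb) < +oo)%E)
  (muV' : (mu' (obox va vb) < +oo)%E) (nuV' : (nu' (obox va vb) < +oo)%E).
Hypothesis jordan : forall A : set (RN R N), measurable A -> A `<=` obox va vb ->
  (mu A + beta A = nu A + alpha A)%E.
Implicit Types (p q : XT R N) (f Lf : 'rV[R]_N -> R).

Lemma Rint_obox (th : {measure set (RN R N) -> \bar R}) f Lf :
  (th (obox va vb) < +oo)%E -> tspan va vb f Lf -> (forall x, 0 <= f x) ->
  (\int[th]_(x in obox va vb) (f x)%:E = (\int[th]_x f x)%:E)%E.
Proof.
move=> thV hf f0; have fi := tspan_intg thV hf.
rewrite [RHS]fineK; last exact: integrable_fin_num fi.
rewrite [LHS]integral_mkcond; apply: eq_integral => x _; rewrite patchE.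
by case: ifPn => //; rewrite notin_setE => xV; rewrite (tspan_out hf xV).1.
Qed.

(** The relation between the four measures on the box integrates to an identity for [f], which
    vanishes off the box. The [beta] term is then discarded. *)
Lemma jordan_test f Lf : tspan va vb f Lf -> (forall x, 0 <= f x) ->
  \int[mu]_x f x <= \int[nu]_x f x + \int[alpha]_x f x.
Proof.
move=> hf f0.
have mV : measurable (obox va vb) by exact: measurable_obox.
have mf : measurable_fun (obox va vb) (fun x => (f x)%:E).
  apply/measurable_EFinP; apply: measurable_funS (continuous_measurable_RN _) => //.
  exact: (tspan_continuous hf).1.
have fin (th : {finite_measure set (RN R N) -> \bar R}) : (th (obox va vb) < +oo)%E.
  by rewrite -ge0_fin_numE// fin_num_measure.
have E : (\int[mu]_(x in obox va vb) (f x)%:E + \int[beta]_(x in obox va vb) (f x)%:E =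
    \int[nu]_(x in obox va vb) (f x)%:E + \int[alpha]_(x in obox va vb) (f x)%:E)%E.
  rewrite -!ge0_integral_measure_add//; try by move=> x _; rewrite lee_fin.
  apply: eq_measure_integral => A mA AV; rewrite /= /msum !big_ord_recl/= !big_ord0 !adde0;
    exact: jordan.
move: E; rewrite (Rint_obox muV hf f0) (Rint_obox nuV hf f0).
rewrite (Rint_obox (fin alpha) hf f0) (Rint_obox (fin beta) hf f0) -!EFinD => -[<-].
by rewrite lerDl Rint_ge0.
Qed.

Variables (g : R -> R) (gk hk : nat -> R -> R) (v u : 'rV[R]_N * R -> R)
  (vk uk : nat -> 'rV[R]_N * R -> R).
Hypotheses (ag : admissible_g g) (agk : forall k, admissible_g (gk k))
  (ahk : forall k, admissible_g (hk k)) (gkg : forall k r, gk k r <= g r)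
  (hvk : forall k, weak_sol m O T (hk k) mu (vk k)) (hv : weak_sol m O T g mu' v)
  (huk : forall k, weak_sol m O T (gk k) nu (uk k)) (hu : weak_sol m O T g nu' u).

Notation ext u := (zext O T u).
Notation abs g u := (absorb O T g u va vb).
Notation ct := (cut T).
Notation ct1 := (cut1 T).

Hypotheses (vkv : (\int[lam]_p `|ext (vk k) p - ext v p|) @[k --> \oo] --> 0)
  (uku : (\int[lam]_p `|ext (uk k) p - ext u p|) @[k --> \oo] --> 0).

Let ei h (lm : {measure set (RN R N) -> \bar R}) w (hw : weak_sol m O T h lm w) :
  intg lam (ext w) := ext_intg lam_intg mO hw.
Let ai h (lm : {measure set (RN R N) -> \bar R}) w (ah : admissible_g h)
    (hw : weak_sol m O T h lm w) : intg lam (abs h w) :=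
  abs_intg lam_intg mO c0 Vrho ah hw.

Lemma kato_step k e f Lf a0 b0 eta eta1 eta2 : 0 < e -> tspan ua ub f Lf ->
  (forall x, 0 <= f x) -> C2c a0 b0 eta eta1 eta2 -> (forall t, 0 <= eta t) -> b0 <= T ->
  \int[lam]_p (cvxf e (ext v p - ext (uk k) p) * bheat eta eta1 f Lf p) <=
  eta 0 * \int[alpha]_x f x.
Proof.
move=> e0 hf f0 he eta0 b0T.
have vi := ei hv; have uki := ei (huk k); have avi := ai ag hv; have aui := ai (agk k) (huk k).
apply: (@kato_limit _ _ lam lamT lam_box lam_pos alpha (fun p => ext v p - ext (uk k) p)
  (fun p => abs g v p - abs (gk k) (uk k) p) va vb ua ub dl T _ _ dl0 dl1 uva uvb _ _
  f Lf a0 b0 eta eta1 eta2 hf f0 he eta0 b0T e e0).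
- exact: intgB.
- exact: intgB.
- move=> {f Lf a0 b0 eta eta1 eta2 hf f0 he eta0 b0T} f Lf a0 b0 eta eta1 eta2 hf f0 he eta0 b0T.
  have I1 := ident lam_Rint mO VO c0 Vrho ag hv muV' hf he b0T.
  have I2 := ident lam_Rint mO VO c0 Vrho (agk k) (huk k) nuV hf he b0T.
  have [C C0 hC] := bheat_bounded he hf; have mb := measurable_bheat he hf.
  have [M M0 hM] := tensor_le hf he f0 eta0; have mz := measurable_tensor hf he.
  have zM (p : XT R N) : `|f (sp p) * eta (tm p)| <= M by rewrite ger0_norm// mulr_ge0.
  have wint (F A : XT R N -> R) : intg lam F -> intg lam A ->
      intg lam (fun p => F p * bheat eta eta1 f Lf p + f (sp p) * eta (tm p) * A p).
    move=> Fi Ai; apply: intgD; last exact: (intgMb mz zM Ai).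
    by under eq_fun do rewrite mulrC; exact: (intgMb mb hC Fi).
  have -> : \int[lam]_p ((ext v p - ext (uk k) p) * bheat eta eta1 f Lf p +
      f (sp p) * eta (tm p) * (abs g v p - abs (gk k) (uk k) p)) =
      eta 0 * (\int[mu']_x f x - \int[nu]_x f x).
    rewrite mulrBr -I1 -I2 -RintB; [|exact: wint|exact: wint].
    by apply: eq_Rint => p; ring.
  apply: ler_wpM2l => //; rewrite lerBlDl.
  apply: le_trans (jordan_test hf f0).
  exact: (trace_le lam_intg lam_Rint T0 mO VO c0 Vrho ahk ag hvk hv vkv muV muV' hf f0).
(* Where [u_k < v], one has [g_k u_k <= g_k v <= g v]. Off the cylinder both extensions are 0, so
   the strict inequality cannot hold there. *)
- move=> p; rewrite /zext /absorb !patchE.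
  have [pQ|_] := boolP (p \in (QT O T : set (XT R N))); last by rewrite subrr ltxx.
  rewrite subr_gt0 => uv; case: ifP => _; last by rewrite subrr.
  rewrite subr_ge0; apply: (le_trans _ (gkg k _)).
  by have [_ mono _] := agk k; apply: mono; exact: ltW.
Qed.

Lemma cvxf_bheat_intg e n f Lf (w : XT R N -> R) : 0 < e -> tspan ua ub f Lf -> intg lam w ->
  intg lam (fun p => cvxf e (w p) * bheat (ct n) (ct1 n) f Lf p).
Proof.
move=> e0 hf wi; have [C C0 hC] := bheat_bounded (cut_C2c T n) hf.
under eq_fun do rewrite mulrC.
exact: (intgMb (measurable_bheat (cut_C2c T n) hf) hC (intg_cvxf e0 wi)).
Qed.

(** The absorption terms no longer occur after [kato_step]. L^1 convergence of [u_k] is all that the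
    limit uses, since [cvxf e] is 1-Lipschitz and the test factor is bounded. *)
Lemma kato_limit_k e n f Lf : 0 < e -> tspan ua ub f Lf -> (forall x, 0 <= f x) ->
  \int[lam]_p (cvxf e (ext v p - ext u p) * bheat (ct n) (ct1 n) f Lf p) <=
  \int[alpha]_x f x.
Proof.
move=> e0 hf f0.
have [C C0 hC] := bheat_bounded (cut_C2c T n) hf.
have mb := measurable_bheat (cut_C2c T n) hf.
have wi := intgB (ei hv) (ei hu).
have wki k := intgB (ei hv) (ei (huk k)).
have L : (\int[lam]_p (bheat (ct n) (ct1 n) f Lf p * cvxf e (ext v p - ext (uk k) p)))
    @[k --> \oo] --> \int[lam]_p (bheat (ct n) (ct1 n) f Lf p * cvxf e (ext v p - ext u p)).
  apply: (L1_mul_cvg (fun k => intg_cvxf e0 (wki k)) (intg_cvxf e0 wi) mb hC C0).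
  apply: cvg0_le uku => k; rewrite Rint_ge0//=; apply: Rint_le.
  - exact: (intg_norm (intgB (intg_cvxf e0 (wki k)) (intg_cvxf e0 wi))).
  - exact: (intg_norm (intgB (ei (huk k)) (ei hu))).
  - move=> p; apply: (le_trans (cvxf_lipschitz e0 _ _)).
    by rewrite (_ : _ - _ = ext u p - ext (uk k) p) ?(distrC (ext u p))//; ring.
under eq_Rintegral do rewrite mulrC.
apply: (cvgr_to_le L); apply: nearW => k.
have := kato_step k e0 hf f0 (cut_C2c T n) (cut_ge0 T0 n) (en_leT T0 n).
by rewrite cut0// mul1r; under eq_Rintegral do rewrite mulrC.
Qed.

(** The slope integrals [A n] tend to the difference of the traces. At fixed [n], replacing [w] by
    [cvxf e w] costs [e / 2] times the slope, which is removed by letting [e] tend to 0. The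
    Laplacian term carries the cut-off and is controlled by [B n], which tends to 0. *)
Theorem trace_comparison f Lf : tspan ua ub f Lf -> (forall x, 0 <= f x) ->
  \int[mu']_x f x <= \int[nu']_x f x + \int[alpha]_x f x.
Proof.
move=> hf f0.
have hfV : tspan va vb f Lf.
  by apply: tspan_widen hf => i //; rewrite (le_trans _ (uva i))// lerDl ltW.
have vi := ei hv; have ui := ei hu; have wi := intgB vi ui.
pose w p : R := ext v p - ext u p.
have w0 p : tm p <= 0 -> w p = 0 by move=> p0; rewrite /w !ext_le0// subrr.
pose A n := \int[lam]_p (slope T f n p * w p).
have LA : A n @[n --> \oo] --> \int[mu']_x f x - \int[nu']_x f x.
  have H1 := trace_cvg lam_intg lam_Rint T0 mO VO c0 Vrho hfV ag hv muV'.
  have H2 := trace_cvg lam_intg lam_Rint T0 mO VO c0 Vrho hfV ag hu nuV'.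
  rewrite (_ : A = fun n => \int[lam]_p (slope T f n p * ext v p) -
    \int[lam]_p (slope T f n p * ext u p)); first exact: cvgB.
  apply/funext => n; rewrite -RintB; [|exact: (slope_intg T hfV n vi)|exact: (slope_intg T hfV n ui)].
  by apply: eq_Rint => p; rewrite mulrBr.
have [M M0 hM] := tspan_bounded hf.
have mLf := (measurable_tspan hf).2.
have Lwi : intg lam (fun p => `|Lf (sp p)| * `|w p|).
  apply: (intgMb (M := M)) (intg_norm wi); first exact: measurableT_comp.
  by move=> p; rewrite normr_id; exact: (hM _).2.
pose B n := \int[lam]_p (ct n (tm p) * (`|Lf (sp p)| * `|w p|)).
have LB : B n @[n --> \oo] --> 0.
  by apply: decay => // p p0; rewrite w0// normr0 mulr0.
have ctLwi n : intg lam (fun p => ct n (tm p) * (`|Lf (sp p)| * `|w p|)).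
  apply: (intgMb (M := 1) _ _ Lwi).
    exact: (measurable_tm_comp (C2c_continuous (cut_C2c T n))).
  by move=> p; rewrite ger0_norm ?cut_ge0// cut_le1.
have key n : A n <= \int[alpha]_x f x + B n.
  have [S S0 hS] := slope_bounded T hf n.
  have ms := measurable_slope T hf n.
  have siB : intg lam (\1_(stbox ua ub 0 T) : XT R N -> R) := intg_stbox lam_box ua ub 0 T.
  pose I := \int[lam]_p (S * \1_(stbox ua ub 0 T) p).
  have I0 : 0 <= I by apply: Rint_ge0 => p; rewrite mulr_ge0.
  apply/ler_addgt0Pr => r r0.
  (* Makes the total cost [e * I] at most [r], also when [I = 0]. *)
  pose e := r / (I + 1).
  have e0 : 0 < e by rewrite divr_gt0// ltr_wpDl.
  have cwi := intg_cvxf e0 wi.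
  have i1 : intg lam (fun p => slope T f n p * w p) by exact: (intgMb ms hS wi).
  have i2 := cvxf_bheat_intg n e0 hf wi.
  have i3 : intg lam (fun p => e * (S * \1_(stbox ua ub 0 T) p)) := intgZ e (intgZ S siB).
  apply: (@le_trans _ _ (\int[lam]_p (cvxf e (w p) * bheat (ct n) (ct1 n) f Lf p +
      ct n (tm p) * (`|Lf (sp p)| * `|w p|) + e * (S * \1_(stbox ua ub 0 T) p)))).
    apply: Rint_le => //; first exact: (intgD (intgD i2 (ctLwi n)) i3).
    move=> p; rewrite bheatE.
    have ctp := cut_ge0 T0 n (tm p).
    (* For [t <= 0] the slope may have the wrong sign, but [w] is zero there. *)
    have [p0|p0] := leP (tm p) 0.
      rewrite (w0 _ p0) mulr0 (cvxf_neg e0 (lexx 0)) mul0r normr0 !mulr0 !add0r.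
      by apply: mulr_ge0; [exact: ltW|exact: mulr_ge0].
    have sl0 : 0 <= slope T f n p.
      by rewrite mulr_ge0// oppr_ge0 cut1_le0// ltW.
    have t1 : slope T f n p * w p <= slope T f n p * (cvxf e (w p) + e / 2).
      by rewrite ler_wpM2l// le_cvxf.
    have t2 : slope T f n p * (e / 2) <= e * (S * \1_(stbox ua ub 0 T) p).
      rewrite indicE; have [_|pB] := boolP (p \in _).
        rewrite mulr1 mulrC ler_pM//; [by rewrite divr_ge0// ltW|lra|].
        exact: le_trans (ler_norm _) (hS p).
      suff -> : slope T f n p = 0 by rewrite mul0r !mulr0.
      move: pB; rewrite notin_setE /stbox/= => /not_andP[h|h].
        rewrite /slope (tspan_out hf _).1 ?mul0r// => h'; apply: h => i.
        by have /andP[-> /ltW] := h' i.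
      rewrite /slope (C2c_out1 (cut_C2c T n)) ?oppr0 ?mulr0//.
      apply/negP => /andP[_ h2]; apply: h; rewrite p0/=.
      by rewrite (le_trans (ltW h2))// en_leT.
    have t3 : cvxf e (w p) * (ct n (tm p) * Lf (sp p)) <=
        ct n (tm p) * (`|Lf (sp p)| * `|w p|).
      rewrite mulrCA ler_wpM2l//; apply: (le_trans (ler_norm _)).
      by rewrite normrM mulrC ler_wpM2l// cvxf_norm.
    move: t1; rewrite mulrDr mulrBr [cvxf e (w p) * slope T f n p]mulrC => t1.
    by move: t1 t2 t3; lra.
  rewrite (RintD (intgD i2 (ctLwi n)) i3) (RintD i2 (ctLwi n)) (RintZ e (intgZ S siB)).
  apply: lerD; first by rewrite lerD2r; exact: kato_limit_k.
  rewrite -/I /e mulrAC ler_pdivrMr ?ltr_wpDl//.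
  by rewrite mulrDr mulr1 lerDl ltW.
have L : (\int[alpha]_x f x + B n) @[n --> \oo] --> \int[alpha]_x f x by exact: cvg_cstD0.
have h : \int[mu']_x f x - \int[nu']_x f x <= \int[alpha]_x f x.
  by apply: ler_cvg_to LA L _; apply: nearW.
by move: h; rewrite lerBlDl.
Qed.

End Comparison.

(** * From test functions to measures *)

Section Approximation.
Variables (R : realType) (N : nat) (I : finType)
  (th : I -> {measure set (RN R N) -> \bar R}) (ua ub : 'rV[R]_N).
Hypothesis thU : forall i, (th i (obox ua ub) < +oo)%E.
Implicit Types (F G : RN R N -> R) (A B : set (RN R N)).
Notation U := (obox ua ub).

(** One [f] has to serve all the measures [th i] at once, because an inequality between measures is
    tested with a single function. The bounds on [f] make the property stable under products. *)
Definition tspan_approx F := [/\ measurable_fun setT F, forall x, 0 <= F x <= \1_U x &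
  forall e, 0 < e -> exists f Lf, [/\ tspan ua ub f Lf, forall x, 0 <= f x <= 1 &
    \sum_i \int[th i]_x `|f x - F x| <= e]].

Let mU : measurable U := measurable_obox ua ub.

Let Ui i : intg (th i) (\1_U : RN R N -> R) := intg_indic mU (thU i).

Lemma indic_le1 A x : (\1_A x : R) <= 1.
Proof. by rewrite indicE; case: (_ \in _). Qed.

Lemma tspan_approx_intg F i : tspan_approx F -> intg (th i) F.
Proof.
move=> [mF F01 _]; apply: (intg_le mF (Ui i)) => x.
by have /andP[F0 F1] := F01 x; rewrite ger0_norm.
Qed.

Lemma tspan_approx01 F x : tspan_approx F -> 0 <= F x <= 1.
Proof. by move=> [_ /(_ x)/andP[-> F1] _]; exact: le_trans F1 (indic_le1 _ _). Qed.

(** The flag [c] chooses between intersection and difference of sets. Constants are not in the span,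
    but [f * (1 - g) = f - f * g] is. *)
Lemma tspan_approx_comb F G (c : bool) : tspan_approx F -> tspan_approx G ->
  tspan_approx (fun x => F x * (if c then G x else 1 - G x)).
Proof.
move=> aF aG; have [mF F01 hF] := aF; have [mG G01 hG] := aG.
have cc (r : R) : 0 <= r <= 1 -> 0 <= (if c then r else 1 - r) <= 1.
  by case: c; lra.
have mK : measurable_fun setT (fun x => F x * (if c then G x else 1 - G x)).
  by apply: measurable_funM => //; case: (c) => //; exact: measurable_funB.
have K01 x : 0 <= F x * (if c then G x else 1 - G x) <= \1_U x.
  have /andP[F0 F1] := F01 x; have /andP[g0 g1] := cc _ (tspan_approx01 x aG).
  by rewrite mulr_ge0//= (le_trans _ F1)// ler_piMr.
split=> // e e0; have e20 : 0 < e / 2 by rewrite divr_gt0.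
have [f [Lf [hf f01 fF]]] := hF _ e20; have [g [Lg [hg g01 gG]]] := hG _ e20.
have [L hL] := tspanM hf hg.
have [L' hL'] : exists L', tspan ua ub (fun x => f x * (if c then g x else 1 - g x)) L'.
  case: (c); first by exists L.
  by exists (fun x => Lf x - L x); apply: tspan_eq (tspanB hf hL) => x //; ring.
exists (fun x => f x * (if c then g x else 1 - g x)), L'; split => //.
  move=> x; have /andP[f0 f1] := f01 x; have /andP[g0 g1] := cc _ (g01 x).
  by rewrite mulr_ge0//= mulr_ile1.
rewrite [e]splitr; apply: le_trans (lerD fF gG); rewrite -big_split/=.
apply: ler_sum => i _.
have fi := tspan_intg (thU i) hf; have gi := tspan_intg (thU i) hg.
have Fi := tspan_approx_intg i aF; have Gi := tspan_approx_intg i aG.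
have i1 := intg_norm (intgB fi Fi); have i2 := intg_norm (intgB gi Gi).
have Ki : intg (th i) (fun x => F x * (if c then G x else 1 - G x)).
  by apply: (intg_le mK (Ui i)) => x; have /andP[K0 K1] := K01 x; rewrite ger0_norm.
rewrite -(RintD i1 i2); apply: Rint_le (intgD i1 i2) _.
  exact: (intg_norm (intgB (tspan_intg (thU i) hL') Ki)).
move=> x; set g' := if c then _ else _; set G' := if c then _ else _.
have gG' : `|g' - G'| = `|g x - G x|.
  rewrite /g' /G'; case: (c) => //.
  by rewrite (_ : _ - _ = G x - g x) ?(distrC (G x))//; ring.
have -> : f x * g' - F x * G' = (f x - F x) * g' + F x * (g' - G') by ring.
rewrite (le_trans (ler_normD _ _))// !normrM gG'.
have /andP[? ?] := cc _ (g01 x); have /andP[? ?] := tspan_approx01 x aF.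
by apply: lerD; [rewrite ler_piMr//|rewrite ler_piMl//]; rewrite ger0_norm.
Qed.

Lemma tspan_approx_lim (Fn : nat -> RN R N -> R) F : (forall n, tspan_approx (Fn n)) ->
  (forall x, Fn n x @[n --> \oo] --> F x) -> tspan_approx F.
Proof.
move=> aFn FnF.
have mFn n : measurable_fun setT (Fn n) by have [] := aFn n.
have mF : measurable_fun setT F by apply: (measurable_fun_cvg mFn) => x _; exact: FnF.
have F01 x : 0 <= F x <= \1_U x.
  apply/andP; split.
    by apply: (cvgr_to_ge (FnF x)); apply: nearW => n; have [_ /(_ x)/andP[]] := aFn n.
  by apply: (cvgr_to_le (FnF x)); apply: nearW => n; have [_ /(_ x)/andP[]] := aFn n.
split=> // e e0.
have Fi i : intg (th i) F.
  by apply: (intg_le mF (Ui i)) => x; have /andP[F0 F1] := F01 x; rewrite ger0_norm.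
have D : (\sum_i \int[th i]_x `|Fn n x - F x|) @[n --> \oo] --> (0 : R).
  rewrite [X in _ --> X](_ : 0 = \sum_(i : I) 0); last by rewrite big1.
  apply: cvg_sum_seq => i.
  have [||||_] := @Rint_dominated _ _ _ (th i) (fun n x => `|Fn n x - F x|) (fun=> 0) \1_U.
  - by move=> n; apply: measurableT_comp => //; exact: measurable_funB.
  - move=> x; rewrite -[X in _ --> X](normr0 R) -(subrr (F x)).
    by apply: cvg_norm; apply: cvgB; [exact: FnF|exact: cvg_cst].
  - exact: Ui.
  - move=> n x; rewrite normr_id; have [_ /(_ x) h1 _] := aFn n; have h2 := F01 x.
    by rewrite ler_norml; move: h1 h2; move: (\1_U x : R) => r h1 h2; lra.
  by rewrite (_ : \int[th i]_x 0 = 0 :> R)// /Rintegral integral0.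
have e20 : 0 < e / 2 by rewrite divr_gt0.
have [n Dn] : exists n, \sum_i \int[th i]_x `|Fn n x - F x| <= e / 2.
  have /cvgrPdist_le/(_ _ e20)[n _ /(_ n (leqnn n))] := D.
  by rewrite sub0r normrN ger0_norm ?sumr_ge0// => [?|i _]; [exists n|exact: Rint_ge0].
have [_ _ /(_ _ e20)[f [Lf [hf f01 fF]]]] := aFn n.
exists f, Lf; split=> //; rewrite [e]splitr; apply: le_trans (lerD fF Dn).
rewrite -big_split/=; apply: ler_sum => i _.
have fi := tspan_intg (thU i) hf; have Fni := tspan_approx_intg i (aFn n).
have i1 := intg_norm (intgB fi Fni); have i2 := intg_norm (intgB Fni (Fi i)).
rewrite -(RintD i1 i2); apply: Rint_le (intgD i1 i2) _.
  exact: (intg_norm (intgB fi (Fi i))).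
by move=> x; rewrite (le_trans _ (ler_normD _ _))// addrA subrK.
Qed.

Lemma tspan_approx_self f Lf : tspan ua ub f Lf -> (forall x, 0 <= f x <= 1) ->
  tspan_approx f.
Proof.
move=> hf f01; split.
- exact: continuous_measurable_RN (tspan_continuous hf).1.
- move=> x; rewrite indicE; have [_|] := boolP (x \in U); first exact: f01.
  by rewrite notin_setE => xU; rewrite (tspan_out hf xU).1 lexx.
- move=> e e0; exists f, Lf; split=> //; rewrite big1 ?ltW// => i _.
  by under eq_Rintegral do rewrite subrr normr0; rewrite /Rintegral integral0.
Qed.

(** Let [h] be a bump with values in [[0, 1]] that is positive exactly on the box. Then
    [1 - (1 - h)^n] tends to the indicator, and it is a polynomial in [h] without constant term,
    hence in the span. *)
Lemma tspan_approx_obox a b : tspan_approx \1_(obox a b `&` U).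
Proof.
pose a' : 'rV[R]_N := \row_i Num.max (a 0 i) (ua 0 i).
pose b' : 'rV[R]_N := \row_i Num.min (b 0 i) (ub 0 i).
have -> : obox a b `&` U = obox a' b'.
  apply/seteqP; split => x /=.
    move=> [h1 h2] i; have /andP[? ?] := h1 i; have /andP[? ?] := h2 i.
    by rewrite !mxE gt_max lt_min; apply/andP; split; apply/andP.
  by move=> h; split => i; have := h i; rewrite !mxE gt_max lt_min =>
    /andP[/andP[? ?] /andP[? ?]]; apply/andP.
have hP := TspanProd (fun i => cbump_C2c (a' 0 i) (b' 0 i)).
have [M M0 hM] := tspan_bounded hP.
set P := prodf _ in hP hM.
have P0 x : 0 <= P x by apply: prodr_ge0 => i _; exact: cbump_ge0.
pose h x := (M + 1)^-1 * P x.
have M1 : 0 < M + 1 by rewrite ltr_wpDl.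
have h01 x : 0 <= h x <= 1.
  rewrite /h mulr_ge0 ?invr_ge0 ?(ltW M1)//= mulrC ler_pdivrMr// mul1r.
  by rewrite (le_trans (ler_norm _))// (le_trans (hM x).1)// lerDl.
have hh : exists L, tspan ua ub h L.
  eexists; apply: tspan_widen (tspanZ (M + 1)^-1 hP) => i; rewrite mxE.
    by rewrite le_max lexx orbT.
  by rewrite ge_min lexx orbT.
have [L hL] := hh.
have fn n : exists L, tspan ua ub (fun x => 1 - (1 - h x) ^+ n) L.
  elim: n => [|n [Ln hn]].
    by exists (fun x => L x - L x); apply: tspan_eq (tspanB hL hL) => x //; rewrite expr0 !subrr.
  have [L' hL'] := tspanM hn hL.
  eexists; apply: tspan_eq (tspanB (tspanD hn hL) hL') => x //; rewrite exprS; ring.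
apply: (@tspan_approx_lim (fun n x => 1 - (1 - h x) ^+ n)) => [n|x].
  have [Ln hn] := fn n; apply: (tspan_approx_self hn) => x; have hx := h01 x.
  have : 0 <= (1 - h x) ^+ n <= 1 by rewrite exprn_ge0 ?exprn_ile1//; lra.
  lra.
rewrite indicE; have [|] := boolP (x \in obox a' b'); rewrite ?inE ?notin_setE => xU.
  have hx : 0 < h x.
    by rewrite mulr_gt0 ?invr_gt0//; apply: prodr_gt0 => i _; apply: cbump_gt0; exact: xU.
  rewrite -[X in _ --> X]subr0; apply: cvgB; first exact: cvg_cst.
  apply: cvg_expr; rewrite ger0_norm; have := h01 x; lra.
have -> : h x = 0 by rewrite /h (tspan_out hP xU).1 mulr0.
by rewrite subr0; under eq_fun do rewrite expr1n subrr; exact: cvg_cst.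
Qed.

(** The sets [A] with this property form a sigma-algebra, complements being taken inside the box. It
    contains half-open boxes as limits of open boxes whose upper ends move down to [b]. *)
Lemma tspan_approx_measurable A : measurable A -> tspan_approx \1_(A `&` U).
Proof.
suff C : sigma_algebra setT [set A | tspan_approx \1_(A `&` U)].
  rewrite measurable_hboxes; move: A; apply: (smallest_sub C) => _ [a [b ->]] /=.
  apply: (@tspan_approx_lim (fun n => \1_(obox a (\row_i (b 0 i + n.+1%:R^-1)) `&` U))).
    by move=> n; exact: tspan_approx_obox.
  move=> x; rewrite indicE.
  have [|] := boolP (x \in _); rewrite ?inE ?notin_setE => hx.
    apply: cvg_near_cst; apply: nearW => n; rewrite indicE mem_set//.
    case: hx => hx Ux; split=> // i; have /andP[-> hb] := hx i.
    by rewrite mxE (le_lt_trans hb)// ltrDl invr_gt0.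
  apply: cvg_near_cst.
  have [Ux|Ux] := pselect (U x); last by apply: nearW => n; rewrite indicE memNset// => -[].
  have /existsNP[i hi] : ~ hbox a b x by move=> h; apply: hx.
  have [ax|ax] := leP (x 0 i) (a 0 i).
    apply: nearW => n; rewrite indicE memNset// => -[/(_ i) + _]; rewrite ltNge ax//.
  have bx : 0 < x 0 i - b 0 i by rewrite subr_gt0 ltNge; apply/negP => h; apply: hi; rewrite ax.
  near=> n; rewrite indicE memNset// => -[/(_ i) + _]; rewrite mxE => /andP[_].
  rewrite ltNge -lerBrDl ltW//; near: n; exact: near_infty_natSinv_lt (PosNum bx).
have aU : tspan_approx \1_U by rewrite -(setIid U); exact: tspan_approx_obox.
have aC F : tspan_approx F -> tspan_approx (fun x => \1_U x * (1 - F x)).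
  exact: (tspan_approx_comb false aU).
split=> [|{}A /= aA|B aB].
- rewrite /= set0I indic0 (_ : cst 0 = (fun x => \1_U x * (1 - \1_U x))); first exact: aC.
  by apply/funext => x; rewrite !indicE; case: (_ \in _); rewrite /= ?subrr ?mulr0 ?mul0r.
- rewrite setTD /mkset (_ : \1__ = (fun x => \1_U x * (1 - \1_(A `&` U) x))); first exact: aC.
  apply/funext => x; rewrite !indicE !in_setI in_setC.
  by case: (_ \in A); case: (_ \in U); rewrite /= ?subrr ?subr0 ?mulr0 ?mul0r ?mulr1.
(* A countable union is reached through its complement: the finite products of the factors
   [1 - \1_(B i)], cut to the box, tend to the indicator of what the union leaves out. *)
- pose P n x : R := \1_U x * \prod_(i < n) (1 - \1_(B i `&` U) x).
  have aP n : tspan_approx (P n).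
    elim: n => [|n ih].
      by rewrite /P; under eq_fun do rewrite big_ord0 mulr1.
    rewrite (_ : P n.+1 = fun x => P n x * (1 - \1_(B n `&` U) x)).
      exact: (tspan_approx_comb false ih (aB n)).
    by apply/funext => x; rewrite /P big_ord_recr/= mulrA.
  rewrite /mkset (_ : \1__ = (fun x => \1_U x * (1 - \1_(U `\` \bigcup_n B n) x))).
    apply: aC; apply: (tspan_approx_lim aP) => x; rewrite /P [X in _ --> X]indicE in_setD.
    rewrite indicE; have [xU|xU] := boolP (x \in U); last first.
      by under eq_fun do rewrite mul0r; exact: cvg_cst.
    have [|xB] := boolP (x \in _); rewrite ?inE.
      move=> [k _ Bk]; apply: cvg_near_cst; exists k.+1 => // n /= kn.
      rewrite (bigD1 (Ordinal kn))//= indicE mem_set ?subrr ?mul0r ?mulr0//.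
      by split=> //; rewrite inE in xU.
    under eq_fun => n.
      rewrite big1 => [|i _]; last first.
        rewrite indicE memNset ?subr0// => -[Bx _].
        by move: xB; rewrite notin_setE => h; apply: h; exists i.
      rewrite mulr1; over.
    exact: cvg_cst.
  apply/funext => x; rewrite !indicE in_setI in_setD.
  by case: (_ \in \bigcup_n _); case: (_ \in U); rewrite /= ?subrr ?subr0 ?mulr0 ?mul0r ?mulr1.
Unshelve. all: by end_near.
Qed.

End Approximation.

(** One function approximates [\1_A] for the three measures with total error [e], so the inequality
    for it becomes the one for [A] up to [e]. *)
Lemma tspan_le_measure (R : realType) (N : nat)
    (mu nu al : {measure set (RN R N) -> \bar R}) (ua ub : 'rV[R]_N) :
  (mu (obox ua ub) < +oo)%E -> (nu (obox ua ub) < +oo)%E -> (al (obox ua ub) < +oo)%E ->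
  (forall f Lf, tspan ua ub f Lf -> (forall x, 0 <= f x) ->
    \int[mu]_x f x <= \int[nu]_x f x + \int[al]_x f x) ->
  forall A : set (RN R N), measurable A -> A `<=` obox ua ub -> (mu A <= nu A + al A)%E.
Proof.
move=> muU nuU alU H A mA AU.
have mU := measurable_obox ua ub.
pose th (i : 'I_3) := nth mu [:: mu; nu; al] i.
have thU i : (th i (obox ua ub) < +oo)%E by case: i => -[|[|[|]]].
have fin (k : {measure set (RN R N) -> \bar R}) : (k (obox ua ub) < +oo)%E -> (k A < +oo)%E.
  by apply: le_lt_trans; apply: le_measure; rewrite ?inE.
have [_ _ apx] := tspan_approx_measurable thU mA.
rewrite (setIidl AU) in apx.
suff : fine (mu A) <= fine (nu A) + fine (al A).
  rewrite -lee_fin EFinD !fineK// ge0_fin_numE//; exact: fin.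
apply/ler_addgt0Pr => e e0.
have [f [Lf [hf f01]]] := apx e e0.
rewrite big_ord_recl big_ord_recl big_ord_recl big_ord0 addr0 /th/= => D.
have est (k : {measure set (RN R N) -> \bar R}) : (k (obox ua ub) < +oo)%E ->
    `|\int[k]_x f x - fine (k A)| <= \int[k]_x `|f x - \1_A x|.
  move=> kU; have fi := tspan_intg kU hf; have Ai := intg_indic mA (fin _ kU).
  by rewrite -(Rint_indic k mA) -(RintB fi Ai); exact: (Rint_norm (intgB fi Ai)).
have := est _ muU; have := est _ nuU; have := est _ alU.
have := H _ _ hf (fun x => proj1 (andP (f01 x))).
move: D; rewrite !ler_norml; lra.
Qed.

(** The difference of [mu] and [nu] is a charge only on a set of finite mass, so Hahn's theorem is
    applied to the restrictions to [V]. The absolute values over [A] inside and outside [P] have the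
    shape of the terms in the total variation. *)
Lemma hahn_difference d (T : measurableType d) (R : realType)
    (mu nu : {measure set T -> \bar R}) (V : set T) : measurable V ->
  (mu V < +oo)%E -> (nu V < +oo)%E ->
  exists (al be : {finite_measure set T -> \bar R}) (P : set T), measurable P /\
    forall A, measurable A -> A `<=` V ->
      [/\ (mu A + be A = nu A + al A)%E, (al A = `|mu (A `&` P) - nu (A `&` P)|)%E &
          (be A = `|mu (A `\` P) - nu (A `\` P)|)%E].
Proof.
move=> mV muV nuV.
have [|mu1 mu1E] := finite_measureP (m := mrestr mu mV); first by rewrite /= /mrestr setTI.
have [|nu1 nu1E] := finite_measureP (m := mrestr nu mV); first by rewrite /= /mrestr setTI.
have mu1V B : B `<=` V -> mu1 B = mu B.
  by move=> BV; rewrite -[LHS]/((mu1 : {measure set T -> \bar R}) B) -mu1E /= /mrestr setIidl.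
have nu1V B : B `<=` V -> nu1 B = nu B.
  by move=> BV; rewrite -[LHS]/((nu1 : {measure set T -> \bar R}) B) -nu1E /= /mrestr setIidl.
pose sg : {charge set T -> \bar R} :=
  cadd (charge_of_finite_measure mu1) (cscale (-1) (charge_of_finite_measure nu1)).
have sgE B : sg B = (mu1 B - nu1 B)%E by rewrite /sg/= /cadd/= /cscale EFinN mulN1e.
have [P [Q PQ]] := Hahn_decomposition sg.
have [[mP posP] [mQ negQ] PQT PQ0] := PQ.
have QE A : A `&` Q = A `\` P.
  apply/seteqP; split => x [Ax Qx]; split => //.
    by move=> Px; have : (P `&` Q) x by []; rewrite PQ0.
  by have : [set: T] x by []; rewrite -PQT => -[].
have finV (k : {measure set T -> \bar R}) : (k V < +oo)%E ->
    forall B, measurable B -> B `<=` V -> k B \is a fin_num.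
  move=> kV B mB BV; rewrite ge0_fin_numE//; apply: le_lt_trans kV.
  by apply: le_measure; rewrite ?inE.
exists (jordan_pos PQ), (jordan_neg PQ), P; split=> // A mA AV.
have mAP := measurableI _ _ mA mP; have mAQ : measurable (A `\` P) by exact: measurableD.
have APV : A `&` P `<=` V by move=> x [/AV].
have AQV : A `\` P `<=` V by move=> x [/AV].
have alE : jordan_pos PQ A = (mu (A `&` P) - nu (A `&` P))%E.
  by rewrite jordan_posE cjordan_posE/= /crestr0/= mem_set// /crestr sgE mu1V// nu1V.
have beE : (jordan_neg PQ A = - (mu (A `\` P) - nu (A `\` P)))%E.
  by rewrite jordan_negE cjordan_negE/= /crestr0/= mem_set// /crestr sgE QE mu1V// nu1V.
split.
- suff : (mu A + jordan_neg PQ A = nu A + jordan_pos PQ A)%E by [].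
  have f1 := finV _ muV _ mAP APV; have f2 := finV _ muV _ mAQ AQV.
  have f3 := finV _ nuV _ mAP APV; have f4 := finV _ nuV _ mAQ AQV.
  have Emu : (mu A = mu (A `\` P) + mu (A `&` P))%E := measureDI mu mA mP.
  have Enu : (nu A = nu (A `\` P) + nu (A `&` P))%E := measureDI nu mA mP.
  rewrite alE beE Emu Enu {Emu Enu}.
  move: f1 f2 f3 f4; move: (mu (A `\` P)) (mu (A `&` P)) (nu (A `\` P)) (nu (A `&` P)).
  by move=> [r1| |] [r2| |] [r3| |] [r4| |] // _ _ _ _; rewrite -?EFinB -?EFinN -?EFinD; congr EFin; ring.
- by rewrite -alE gee0_abs.
- by rewrite -abseN -beE gee0_abs.
Qed.

(** * Lebesgue measure on space-time *)

Section ProductLebesgue.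
Variables (R : realType) (N : nat) (m : {measure set (RN R N) -> \bar R}).
Hypothesis hm : is_lebesgue m.

Lemma mQ_stbox a b c e :
  mQ m (stbox a b c e) = (m (hbox a b) * (@lebesgue_measure R) `]c, e]%classic)%E.
Proof.
rewrite (_ : stbox a b c e = hbox a b `*` `]c, e]%classic).
  by rewrite /mQ product_measure1E//; exact: measurable_hbox.
by apply/seteqP; split => -[x t] [] /= h1 h2; split => //=; move: h2; rewrite in_itv.
Qed.

Lemma mQ_stbox_lty a b c e : (mQ m (stbox a b c e) < +oo)%E.
Proof.
rewrite mQ_stbox (hbox_measure hm) lebesgue_measure_itv/=.
by case: ifP => _; rewrite -?EFinB -?EFinM ?mule0 ltry.
Qed.

Lemma mQ_stbox_gt0 a b : a < b -> (0 < mQ m (stbox (const_mx a) (const_mx b) a b))%E.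
Proof.
move=> ab; rewrite mQ_stbox (hbox_measure hm) lebesgue_measure_itv/= lte_fin ab.
rewrite -EFinB -EFinM lte_fin mulr_gt0 ?subr_gt0//.
by apply: prodr_gt0 => i _; rewrite !mxE lt_max subr_gt0 ab.
Qed.

Lemma mQ_sigma_finite : exists lam : {sigma_finite_measure set (XT R N) -> \bar R},
  (m \x (@lebesgue_measure R))%E = lam :> {measure set (XT R N) -> \bar R}.
Proof.
apply: sigma_finite_measureP.
exists (fun n => stbox (const_mx (- n%:R)) (const_mx n%:R) (- n%:R) n%:R).
  by rewrite bigcup_stbox.
by move=> n; split; [exact: measurable_stbox|exact: mQ_stbox_lty].
Qed.

End ProductLebesgue.

(** * Distance to the boundary *)

Section Distance.
Variables (R : realType) (N : nat) (O : set 'rV[R]_N).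

Lemma coord_le_enorm (x : 'rV[R]_N) i : `|x 0 i| <= enorm x.
Proof.
rewrite /enorm -sqrtr_sqr ler_wsqrtr// (bigD1 i)//= lerDl.
by apply: sumr_ge0 => j _; exact: sqr_ge0.
Qed.

(** Nonemptiness of the boundary matters: the infimum of the empty set is 0 by convention. *)
Lemma le_rho r (x : 'rV[R]_N) : bdry O !=set0 ->
  (forall y : 'rV[R]_N, (forall i, `|y 0 i - x 0 i| <= r) -> O y) -> r <= rho O x.
Proof.
move=> [y0 By0] H; apply: lb_le_inf; first by exists (enorm (x - y0)), y0.
move=> _ [y [_ Oy] <-]; rewrite leNgt; apply/negP => lt; apply: Oy; apply: H => i.
rewrite distrC; apply: le_trans (ltW lt).
by apply: le_trans (coord_le_enorm _ i); rewrite !mxE.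
Qed.

(** Without boundary points [O] would be open and closed. By connectedness of the real line, it
    would then contain the whole line through [x] in the first coordinate direction, against
    boundedness. *)
Lemma bdry_nonempty : (0 < N)%N -> bounded_domain O -> bdry O !=set0.
Proof.
move=> N0 [oO [_ [[x Ox] [M hM]]]].
pose i0 : 'I_N := Ordinal N0.
pose l (t : R) : 'rV[R]_N := x + t *: ei R i0.
have cl : continuous l.
  move=> t; apply: (@continuousD _ _ _ (fun=> x) (fun t : R => t *: ei R i0)).
    exact: cst_continuous.
  exact: (continuousZr_tmp (cvg_id)).
apply/set0P/eqP => B0.
have cO : closed O.
  by move=> y Oy; apply: contrapT => nOy; have : bdry O y by []; rewrite B0.
have lT : l @^-1` O = setT.
  have /connected_intervalP cR : is_interval [set: R] by [].
  apply: cR; first by exists 0; rewrite /= /l scale0r addr0.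
    by exists (l @^-1` O); rewrite ?setTI//; apply: open_comp => // t _; exact: cl.
  by exists (l @^-1` O); rewrite ?setTI//; apply: closed_comp => // t _; exact: cl.
have : O (l (M + `|x 0 i0| + 1)) by have : [set: R] (M + `|x 0 i0| + 1) by []; rewrite -lT.
move=> /hM; apply/negP; rewrite -ltNge; apply: lt_le_trans (coord_le_enorm _ i0).
rewrite !mxE eqxx mulr1; apply: lt_le_trans (ler_norm _).
by have := ler_norm (- x 0 i0); rewrite normrN; lra.
Qed.

End Distance.

(** * The estimate on one cube *)

Lemma reduced_measure_le (R : realType) (N : nat) (m : {measure set (RN R N) -> \bar R})
    (O : set 'rV[R]_N) (T : R) (va vb ua ub : 'rV[R]_N) (c dl : R) (g : R -> R)
    (mu nu mu' nu' : {measure set (RN R N) -> \bar R})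
    (al be : {finite_measure set (RN R N) -> \bar R}) :
  is_lebesgue m -> open O -> 0 < T -> admissible_g g -> 0 < c -> 0 < dl -> dl <= 1 ->
  (forall x, obox va vb x -> O x /\ c <= rho O x) ->
  (forall i, va 0 i + dl <= ua 0 i) -> (forall i, ub 0 i <= vb 0 i) ->
  (mu (obox va vb) < +oo)%E -> (nu (obox va vb) < +oo)%E ->
  (mu' (obox va vb) < +oo)%E -> (nu' (obox va vb) < +oo)%E ->
  (forall A, measurable A -> A `<=` obox va vb -> (mu A + be A = nu A + al A)%E) ->
  reduced_measure m O T g mu mu' -> reduced_measure m O T g nu nu' ->
  forall A, measurable A -> A `<=` obox ua ub -> (mu' A <= nu' A + al A)%E.
Proof.
move=> hm oO T0 ag c0 dl0 dl1 V uva uvb muV nuV muV' nuV' jd.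
move=> [hk [p1 [c1 [d1 [vk [v [[_ ahk _ _ hvk] [vkv _ hv]]]]]]]].
move=> [gk [p2 [c2 [d2 [uk [u [[_ agk gkS gkg huk] [uku _ hu]]]]]]]].
have mO : measurable (O : set (RN R N)) by exact: open_measurable_RN.
have [lam lamE] := mQ_sigma_finite hm.
(* Carries properties of the product measure over to its sigma-finite packaging [lam], one at a
   time. *)
have lamP (P : {measure set (XT R N) -> \bar R} -> Prop) :
    P (m \x (@lebesgue_measure R))%E -> P lam by rewrite lamE.
have lam_intg (F : XT R N -> R) : intg (mQ m) F -> intg lam F.
  by move=> h; apply: (lamP (fun k => intg k F)).
have lam_Rint (F : XT R N -> R) : \int[mQ m]_p F p = \int[lam]_p F p.
  exact: (lamP (fun k => \int[mQ m]_p F p = \int[k]_p F p)).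
have lamT (q : XT R N) A : measurable A -> lam (stshift q @^-1` A) = lam A.
  move=> mA; apply: (lamP (fun k => k (stshift q @^-1` A) = k A)); exact: product_translate.
have lam_box (a b : 'rV[R]_N) (r s : R) : (lam (stbox a b r s) < +oo)%E.
  by apply: (lamP (fun k => k (stbox a b r s) < +oo)%E); exact: mQ_stbox_lty.
have lam_pos (a b : R) : a < b -> (0 < lam (stbox (const_mx a : 'rV[R]_N) (const_mx b) a b))%E.
  move=> ab; apply: (lamP (fun k => 0 < k (stbox (const_mx a) (const_mx b) a b))%E).
  exact: mQ_stbox_gt0.
have UV : obox ua ub `<=` obox va vb.
  move=> x h i; have /andP[h1 h2] := h i; rewrite (lt_le_trans h2 (uvb i)) andbT.
  by apply: le_lt_trans h1; rewrite (le_trans _ (uva i))// lerDl ltW.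
have fin (k : {measure set (RN R N) -> \bar R}) : (k (obox va vb) < +oo)%E ->
    (k (obox ua ub) < +oo)%E.
  by apply: le_lt_trans; apply: le_measure => //; rewrite inE; exact: measurable_obox.
have alU : (al (obox ua ub) < +oo)%E.
  by rewrite -ge0_fin_numE// fin_num_measure//; exact: measurable_obox.
have gkle k r : gk k r <= g r.
  have gn : nondecreasing_seq (gk ^~ r) by apply/nondecreasing_seqP => n; exact: gkS.
  have := nondecreasing_cvgn_le gn (cvgP _ (gkg r)) k.
  by rewrite (cvg_lim _ (gkg r)).
apply: (tspan_le_measure (fin _ muV') (fin _ nuV') alU) => f Lf hf f0.
exact: (trace_comparison lam_intg lam_Rint lamT lam_box lam_pos T0 mO
  (fun x xV => (V x xV).1) c0 (fun x xV => (V x xV).2) dl0 dl1 uva uvb muV nuV muV' nuV' jd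
  ag (fun k => (agk k).1) (fun k => (ahk k).1) gkle hvk hv huk hu
  (ext_L1_cvg lam_Rint hvk hv vkv) (ext_L1_cvg lam_Rint huk hu uku) hf f0).
Qed.

Lemma Mplus1_obox (R : realType) (N : nat) (O : set 'rV[R]_N)
    (mu : {measure set (RN R N) -> \bar R}) (a b : 'rV[R]_N) : Mplus1 O mu ->
  (forall x : 'rV[R]_N, (forall i, a 0 i <= x 0 i <= b 0 i) -> O x) ->
  (mu (obox a b) < +oo)%E.
Proof.
move=> [_ hK _] abO.
pose K : set 'rV[R]_N := [set x | forall i, `[a 0 i, b 0 i]%classic (x ord0 i)].
have KE x : K x -> forall i, a 0 i <= x 0 i <= b 0 i.
  by move=> Kx i; have := Kx i; rewrite /= in_itv.
have cK : compact K := rV_compact (fun i => @segment_compact R (a 0 i) (b 0 i)).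
apply: le_lt_trans (hK K cK _); last by move=> x /KE; exact: abO.
apply: le_measure; rewrite ?inE; first exact: measurable_obox.
  rewrite (_ : K = \bigcap_(i in [set: 'I_N])
      ((fun x : 'rV[R]_N => x 0 i) @^-1` `[a 0 i, b 0 i]%classic)).
    apply: fin_bigcap_measurable => // i _; rewrite -[X in measurable X]setTI.
    exact: (measurable_coord i).
  by apply/seteqP; split => x h i; [move=> _; exact: h|exact: h].
by move=> x h i; have /andP[/ltW h1 /ltW h2] := h i; rewrite /= in_itv/= h1.
Qed.

Lemma Mplus1_rbox (R : realType) (N : nat) (O : set 'rV[R]_N)
    (mu : {measure set (RN R N) -> \bar R}) (q : 'rV[rat]_N * nat) : Mplus1 O mu -> rbox_in O q ->
  (mu (rbox q : set (RN R N)) < +oo)%E.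
Proof.
move=> hmu [r r0 qO].
pose e : R := q.2.+1%:R^-1; pose s i : R := ratr (q.1 0 i).
pose va : 'rV[R]_N := \row_i (s i - (e + r)); pose vb : 'rV[R]_N := \row_i (s i + (e + r)).
apply: le_lt_trans (Mplus1_obox (a := va) (b := vb) hmu _).
  apply: le_measure; rewrite ?inE; [exact: measurable_hbox|exact: measurable_obox|].
  by move=> x hx i; have := hx i; rewrite !mxE -/(s i) -/e; lra.
by move=> x hx; apply: qO => i; rewrite -/(s i) -/e; have := hx i; rewrite !mxE ler_norml; lra.
Qed.

Lemma reduced_measure_dist (R : realType) (N : nat) (m : {measure set (RN R N) -> \bar R})
    (O : set 'rV[R]_N) (T : R) (g : R -> R)
    (mu nu mu' nu' : {measure set (RN R N) -> \bar R}) q :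
  (0 < N)%N -> is_lebesgue m -> bounded_domain O -> 0 < T -> admissible_g g ->
  Mplus1 O mu -> Mplus1 O nu ->
  reduced_measure m O T g mu mu' -> reduced_measure m O T g nu nu' -> rbox_in O q ->
  exists2 P : set (RN R N), measurable P &
    forall A : set (RN R N), measurable A -> A `<=` rbox q ->
    (`|mu' A - nu' A| <=
      `|mu (A `&` P) - nu (A `&` P)| + `|mu (A `\` P) - nu (A `\` P)|)%E.
Proof.
move=> N0 hm hO T0 ag hmu hnu rmu rnu [r r0 qO].
have oO : open O by case: hO.
pose e : R := q.2.+1%:R^-1; pose s i : R := ratr (q.1 0 i).
have e0 : 0 < e by rewrite invr_gt0.
(* Three collars of width [d] around the cube of half-side [e]. The final test functions live in the
   first box, with corners [ua] and [ub]. Kernels may spill into the second, with corners [va] and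
   [vb]. The third keeps points of the second at distance at least [d] from the boundary, and
   [3 * d <= r] leaves all of this inside [O]. *)
pose d := Num.min 1 (r / 3).
have d0 : 0 < d by rewrite lt_min ltr01 divr_gt0.
have d1 : d <= 1 by rewrite ge_min lexx.
have dr : 3 * d <= r by rewrite -ler_pdivlMl// mulrC ge_min lexx orbT.
pose va : 'rV[R]_N := \row_i (s i - (e + 2 * d)); pose vb : 'rV[R]_N := \row_i (s i + (e + 2 * d)).
pose ua : 'rV[R]_N := \row_i (s i - (e + d)); pose ub : 'rV[R]_N := \row_i (s i + (e + d)).
have vE (x : 'rV[R]_N) : (forall i, va 0 i <= x 0 i <= vb 0 i) ->
    forall y : 'rV[R]_N, (forall i, `|y 0 i - x 0 i| <= d) -> O y.
  move=> hx y hy; apply: qO => i; rewrite -/(s i) -/e.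
  have := hx i; have := hy i; rewrite !mxE !ler_norml; lra.
have vO (x : 'rV[R]_N) : (forall i, va 0 i <= x 0 i <= vb 0 i) -> O x.
  by move=> hx; apply: (vE x hx) => i; rewrite subrr normr0 ltW.
have V x : obox va vb x -> O x /\ d <= rho O x.
  move=> hx; have hx' i : va 0 i <= x 0 i <= vb 0 i.
    by have /andP[/ltW -> /ltW ->] := hx i.
  by split; [exact: vO|apply: le_rho (vE x hx'); exact: bdry_nonempty].
have fin k : Mplus1 O k -> (k (obox va vb) < +oo)%E by move=> hk; exact: (Mplus1_obox hk vO).
have [al [be [P [mP jd]]]] := hahn_difference (measurable_obox va vb) (fin _ hmu) (fin _ hnu).
have rU : (rbox q : set (RN R N)) `<=` obox ua ub.
  move=> x hx i; have := hx i; rewrite !mxE -/(s i) -/e; lra.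
have UV : obox ua ub `<=` obox va vb.
  by move=> x hx i; have := hx i; rewrite !mxE; lra.
have uva i : va 0 i + d <= ua 0 i by rewrite !mxE; lra.
have uvb i : ub 0 i <= vb 0 i by rewrite !mxE; lra.
have [gk1 [p1 [c1 [d1' [uk1 [u1 [_ [_ hmu' _]]]]]]]] := rmu.
have [gk2 [p2 [c2 [d2' [uk2 [u2 [_ [_ hnu' _]]]]]]]] := rnu.
exists P => // A mA Aq; have AU := subset_trans Aq rU; have AV := subset_trans AU UV.
have H1 := reduced_measure_le hm oO T0 ag d0 d0 d1 V uva uvb (fin _ hmu) (fin _ hnu)
  (fin _ hmu') (fin _ hnu') (fun B mB BV => let: And3 j _ _ := jd B mB BV in j) rmu rnu mA AU.
(* With the roles exchanged the same decomposition serves, [be] taking the place of [al]. *)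
have H2 := reduced_measure_le hm oO T0 ag d0 d0 d1 V uva uvb (fin _ hnu) (fin _ hmu)
  (fin _ hnu') (fin _ hmu') (fun B mB BV => let: And3 j _ _ := jd B mB BV in esym j) rnu rmu mA AU.
have [_ alE beE] := jd A mA AV.
have finA (k : {measure set (RN R N) -> \bar R}) : (k (obox va vb) < +oo)%E -> k A \is a fin_num.
  move=> kV; rewrite ge0_fin_numE//; apply: le_lt_trans kV.
  by apply: le_measure; rewrite ?inE//; exact: measurable_obox.
rewrite -alE -beE.
have al0 : (0 <= al A)%E by []. have be0 : (0 <= be A)%E by [].
have aloo : al A \is a fin_num by exact: fin_num_measure.
have beoo : be A \is a fin_num by exact: fin_num_measure.
move: H1 H2 al0 be0 aloo beoo (finA _ (fin _ hmu')) (finA _ (fin _ hnu')).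
move: (al A) (be A) (mu' A) (nu' A) => [a1| |] [a2| |] [a3| |] [a4| |]//.
rewrite -!EFinD !lee_fin => *; rewrite ler_norml; lra.
Qed.

(** Countable additivity over the disjoint [D j], in real values so that two measures can be
    subtracted; the part of [B] outside their union is null. *)
Lemma cvg_fine_pieces d (T : measurableType d) (R : realType) (k : {measure set T -> \bar R})
    (B : set T) (D : nat -> set T) : measurable B -> (k B < +oo)%E ->
  (forall j, measurable (D j)) -> trivIset setT D -> k (~` \bigcup_j D j) = 0%E ->
  (\sum_(j < J) fine (k (B `&` D j))) @[J --> \oo] --> fine (k B).
Proof.
move=> mB Boo mD tD k0.
have fin j : k (B `&` D j) \is a fin_num.
  rewrite ge0_fin_numE//; apply: le_lt_trans Boo.
  by apply: le_measure; rewrite ?inE//; exact: measurableI.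
have mU : measurable (\bigcup_j D j) by exact: bigcup_measurable.
have kB : k B = k (\bigcup_j (B `&` D j)).
  rewrite -setI_bigcupr -[in LHS](setIT B) -(setUv (\bigcup_j D j)) setIUr measureU.
  - rewrite [X in (_ + X)%E](_ : _ = 0%E) ?adde0//; apply: subset_measure0 k0.
    + by apply: measurableI => //; exact: measurableC.
    + exact: measurableC.
    + exact: subIsetr.
  - exact: measurableI.
  - by apply: measurableI => //; exact: measurableC.
  - by rewrite setIACA setICr setI0.
have := @measure_sigma_additive _ _ _ k (fun j => B `&` D j)
  (fun j => measurableI _ _ mB (mD j)) (trivIset_setIl (G := fun=> B) tD).
rewrite -kB -{1}(fineK (_ : k B \is a fin_num)) ?ge0_fin_numE//.
move=> /fine_cvg; apply: cvg_trans; apply: near_eq_cvg; apply: nearW => J /=.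
by rewrite big_mkord sum_fine.
Qed.

(** * Total variation from countably many pieces *)

Section TotalVariation.
Variables (R : realType) (N : nat).
Implicit Types (mu nu : {measure set (RN R N) -> \bar R}) (A : set (RN R N)).

Lemma le_tv mu nu A (K : finType) (X : K -> set (RN R N)) :
  (forall k, [/\ measurable (X k), X k `<=` A, (mu (X k) < +oo)%E & (nu (X k) < +oo)%E]) ->
  (forall k l, k != l -> X k `&` X l = set0) ->
  ((\sum_k `|fine (mu (X k)) - fine (nu (X k))|)%:E <= tv mu nu A)%E.
Proof.
move=> hX dX; apply: ereal_sup_ubound; exists #|K|, (fun i => X (enum_val i)); split.
- by move=> i; have [] := hX (enum_val i).
- by move=> i; have [] := hX (enum_val i).
- by move=> i j ij; apply: dX; rewrite (inj_eq enum_val_inj).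
- by move=> i; have [] := hX (enum_val i).
- rewrite -sumEFin (reindex (@enum_val _ K)) /=; last exact/onW_bij/enum_val_bij.
  apply: eq_bigr => i _; have [_ _ h1 h2] := hX (enum_val i).
  by rewrite -[in RHS](fineK (_ : mu _ \is a fin_num)) ?ge0_fin_numE//
    -[in RHS](fineK (_ : nu _ \is a fin_num)) ?ge0_fin_numE// -EFinB abse_EFin.
Qed.

(** The local estimates hold only inside a [D j], and a set [B i] competing for [mu'] and [nu'] may
    have infinite mass for [mu] or [nu]. So each [B i] is cut by the [D j] with [j < J], and each
    piece again by [P j]. The finer pieces lie in some [D j], have finite mass and compete for
    [tv mu nu A]. As [J] grows, the sums recover [B i], since nothing of [mu'] and [nu'] lies
    outside the [D j]. *)
Lemma tv_le_pieces mu nu mu' nu' (D P : nat -> set (RN R N)) :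
  (forall j, [/\ measurable (D j), measurable (P j), (mu (D j) < +oo)%E & (nu (D j) < +oo)%E]) ->
  trivIset setT D -> mu' (~` \bigcup_j D j) = 0%E -> nu' (~` \bigcup_j D j) = 0%E ->
  (forall j A, measurable A -> A `<=` D j -> (`|mu' A - nu' A| <=
      `|mu (A `&` P j) - nu (A `&` P j)| + `|mu (A `\` P j) - nu (A `\` P j)|)%E) ->
  forall A, measurable A -> (tv mu' nu' A <= tv mu nu A)%E.
Proof.
move=> hD tD mu0 nu0 H A mA; apply: ge_ereal_sup => _ [n [B [mB BA dB fB ->]]].
have mD j : measurable (D j) by have [] := hD j.
have mBD i j : measurable (B i `&` D j) by exact: measurableI.
pose d (k l : {measure set (RN R N) -> \bar R}) X := `|fine (k X) - fine (l X)|.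
pose X (t : 'I_n * nat * bool) : set (RN R N) :=
  (B t.1.1 `&` D t.1.2) `&` (if t.2 then P t.1.2 else ~` P t.1.2).
have mX t : measurable (X t).
  apply: measurableI => //; have [_ mP _ _] := hD t.1.2.
  by case: ifP => // _; exact: measurableC.
have le_fin (k : {measure set (RN R N) -> \bar R}) (Y Z : set (RN R N)) :
    measurable Y -> measurable Z -> Y `<=` Z -> (k Z < +oo)%E -> (k Y < +oo)%E.
  by move=> mY mZ YZ; apply: le_lt_trans; apply: le_measure; rewrite ?inE.
have Xmu t : (mu (X t) < +oo)%E.
  by have [_ _ h _] := hD t.1.2; apply: le_fin h => // x [[]].
have Xnu t : (nu (X t) < +oo)%E.
  by have [_ _ _ h] := hD t.1.2; apply: le_fin h => // x [[]].
have BDmu i j : (mu' (B i `&` D j) < +oo)%E.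
  by have [h _] := fB i; apply: le_fin h => // x [].
have BDnu i j : (nu' (B i `&` D j) < +oo)%E.
  by have [_ h] := fB i; apply: le_fin h => // x [].
have dE (k l : {measure set (RN R N) -> \bar R}) Y : (k Y < +oo)%E -> (l Y < +oo)%E ->
    (`|k Y - l Y| = (d k l Y)%:E)%E.
  move=> kY lY; rewrite /d -(abse_EFin (fine (k Y) - fine (l Y))) EFinB.
  by rewrite !fineK ?ge0_fin_numE.
have piece i j : d mu' nu' (B i `&` D j) <= \sum_(b : bool) d mu nu (X (i, j, b)).
  rewrite -lee_fin big_bool /= EFinD -!dE//.
  exact: (H j _ (mBD i j) (@subIsetr _ _ _)).
have key J : ((\sum_(i < n) `|\sum_(j < J) fine (mu' (B i `&` D j)) -
    \sum_(j < J) fine (nu' (B i `&` D j))|)%:E <= tv mu nu A)%E.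
  pose Y (t : 'I_n * 'I_J * bool) := X (t.1.1, val t.1.2, t.2).
  apply: le_trans (le_tv (K := ('I_n * 'I_J * bool)%type) (X := Y) _ _).
  - rewrite lee_fin -(pair_big predT predT (fun ij b => d mu nu (Y (ij, b))))/=.
    rewrite -(pair_big predT predT (fun i j => \sum_b d mu nu (Y (i, j, b))))/=.
    apply: ler_sum => i _; rewrite -sumrB; apply: (le_trans (ler_norm_sum _ _ _)).
    by apply: ler_sum => j _; exact: piece.
  - move=> t; split; [exact: mX| |exact: Xmu|exact: Xnu].
    by move=> x [[Bx _] _]; exact: BA Bx.
  - move=> [[i j] b] [[i' j'] b'] ne; apply/seteqP; split => // x [[[/= Bi Dj] Pb] [[/= Bi' Dj'] Pb']].
    have ii : i = i'.
      by apply/eqP/negP => /negP/dB h; have : (B i `&` B i') x by []; rewrite h.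
    have jj : j = j' by apply: val_inj; apply: (tD _ _ I I); exists x.
    move: ne Pb Pb'; rewrite -ii -jj.
    by case: b b' => -[]; rewrite ?eqxx//.
have -> : (\sum_(i < n) `|mu' (B i) - nu' (B i)|)%E = (\sum_(i < n) d mu' nu' (B i))%:E.
  by rewrite -sumEFin; apply: eq_bigr => i _; have [h1 h2] := fB i; exact: dE.
have L : (\sum_(i < n) `|\sum_(j < J) fine (mu' (B i `&` D j)) -
    \sum_(j < J) fine (nu' (B i `&` D j))|) @[J --> \oo] --> \sum_(i < n) d mu' nu' (B i).
  apply: cvg_sum_seq => i; have [h1 h2] := fB i.
  by apply: cvg_norm; apply: cvgB; exact: cvg_fine_pieces.
case: (tv mu nu A) key => [r| |] key; [|by rewrite leey|by have := key 0%N].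
by rewrite lee_fin; apply: (cvgr_to_le L); apply: nearW => J; rewrite -lee_fin.
Qed.

End TotalVariation.

Theorem theorem2p21 (R : realType) (N : nat) (hN : (0 < N)%N)
  (m : {measure set (RN R N) -> \bar R}) (hm : is_lebesgue m)
  (O : set 'rV[R]_N) (hO : bounded_domain O) (T : R) (hT : 0 < T)
  (g : R -> R) (hg : admissible_g g)
  (mu nu mu' nu' : {measure set (RN R N) -> \bar R})
  (hmu : Mplus1 O mu) (hnu : Mplus1 O nu)
  (hmu' : reduced_measure m O T g mu mu') (hnu' : reduced_measure m O T g nu nu') :
  forall A : set (RN R N), measurable A -> (tv mu' nu' A <= tv mu nu A)%E.
Proof.
(* Enumerates the admissible rational cubes; numbers that code none of them give the empty set. The
   cubes overlap, so [seqDU] cuts them to disjoint sets, and these inherit the local estimates. *)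
pose G (n : nat) : set (RN R N) :=
  if unpickle n is Some q then if pselect (rbox_in O q) then rbox q else set0 else set0.
have mG n : measurable (G n).
  rewrite /G; case: unpickle => [q|]; last exact: measurable0.
  by case: pselect => ?; [exact: measurable_hbox|exact: measurable0].
have GO : \bigcup_n G n = O.
  have oO : open O by case: hO.
  rewrite (open_bigcup_rbox oO); apply/seteqP; split => x.
    move=> [n _]; rewrite /G; case: unpickle => // q; case: pselect => // qO qx.
    by exists q.
  by move=> [q qO qx]; exists (pickle q) => //; rewrite /G pickleK; case: pselect.
have GP n : exists P : set (RN R N), [/\ measurable P, (mu (G n) < +oo)%E, (nu (G n) < +oo)%E &
    forall A : set (RN R N), measurable A -> A `<=` G n -> (`|mu' A - nu' A| <=
      `|mu (A `&` P) - nu (A `&` P)| + `|mu (A `\` P) - nu (A `\` P)|)%E].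
  have triv : exists P : set (RN R N), [/\ measurable P, (mu set0 < +oo)%E, (nu set0 < +oo)%E &
    forall A : set (RN R N), measurable A -> A `<=` set0 -> (`|mu' A - nu' A| <=
      `|mu (A `&` P) - nu (A `&` P)| + `|mu (A `\` P) - nu (A `\` P)|)%E].
    exists set0; rewrite !measure0; split=> // A _; rewrite subset0 => ->.
    by rewrite !measure0 subee// abse0 adde_ge0.
  rewrite /G; case: unpickle => // q; case: pselect => // qO.
  have [P mP hP] := reduced_measure_dist hN hm hO hT hg hmu hnu hmu' hnu' qO.
  by exists P; split=> //; exact: Mplus1_rbox qO.
have [P hP] := choice GP.
have DG n : seqDU G n `<=` G n by exact: subDsetl.
have mD n : measurable (seqDU G n).
  by apply: measurableD => //; exact: bigsetU_measurable.
have DO : \bigcup_n seqDU G n = O by rewrite -seqDU_bigcup_eq.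
have [gk1 [p1 [c1 [d1 [uk1 [u1 [_ [_ [mu0 _ _] _]]]]]]]] := hmu'.
have [gk2 [p2 [c2 [d2 [uk2 [u2 [_ [_ [nu0 _ _] _]]]]]]]] := hnu'.
apply: (@tv_le_pieces _ _ mu nu mu' nu' (seqDU G) P); rewrite ?DO//.
- move=> j; have [mP h1 h2 _] := hP j; split=> //.
    by apply: le_lt_trans h1; apply: le_measure; rewrite ?inE.
  by apply: le_lt_trans h2; apply: le_measure; rewrite ?inE.
- move=> j A mA AD; have [_ _ _ h] := hP j; apply: h => //.
  exact: subset_trans AD (DG j).
Qed.
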